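(* Assume the proposal densities satisfy $\pi_{N,N+1}(\mathbf q_{\mathrm{new}},\mathbf p_{\mathrm{new}};\mathbf q,\mathbf p)=\pi_{N,N+1}(\mathbf q_{\mathrm{new}},-\mathbf p_{\mathrm{new}};\mathbf q,-\mathbf p)$ for all $N,\mathbf q,\mathbf p,\mathbf q_{\mathrm{new}},\mathbf p_{\mathrm{new}}$. Then for any given time $T>0$, the transition kernel $\Gamma_T(\varphi_N\to\varphi_M)$ of the ideal DHMC algorithm with fixed simulation time $T$ (defined in the context) satisfies the detailed balance condition with respect to $\hat\pi(\varphi)$: $$\hat\pi(\varphi_N)\,\Gamma_T(\varphi_N\to\varphi_M)=\hat\pi(\varphi_M)\,\Gamma_T(\varphi_M\to\varphi_N)$$ for all $N,M\ge0$, $\varphi_N\in V_{d_N}\times[N,N+1)$, $\varphi_M\in V_{d_M}\times[M,M+1)$, understood as an equality of measures in $(\varphi_N,\varphi_M)$: for all Borel sets $A\subset V_{d_N}\times[N,N+1)$ and $B\subset V_{d_M}\times[M,M+1)$, $$\int_A\hat\pi(\varphi)\,\Gamma_T(\varphi\to B)\,d\varphi=\int_B\hat\pi(\varphi)\,\Gamma_T(\varphi\to A)\,d\varphi .$$ Consequently, the ideal DHMC algorithm with random simulation time $T\sim\mathrm{UNIF}[T_{\min},T_{\max}]$, whose transition kernel is $\Gamma=\frac1{T_{\max}-T_{\min}}\int_{T_{\min}}^{T_{\max}}\Gamma_T\,dT$, satisfies the detailed balance condition with respect to the target distribution $\hat\pi(\mathbf q,n)$, i.e. the same identity holds with $\Gamma_T$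 replaced by $\Gamma$.
   Context: **Target and extended distribution.** Let $\beta,m,m_n>0$ be constants. Let $(d_N)_{N\ge0}$ be strictly increasing nonnegative integers and $V_{d_N}\subset\mathbb R^{d_N}$ domains such that the projection of $V_{d_{N+1}}$ onto the first $d_N$ coordinates is $V_{d_N}$. For each integer $N\ge 0$ let $\mathcal U_N:V_{d_N}\to\mathbb R$ be a smooth potential, with $Z_\beta=\sum_N\int_{V_{d_N}}e^{-\beta\mathcal U_N(\mathbf q)}d\mathbf q<\infty$. The target is $\pi(\mathbf q,N)=Z_\beta^{-1}e^{-\beta\mathcal U_N(\mathbf q)}$, $\mathbf q\in V_{d_N}$. The index is embedded in a continuous variable $n\in[0,\infty)$: on $\bigcup_{N\ge0}V_{d_N}\times[N,N+1)$ put $\hat\pi(\mathbf q,n)=\pi(\mathbf q,N)$ for $n\in[N,N+1)$. Add momenta $\mathbf p\in\mathbb R^{d_N}$ (when $n\in[N,N+1)$) and $p_n\in\mathbb R$, with $K(\mathbf p)=\|\mathbf p\|^2/(2m)$ and $K_n(p_n)=|p_n|/m_n$. Write $\varphi=(\mathbf q,n)$, $\psi=(\mathbf p,p_n)$, with a subscript $N$ meaning that $n\in[N,N+1)$ and $\mathbf q,\mathbf p$ have dimension $d_N$. The momentum density is $$\pi_\psi(\psi_N)=\Big(\tfrac{2m\pi}{\beta}\Big)^{-d_N/2}e^{-\beta K(\mathbf p)}\,\tfrac{\beta}{2m_n}e^{-\beta K_n(p_n)},$$ where the $\pi$ in $2m\pi/\beta$ is the circle constant. **Proposal densities.** For each $N$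 and each $(\mathbf q,\mathbf p)\in V_{d_N}\times\mathbb R^{d_N}$, $\pi_{N,N+1}(\cdot,\cdot;\mathbf q,\mathbf p)$ is a probability density for $(\mathbf q_{\mathrm{new}},\mathbf p_{\mathrm{new}})$ on $\{\mathbf q_{\mathrm{new}}\in\mathbb R^{d_{N+1}-d_N}:(\mathbf q,\mathbf q_{\mathrm{new}})\in V_{d_{N+1}}\}\times\mathbb R^{d_{N+1}-d_N}$ (jointly measurable in all arguments). **DHMC dynamics.** While $n\in(N,N+1)$, the system follows $$\dot{\mathbf q}=\mathbf p/m,\quad \dot{\mathbf p}=-\nabla\mathcal U_N(\mathbf q),\quad \dot n=\mathrm{sign}(p_n)/m_n,\quad \dot p_n=0,\qquad \mathrm{sign}(0):=1.$$ The Hamiltonian flow of $(\mathbf q,\mathbf p)$ on $V_{d_N}\times\mathbb R^{d_N}$ is assumed to be globally defined for each $N$ (hence it is a volume-preserving, energy-preserving, momentum-reversible flow of diffeomorphisms). Put $\mathcal E_N(\mathbf q,\mathbf p)=\mathcal U_N(\mathbf q)+K(\mathbf p)+\frac{d_N}{2\beta}\log\frac{2m\pi}{\beta}$. At integer values of $n$ the following rules apply. (Up) If $n$ reaches $N+1$ from the left (so $\mathrm{sign}(p_n)=1$), with current state $(\mathbf q,\mathbf p)$: sample $(\mathbf q_{\mathrm{new}},\mathbf p_{\mathrm{new}})\sim\pi_{N,N+1}(\cdot,\cdot;\mathbf q,\mathbf p)$, propose $\tilde{\mathbf q}=(\mathbf q,\mathbf q_{\mathrm{new}})$, $\tilde{\mathbf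 p}=(\mathbf p,\mathbf p_{\mathrm{new}})$, and set $$\delta\mathcal H=\mathcal E_{N+1}(\tilde{\mathbf q},\tilde{\mathbf p})-\mathcal E_N(\mathbf q,\mathbf p)+\tfrac1\beta\log\pi_{N,N+1}(\mathbf q_{\mathrm{new}},\mathbf p_{\mathrm{new}};\mathbf q,\mathbf p).$$ (Down) If $n$ reaches $N\ge1$ from the right (so $p_n<0$), with current state $(\mathbf q,\mathbf p)\in V_{d_N}\times\mathbb R^{d_N}$: propose $\tilde{\mathbf q},\tilde{\mathbf p}$ equal to the first $d_{N-1}$ components of $\mathbf q,\mathbf p$; let $\mathbf q',\mathbf p'$ be the remaining $d_N-d_{N-1}$ components, and set $$\delta\mathcal H=\mathcal E_{N-1}(\tilde{\mathbf q},\tilde{\mathbf p})-\mathcal E_N(\mathbf q,\mathbf p)-\tfrac1\beta\log\pi_{N-1,N}(\mathbf q',\mathbf p';\tilde{\mathbf q},\tilde{\mathbf p}),\qquad \log 0:=-\infty.$$ If $n$ reaches $0$ from the right, $\delta\mathcal H=+\infty$. In both cases: if $K_n(p_n)\ge\delta\mathcal H$, the proposal is accepted, $(\mathbf q,\mathbf p)$ is replaced by $(\tilde{\mathbf q},\tilde{\mathbf p})$, and $p_n$ is replaced by $\tilde p_n$ of the same sign with $K_n(\tilde p_n)=K_n(p_n)-\delta\mathcal H$, and $n$ crosses the integer. Otherwise the proposal is rejected, $(\mathbf q,\mathbf p)$ is unchanged, $p_n$ is replaced by $-p_n$, and $n$ is reflected. The evolution then continues in the corresponding interval. Let $\Gamma_T(\varphi_N,\psi_N\to\varphi_M,\psi_M)$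 be the Markov transition kernel (from time $0$ to time $T$) of this dynamics. **Ideal DHMC algorithm.** One step with fixed simulation time $T$: from $\varphi_N=(\mathbf q,n)$, draw $\psi_N\sim\pi_\psi$, run the DHMC dynamics (the Hamiltonian evolution of $(\mathbf q,\mathbf p,n,p_n)$ while $n$ is between consecutive integers, together with the accept/reject rules (Up) and (Down) when $n$ reaches an integer) from $(\varphi_N,\psi_N)$ for time $T$, and keep only the resulting $\varphi_M$. Its kernel is $$\Gamma_T(\varphi_N\to\varphi_M)=\int\pi_\psi(\psi_N)\,\Gamma_T(\varphi_N,\psi_N\to\varphi_M,\psi_M)\,d\psi_N\,d\psi_M .$$ With random simulation time, each step first draws $T\sim\mathrm{UNIF}[T_{\min},T_{\max}]$, $0\le T_{\min}<T_{\max}$, independently of everything else, and then performs the step with that $T$. *)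

(* Defs.v *)
From HB Require Import structures.
From mathcomp Require Import all_boot all_order all_algebra.
From mathcomp Require Import all_classical all_reals all_analysis.

Set Implicit Arguments.
Unset Strict Implicit.
Unset Printing Implicit Defensive.

Import Order.TTheory GRing.Theory Num.Theory.
Import numFieldNormedType.Exports.

Local Open Scope classical_set_scope.
Local Open Scope ring_scope.

(* The Borel sigma-algebra of R^n. *)
HB.instance Definition _ (R : realType) (n : nat) :=
  @isMeasurable.Build default_measure_display 'rV[R]_n
    <<s @open 'rV[R]_n >> (@sigma_algebra0 _ setT _)
    (@sigma_algebraC _ _) (@sigma_algebra_bigcup _ setT _).

Section lebesgue_rV.
Context {R : realType}.

Definition consV n (z : measurableTypeR R * 'rV[R]_n) : 'rV[R]_n.+1 :=
  @row_mx R 1 1 n (z.1)%:M z.2.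

Definition unconsV n (v : 'rV[R]_n.+1) : measurableTypeR R * 'rV[R]_n :=
  (v 0 0, @rsubmx R 1 1 n v).

Lemma consVK n : cancel (@consV n) (@unconsV n).
Proof.
case=> x v; rewrite /unconsV /consV /= row_mxKr; congr pair.
rewrite !mxE; case: splitP => j // _.
by rewrite !mxE (ord1 j) eqxx mulr1n.
Qed.

Lemma unconsVK n : cancel (@unconsV n) (@consV n).
Proof.
move=> v; rewrite /consV /unconsV /=; apply/rowP => i.
rewrite !mxE; case: (@splitP 1 n i) => j ij; rewrite !mxE.
  rewrite (ord1 j) eqxx mulr1n; congr (v _ _); apply: val_inj.
  by rewrite /= ij (ord1 j).
by congr (v _ _); apply: val_inj.
Qed.

Lemma ball_unconsV n (v w : 'rV[R]_n.+1) (e : R) : ball v e w <->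
  ball (unconsV v).1 e (unconsV w).1 /\ ball (unconsV v).2 e (unconsV w).2.
Proof.
split=> [[e0 vw]|[vw0 [e0 vw]]].
  by split; [exact: vw|split=> // i j; rewrite !mxE; exact: vw].
split=> // i j; rewrite (ord1 i).
case: (unliftP 0 j) => [k|] ->; last exact: vw0.
have := vw 0 k; rewrite !mxE.
by rewrite (_ : rshift 1 k = lift 0 k) //; exact: val_inj.
Qed.

Lemma open_measurable_rV n (U : set 'rV[R]_n) : open U -> measurable U.
Proof. by move=> oU; exact: sub_sigma_algebra. Qed.

Lemma ball_measurable_rV n (c : 'rV[R]_n) (e : R) : measurable (ball c e).
Proof. by apply: open_measurable_rV; exact: ball_open. Qed.

Lemma open_bigcup_ball n (U : set 'rV[R]_n) : open U ->
  U = \bigcup_(z in [set z : 'rV[rat]_n * nat |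
        ball (map_mx (@ratr R) z.1) (z.2.+1%:R^-1 : R) `<=` U])
      ball (map_mx (@ratr R) z.1) (z.2.+1%:R^-1 : R).
Proof.
move=> oU; apply/seteqP; split=> [x Ux|x [z + zx]]; last by apply.
have /nbhs_ballP[e /= e0 eU] : nbhs x U by exact: open_nbhs_nbhs.
have [k ke] : exists k : nat, (k.+1%:R^-1 : R) < e / 2.
  have := near_infty_natSinv_lt (PosNum (divr_gt0 e0 (ltr0n R 2))).
  by move=> [k _ /(_ k (leqnn k)) ?]; exists k.
have k0 : 0 < k.+1%:R^-1 :> R by rewrite invr_gt0 ltr0n.
have /choice[c cP] : forall i, exists q : rat, ball (x 0 i) (k.+1%:R^-1 : R) (ratr q).
  move=> i; have [|q] := @rat_in_itvoo R (x 0 i) (x 0 i + k.+1%:R^-1).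
    by rewrite ltrDl.
  rewrite in_itv /= => /andP[xq qx]; exists q.
  by rewrite /ball /= ltr_distlC ltrBlDr qx andbT (lt_trans xq) // ltrDl.
have xc : ball x (k.+1%:R^-1 : R) (map_mx (@ratr R) (\row_i c i)).
  by split=> // i j; rewrite (ord1 i) !mxE; exact: cP.
exists (\row_i c i, k) => /=; last exact: ball_sym.
move=> y cy; apply: eU; rewrite (splitr e).
by apply: ball_triangle; [exact: (le_ball (ltW ke) xc)|
                          exact: (le_ball (ltW ke) cy)].
Qed.

Lemma measurable_consV n : measurable_fun [set: _] (@consV n).
Proof.
apply: (@measurability _ _ _ 'rV[R]_n.+1 _ _ open) => //.
move=> _ [U oU <-]; rewrite setTI (open_bigcup_ball oU) preimage_bigcup.
rewrite [X in measurable X](_ : _ = \bigcup_k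
   (if unpickle k is Some z then
     if `[< ball (map_mx (@ratr R) z.1) (z.2.+1%:R^-1 : R) `<=` U >] then
     @consV n @^-1` ball (map_mx (@ratr R) z.1) (z.2.+1%:R^-1 : R) else set0
    else set0)); last first.
  apply/seteqP; split=> [x [z zU zx]|x [k _]].
    by exists (pickle z) => //; rewrite pickleK; case: asboolP.
  case: unpickle => // z; case: asboolP => // zU zx; by exists z.
apply: bigcupT_measurable => k; case: unpickle => // -[c l] /=.
case: asboolP => // _; set b := map_mx _ _; set e := _^-1.
rewrite [X in measurable X](_ : _ =
    ball (unconsV b).1 e `*` ball (unconsV b).2 e).
  apply: measurableX; last exact: ball_measurable_rV.
  by apply: measurable_realfun.open_measurable; exact: ball_open.
apply/seteqP; split=> [z|z] /=; first by rewrite ball_unconsV consVK.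
by move=> ?; rewrite ball_unconsV consVK.
Qed.

Lemma measurable_unconsV n : measurable_fun [set: _] (@unconsV n).
Proof.
apply: measurable_fun_pair.
  apply: (measurability _ (measurable_realfun.RGenOpens.measurableE R)).
  move=> _ [_ [a [b ->] <-]]; rewrite setTI.
  apply: open_measurable_rV; apply: open_comp; last exact: interval_open.
  by move=> v _; exact: coord_continuous.
apply: (@measurability _ _ _ 'rV[R]_n _ _ open) => //.
move=> _ [U oU <-]; rewrite setTI; apply: open_measurable_rV.
rewrite openE; move=> v /= Uv.
have /nbhs_ballP[e /= e0 eU] : nbhs (@rsubmx R 1 1 n v) U
  by exact: open_nbhs_nbhs.
by apply/nbhs_ballP; exists e => //= w /ball_unconsV[_ vw]; exact: eU.
Qed.

Section step.
Variables (n : nat) (mu : {sigma_finite_measure set 'rV[R]_n -> \bar R}).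

Definition lebesgue_step : set 'rV[R]_n.+1 -> \bar R :=
  pushforward (lebesgue_measure \x mu)%E (@consV n).

Let step0 : lebesgue_step set0 = 0%E.
Proof. by rewrite /lebesgue_step /pushforward preimage_set0 measure0. Qed.

Let step_ge0 A : (0 <= lebesgue_step A)%E.
Proof. by rewrite /lebesgue_step /pushforward; exact: measure_ge0. Qed.

Let step_sigma_additive : semi_sigma_additive lebesgue_step.
Proof.
move=> F mF tF mUF; rewrite /lebesgue_step /pushforward preimage_bigcup.
have mcons A : measurable A -> measurable (@consV n @^-1` A).
  by move=> mA; rewrite -[X in measurable X]setTI; exact: measurable_consV.
apply: measure_semi_sigma_additive.
- by move=> k; exact: mcons.
- apply/trivIsetP => /= i j _ _ ij; rewrite -preimage_setI.
  by move/trivIsetP : tF => /(_ _ _ _ _ ij) ->//; rewrite preimage_set0.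
- by rewrite -preimage_bigcup; exact: mcons.
Qed.

HB.instance Definition _ := isMeasure.Build _ _ _ lebesgue_step
  step0 step_ge0 step_sigma_additive.

Let step_sigma_finite : sigma_finite setT lebesgue_step.
Proof.
have /sigma_finiteP[F [FT ndF Foo]] := sigma_finiteT (@lebesgue_measure R).
have /sigma_finiteP[G [GT ndG Goo]] := sigma_finiteT mu.
exists (fun k => @unconsV n @^-1` (F k `*` G k)).
  apply/seteqP; split=> // v _.
  have : [set: measurableTypeR R] (unconsV v).1 by [].
  have : [set: 'rV[R]_n] (unconsV v).2 by [].
  rewrite FT GT => -[k _ Gk] [l _ Fl]; exists (maxn k l) => //; split.
    by move: (unconsV v).1 Fl; exact/subsetPset/ndF/leq_maxr.
  by move: (unconsV v).2 Gk; exact/subsetPset/ndG/leq_maxl.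
move=> k; have [mF Fk] := Foo k; have [mG Gk] := Goo k; split.
  rewrite -[X in measurable X]setTI; apply: measurable_unconsV => //.
  exact: measurableX.
rewrite /lebesgue_step /pushforward -comp_preimage.
rewrite (_ : _ \o _ = id) ?preimage_id; last by apply/funext => z; exact: consVK.
by rewrite product_measure1E// lte_mul_pinfty// ge0_fin_numE.
Qed.

HB.instance Definition _ := Measure_isSigmaFinite.Build _ _ _ lebesgue_step
  step_sigma_finite.

End step.

(* The Lebesgue measure of R^n, as the product of n copies of the Lebesgue
   measure of R; it is characterised on boxes by lebesgue_rV_box below. *)
Fixpoint lebesgue_rV n : {sigma_finite_measure set 'rV[R]_n -> \bar R} :=
  match n with
  | 0 => dirac (0 : 'rV[R]_0)
  | n'.+1 => @lebesgue_step n' (lebesgue_rV n')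
  end.

Lemma lebesgue_rV_box n (A : 'I_n -> set (measurableTypeR R)) :
  (forall i, measurable (A i)) ->
  measurable [set v : 'rV[R]_n | forall i, A i (v 0 i)] /\
  lebesgue_rV n [set v : 'rV[R]_n | forall i, A i (v 0 i)] =
  (\prod_i lebesgue_measure (A i))%E.
Proof.
elim: n A => [|n IH] A mA.
  have -> : [set v : 'rV[R]_0 | forall i, A i (v 0 i)] = setT.
    by apply/seteqP; split=> // v _ [].
  by split; [exact: measurableT|rewrite big_ord0 /= diracT].
have [mB lB] := IH (fun i => A (lift 0 i)) (fun i => mA _).
set B := [set v | _] in mB lB.
have AE : [set v : 'rV[R]_n.+1 | forall i, A i (v 0 i)] =
    @unconsV n @^-1` (A 0 `*` B).
  apply/seteqP; split=> [v Av|v [/= v0 vB] i].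
    split=> [|i /=]; first exact: Av.
    have := Av (lift 0 i); rewrite !mxE.
    by rewrite (_ : rshift 1 i = lift 0 i) //; exact: val_inj.
  case: (unliftP 0 i) => [k|] ->; last exact: v0.
  have := vB k; rewrite !mxE.
  by rewrite (_ : rshift 1 k = lift 0 k) //; exact: val_inj.
have mAB : measurable (A 0 `*` B) by exact: measurableX.
rewrite AE; split.
  by rewrite -[X in measurable X]setTI; exact: measurable_unconsV.
rewrite /= /lebesgue_step /pushforward -comp_preimage.
rewrite (_ : _ \o _ = id) ?preimage_id; last by apply/funext => z; exact: consVK.
by rewrite product_measure1E // big_ord_recl lB.
Qed.

End lebesgue_rV.


Section smooth.
Context {R : realType} {n : nat}.

Definition partial (j : 'I_n) (f : 'rV[R]_n -> R) : 'rV[R]_n -> R :=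
  fun x => 'D_(delta_mx 0 j) f x.

Definition gradient (f : 'rV[R]_n -> R) (x : 'rV[R]_n) : 'rV[R]_n :=
  \row_j partial j f x.

(* C^oo on V: the iterated partial derivatives of all orders exist and are
   continuous at every point of V. *)
Definition smooth_on (V : set 'rV[R]_n) (f : 'rV[R]_n -> R) : Prop :=
  forall (s : seq 'I_n) (x : 'rV[R]_n), V x ->
    {for x, continuous (foldr partial f s)} /\
    forall j, derivable (foldr partial f s) x (delta_mx 0 j).

End smooth.

(* [pot], [dens] and [flow] are total; only their values over the domains [dom]
   matter. *)
Record dhmc (R : realType) := Dhmc {
  beta : R;
  mass : R;
  nmass : R;
  dim : nat -> nat;
  dim_incr : {homo dim : M N / (M < N)%N};
  dom : forall N, set 'rV[R]_(dim N);
  pot : forall N, 'rV[R]_(dim N) -> R;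
  (* [dens N q p q_new p_new] is pi_{N,N+1}(q_new, p_new; q, p) *)
  dens : forall N, 'rV[R]_(dim N) -> 'rV[R]_(dim N) ->
    'rV[R]_(dim N.+1 - dim N) -> 'rV[R]_(dim N.+1 - dim N) -> R;
  (* [flow N t (q, p)] is the Hamiltonian flow of U_N + K at time t *)
  flow : forall N, R -> 'rV[R]_(dim N) * 'rV[R]_(dim N) ->
    'rV[R]_(dim N) * 'rV[R]_(dim N)
}.

Section dhmc_def.
Context {R : realType} (D : dhmc R).

Local Notation "'d_ N" := (dim D N) (at level 0, N at level 0, format "''d_' N").
Local Notation vec N := 'rV[R]_('d_N).
Local Notation vec_new N := 'rV[R]_(dim D N.+1 - dim D N).

Lemma dim_split N : ('d_N + (dim D N.+1 - dim D N))%N = dim D N.+1.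
Proof. by rewrite subnKC// ltnW// dim_incr. Qed.

Definition extend N (x : vec N) (y : vec_new N) : vec N.+1 :=
  castmx (erefl, dim_split N) (row_mx x y).

Definition old_part N (x : vec N.+1) : vec N :=
  lsubmx (castmx (erefl, esym (dim_split N)) x).

Definition new_part N (x : vec N.+1) : vec_new N :=
  rsubmx (castmx (erefl, esym (dim_split N)) x).

Definition kinetic n (p : 'rV[R]_n) : R :=
  (\sum_i p 0 i ^+ 2) / (2 * mass D).

Definition nkinetic (pn : R) : R := `|pn| / nmass D.

(* Num.sg is not used because sign(0) is 1 here. *)
Definition sign (pn : R) : R := if 0 <= pn then 1 else -1.

Definition energy N (q p : vec N) : R :=
  pot q + kinetic p + 'd_N%:R / (2 * beta D) * ln (2 * mass D * pi / beta D).

(* phi = (q, n) and psi = (p, p_n), both at level N *)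
Local Notation ext N := ('rV[R]_('d_N) * measurableTypeR R)%type.

Local Notation ext_measure N := (lebesgue_rV 'd_N \x @lebesgue_measure R)%E.

Definition ext_dom N : set (ext N) :=
  [set phi | dom phi.1 /\ N%:R <= phi.2 < N.+1%:R].

Definition partition_function : \bar R :=
  (\sum_(N <oo) \int[lebesgue_rV 'd_N]_(q in @dom _ D N)
     (expR (- beta D * pot q))%:E)%E.

Definition target N (q : vec N) : R :=
  (fine partition_function)^-1 * expR (- beta D * pot q).

Definition ext_target N (phi : ext N) : R := target phi.1.

Definition momentum_density N (psi : ext N) : R :=
  (2 * mass D * pi / beta D) `^ (- ('d_N%:R / 2)) *
  expR (- beta D * kinetic psi.1) *
  (beta D / (2 * nmass D) * expR (- beta D * nkinetic psi.2)).

(* A state of the dynamics. The level is part of the state, and n belongs to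
   the closed interval [level, level + 1]: after an accepted downward move, n
   is at the right end of its new interval. *)
Record state := State {
  level : nat;
  pos : vec level;
  mom : vec level;
  idx : R;
  imom : R
}.

(* The time until n hits an end of [level, level + 1]; n has the constant
   velocity sign(p_n) / m_n in between. *)
Definition hitting_time (x : state) : R :=
  nmass D * (if 0 <= imom x then (level x).+1%:R - idx x
             else idx x - (level x)%:R).

(* The evolution for a time t <= hitting_time x. *)
Definition advance (t : R) (x : state) : state :=
  let z := flow t (pos x, mom x) in
  State z.1 z.2 (idx x + t * (sign (imom x) / nmass D)) (imom x).

Definition reject (x : state) : state :=
  State (pos x) (mom x) (idx x) (- imom x).

(* The state after the proposal of (q, p) at level N from x, with the energy
   difference dH, has been accepted or rejected. *)
Definition decide (x : state) N (q p : vec N) (dH : \bar R) : state :=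
  if (dH <= (nkinetic (imom x))%:E)%E then
    State q p (idx x)
      (sign (imom x) * (nmass D * (nkinetic (imom x) - fine dH)))
  else reject x.

(* [lne] is the extended logarithm, so that lne 0 = -oo. *)
Definition up_state (x : state) (y : vec_new (level x) * vec_new (level x)) :
    state :=
  let q := extend (pos x) y.1 in
  let p := extend (mom x) y.2 in
  decide x q p
    ((energy q p - energy (pos x) (mom x))%:E +
     (beta D)^-1%:E * lne (dens (pos x) (mom x) y.1 y.2)%:E)%E.

Definition down_state (x : state) : state :=
  match x with
  | @State N'.+1 q p n pn =>
    let q0 := old_part q in
    let p0 := old_part p in
    decide (State q p n pn) q0 p0
      ((energy q0 p0 - energy q p)%:E -
       (beta D)^-1%:E * lne (dens q0 p0 (new_part q) (new_part p))%:E)%E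
  | @State 0 _ _ _ _ => reject x
  end.

Definition new_dom N (q : vec N) : set (vec_new N * vec_new N) :=
  [set y | dom (extend q y.1)].

Local Notation new_measure N :=
  (lebesgue_rV (dim D N.+1 - dim D N) \x lebesgue_rV (dim D N.+1 - dim D N))%E.

(* The expected value of f at the state that follows the event which takes
   place at x, where n = idx x is an integer. *)
Definition event (f : state -> \bar R) (x : state) : \bar R :=
  if 0 <= imom x then
    (\int[new_measure (level x)]_(y in new_dom (pos x))
       ((dens (pos x) (mom x) y.1 y.2)%:E * f (up_state y)))%E
  else f (down_state x).

(* The probability that, from x, exactly k events take place up to time T and
   that the state at time T is in C. *)
Fixpoint kernel_events (k : nat) (T : R) (x : state) (C : set state) :
    \bar R :=
  match k with
  | 0 => if T < hitting_time x then (\1_C (advance T x))%:E else 0%E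
  | k'.+1 =>
    if hitting_time x <= T then
      event (fun y => kernel_events k' (T - hitting_time x) y C)
        (advance (hitting_time x) x)
    else 0%E
  end.

(* Gamma_T(phi, psi -> C). The times of the events are determined by n and p_n,
   and successive events are nmass apart, so that almost every trajectory has
   finitely many events up to time T. *)
Definition phase_kernel (T : R) (x : state) (C : set state) : \bar R :=
  (\sum_(k <oo) kernel_events k T x C)%E.

(* The states with (q, n) in B at level M, whatever their momenta. *)
Definition states_over M (B : set (ext M)) : set state :=
  [set x | exists q p n pn, x = @State M q p n pn /\ B (q, n)].

(* Gamma_T(phi_N -> B), B at level M *)
Definition dhmc_kernel (T : R) N (phi : ext N) M (B : set (ext M)) : \bar R :=
  (\int[ext_measure N]_psi
     ((momentum_density psi)%:E *
      phase_kernel T (State phi.1 psi.1 phi.2 psi.2) (states_over B)))%E.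

(* The kernel for a random simulation time, uniform on [Tmin, Tmax]. *)
Definition random_time_kernel (Tmin Tmax : R) N (phi : ext N)
    M (B : set (ext M)) : \bar R :=
  (((Tmax - Tmin)^-1)%:E *
   \int[lebesgue_measure]_(T in `[Tmin, Tmax]%classic) dhmc_kernel T phi B)%E.

Definition detailed_balance
    (G : forall N, ext N -> forall M, set (ext M) -> \bar R) : Prop :=
  forall N M (A : set (ext N)) (B : set (ext M)),
    measurable A -> A `<=` @ext_dom N -> measurable B -> B `<=` @ext_dom M ->
    (\int[ext_measure N]_(phi in A) ((ext_target phi)%:E * G N phi M B) =
     \int[ext_measure M]_(phi in B) ((ext_target phi)%:E * G M phi N A))%E.

Definition proper_domains : Prop :=
  forall N, [/\ open (@dom _ D N), connected (@dom _ D N),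
    @dom _ D N !=set0 & @old_part N @` @dom _ D N.+1 = @dom _ D N].

Definition proposal_densities : Prop :=
  forall N,
    measurable_fun
      [set z : (vec N * vec N) * (vec_new N * vec_new N) |
        dom z.1.1 /\ new_dom z.1.1 z.2]
      (fun z => dens z.1.1 z.1.2 z.2.1 z.2.2) /\
    forall q p : vec N, dom q ->
      (forall y, new_dom q y -> 0 <= dens q p y.1 y.2) /\
      (\int[new_measure N]_(y in new_dom q) (dens q p y.1 y.2)%:E = 1)%E.

(* The ODE determines [flow N t x] whenever x is over dom N. *)
Definition hamiltonian_flow : Prop :=
  forall N (x : vec N * vec N), dom x.1 ->
    flow 0 x = x /\
    forall t : R,
      [/\ dom (flow t x).1,
          is_derive t 1 (fun s => (flow s x).1) ((mass D)^-1 *: (flow t x).2) &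
          is_derive t 1 (fun s => (flow s x).2)
            (- gradient (@pot _ D N) (flow t x).1)].

Definition dhmc_setting : Prop :=
  [/\ [/\ 0 < beta D, 0 < mass D & 0 < nmass D],
      proper_domains,
      (forall N, smooth_on (@dom _ D N) (@pot _ D N)) /\
        (partition_function < +oo)%E,
      proposal_densities &
      hamiltonian_flow].

Definition proposals_reversible : Prop :=
  forall N (q p : vec N) (q' p' : vec_new N),
    dom q -> dom (extend q q') -> dens q p q' p' = dens q (- p) q' (- p').

End dhmc_def.

(* Main.v *)
Require Import Defs.
From HB Require Import structures.
From mathcomp Require Import all_boot all_order all_algebra.
From mathcomp Require Import all_classical all_reals all_analysis.
From mathcomp Require Import measurable_realfun ring lra.

Set Implicit Arguments.
Unset Strict Implicit.
Unset Printing Implicit Defensive.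

Import Order.TTheory GRing.Theory Num.Theory.
Import numFieldNormedType.Exports.
(* [dim] also names an operation on vector spaces. *)
Import Defs.

Local Open Scope classical_set_scope.
Local Open Scope ring_scope.

(* Up to a constant, the density of the initial states is
   w = exp(- beta (E_N(q, p) + K_n(p_n))). Two symmetries are combined.
   - Between events, the Hamiltonian flow followed by the reversal of the momenta
     is an involution preserving w dq dp dp_n. Its volume preservation comes from
     the convergence of the symplectic Euler scheme, whose steps are compositions
     of two shears.
   - At an event, the pairing <a, b> of two functions of the state, the integral
     of w times a(state before the event, momenta reversed) times the expected
     value of b(state after the event), is symmetric in a and b: the change of
     p_n in an accepted move turns w at one level times the proposal density
     into w at the other level.
   Successive events are nmass apart, so <a', b> = <a, b'> if a' and b' are
   obtained from a and b by one passage from an end of [N, N + 1] to the other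
   followed by one event.
   Given that k + 1 events happen up to time T, parametrise n by the time u nmass
   of the first event. The mass carried from A to B with first event at u nmass
   is <A before u nmass, k events then B>, and the k + 1 events are symmetric to
   those of the paths from B to A with first event at T - k nmass - u nmass.
   Detailed balance thus holds for each number of events separately; the sum over
   the number of events gives fixed times, and Fubini gives random ones. *)

(** * Measure-preserving maps *)

(** The flow is known only through its differential equation on an open domain, so its volume
    preservation is not read off a Jacobian. One estimate for the Euler scheme, uniform in nearby
    starting points, gives uniqueness of trajectories, hence reversibility, then continuity, joint
    measurability and volume preservation. Every later substitution is a [measure_preserving] map
    built from shears, reflections and rearrangements of coordinates. All integrands take values in
    [0, +oo], so Tonelli and monotone convergence suffice. Two normalisations keep constants out of
    the symmetry. The logarithm in the energy absorbs the Gaussian constant of the momenta, which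
    depends on the level; and time counted in units of nmass moves n at speed one, so u and n carry
    the same Lebesgue measure. The symmetries hold only off null sets: sign(0) = 1 singles out one
    direction at p_n = 0, an accepted move may leave exactly p_n = 0, and a path may start or stop
    exactly at an event. Hence the recurring condition [r != 0] and the excluded values of u. *)

Definition measure_preserving d1 d2 (T1 : measurableType d1)
    (T2 : measurableType d2) (R : realType) (m1 : set T1 -> \bar R)
    (m2 : set T2 -> \bar R) (f : T1 -> T2) :=
  measurable_fun setT f /\ forall A, measurable A -> m1 (f @^-1` A) = m2 A.

Section product_sigma_finite.
Local Open Scope ereal_scope.
Context d1 d2 (T1 : measurableType d1) (T2 : measurableType d2) (R : realType).
Variable m1 : {sigma_finite_measure set T1 -> \bar R}.
Variable m2 : {sigma_finite_measure set T2 -> \bar R}.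

Lemma product_sigma_finite : sigma_finite setT (m1 \x m2).
Proof.
have /sigma_finiteP[F [FT ndF Foo]] := sigma_finiteT m1.
have /sigma_finiteP[G [GT ndG Goo]] := sigma_finiteT m2.
exists (fun k => F k `*` G k).
  apply/seteqP; split=> // -[x y] _.
  have : [set: T1] x by []. have : [set: T2] y by [].
  rewrite FT GT => -[k _ Gk] [l _ Fl]; exists (maxn k l) => //; split.
    by move: x Fl; exact/subsetPset/ndF/leq_maxr.
  by move: y Gk; exact/subsetPset/ndG/leq_maxl.
move=> k; have [mF Fk] := Foo k; have [mG Gk] := Goo k.
split; first exact: measurableX.
by rewrite product_measure1E// lte_mul_pinfty// ge0_fin_numE.
Qed.

(* The library has no sigma-finite instance on [m1 \x m2]: the one found there
   is for subprobabilities. *)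
Definition prodm : {sigma_finite_measure set (T1 * T2)%type -> \bar R} :=
  HB.pack (m1 \x m2)
    (Measure_isSigmaFinite.Build _ _ _ (m1 \x m2) product_sigma_finite).

End product_sigma_finite.

Section measure_preserving_theory.
Local Open Scope ereal_scope.
Context {R : realType}.

Lemma mpres_integral d1 d2 (T1 : measurableType d1) (T2 : measurableType d2)
    (m1 : {measure set T1 -> \bar R}) (m2 : {measure set T2 -> \bar R})
    (f : T1 -> T2) (F : T2 -> \bar R) : measure_preserving m1 m2 f ->
  measurable_fun setT F -> (forall x, 0 <= F x) ->
  \int[m2]_y F y = \int[m1]_x F (f x).
Proof.
move=> [mf ff] mF F0.
have := @ge0_integral_pushforward _ _ _ _ R f mf m1 setT F measurableT mF
  (fun x _ => F0 x).
rewrite preimage_setT => <-.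
by apply: eq_measure_integral => A mA _; exact/esym/ff.
Qed.

Lemma mpres_comp d1 d2 d3 (T1 : measurableType d1) (T2 : measurableType d2)
    (T3 : measurableType d3) (m1 : set T1 -> \bar R) (m2 : set T2 -> \bar R)
    (m3 : set T3 -> \bar R) f g :
  measure_preserving m1 m2 f -> measure_preserving m2 m3 g ->
  measure_preserving m1 m3 (g \o f).
Proof.
move=> [mf f12] [mg g23]; split; first exact: measurableT_comp.
move=> A mA; rewrite comp_preimage f12 ?g23//.
by rewrite -[X in measurable X]setTI; exact: mg.
Qed.

Lemma mpres_can d1 d2 (T1 : measurableType d1) (T2 : measurableType d2)
    (m1 : set T1 -> \bar R) (m2 : set T2 -> \bar R) f g :
  measure_preserving m1 m2 f -> measurable_fun setT g -> cancel f g ->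
  measure_preserving m2 m1 g.
Proof.
move=> [mf f12] mg fg; split=> // A mA.
rewrite -f12; last by rewrite -[X in measurable X]setTI; exact: mg.
rewrite -comp_preimage (_ : g \o f = id) ?preimage_id//.
by apply/funext => x /=; rewrite fg.
Qed.

Lemma mpres_id d1 (T1 : measurableType d1) (m1 : set T1 -> \bar R) :
  measure_preserving m1 m1 id.
Proof. by split=> //; exact: measurable_id. Qed.

(** A shear over the first coordinate preserves the product measure as soon as each fibre map does,
    because the product measure is an iterated integral. The kicks and drifts of the Euler scheme,
    the shift of p_n by the jump and the passage from u to n are all of this kind. *)
Lemma mpres_fiber d1 d2 d3 (T1 : measurableType d1) (T2 : measurableType d2)
    (T3 : measurableType d3) (m1 : {sigma_finite_measure set T1 -> \bar R})
    (m2 : {sigma_finite_measure set T2 -> \bar R})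
    (m3 : {sigma_finite_measure set T3 -> \bar R}) (f : T1 -> T2 -> T3) :
  measurable_fun setT (fun z : T1 * T2 => f z.1 z.2) ->
  (forall x, measure_preserving m2 m3 (f x)) ->
  measure_preserving (prodm m1 m2) (prodm m1 m3) (fun z => (z.1, f z.1 z.2)).
Proof.
move=> mf f23; split.
  by apply: measurable_fun_pair => //; exact: measurable_fst.
move=> A mA; rewrite /product_measure1; apply: eq_integral => x _ /=.
rewrite -(f23 x).2; last exact: measurable_xsection.
by congr (m2 _); apply/seteqP; split=> y; rewrite /xsection /= !inE.
Qed.

Lemma mpres_swap d1 d2 (T1 : measurableType d1) (T2 : measurableType d2)
    (m1 : {sigma_finite_measure set T1 -> \bar R})
    (m2 : {sigma_finite_measure set T2 -> \bar R}) :
  measure_preserving (prodm m1 m2) (prodm m2 m1) (fun z => (z.2, z.1)).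
Proof.
have msw : measurable_fun [set: T1 * T2] (fun z => (z.2, z.1)).
  by apply: measurable_fun_pair; [exact: measurable_snd|exact: measurable_fst].
split=> // A mA.
have := @product_measure_unique _ _ _ _ R m2 m1
  (pushforward (m1 \x m2) (fun z : T1 * T2 => (z.2, z.1))).
move=> /(_ msw) swE; apply/esym/swE => // B C mB mC.
rewrite /pushforward muleC -product_measure1E//.
by congr (product_measure1 _ _ _); apply/seteqP; split=> -[x y] [].
Qed.

Lemma mpres_prod d1 d2 d3 d4 (T1 : measurableType d1) (T2 : measurableType d2)
    (T3 : measurableType d3) (T4 : measurableType d4)
    (m1 : {sigma_finite_measure set T1 -> \bar R})
    (m2 : {sigma_finite_measure set T2 -> \bar R})
    (m3 : {sigma_finite_measure set T3 -> \bar R})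
    (m4 : {sigma_finite_measure set T4 -> \bar R}) (f : T1 -> T3) (g : T2 -> T4) :
  measure_preserving m1 m3 f -> measure_preserving m2 m4 g ->
  measure_preserving (prodm m1 m2) (prodm m3 m4) (fun z => (f z.1, g z.2)).
Proof.
move=> mpf mpg.
have h1 : measure_preserving (prodm m1 m2) (prodm m1 m4) (fun z => (z.1, g z.2)).
  apply: (@mpres_fiber _ _ _ _ _ _ m1 m2 m4 (fun=> g)) => //.
  by apply: measurableT_comp => //; exact: mpg.1.
have h2 : measure_preserving (prodm m4 m1) (prodm m4 m3) (fun z => (z.1, f z.2)).
  apply: (@mpres_fiber _ _ _ _ _ _ m4 m1 m3 (fun=> f)) => //.
  by apply: measurableT_comp => //; exact: mpf.1.
have := mpres_comp (mpres_comp (mpres_comp h1 (mpres_swap m1 m4)) h2)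
  (mpres_swap m4 m3).
by [].
Qed.

Lemma mpres_assoc d1 d2 d3 (T1 : measurableType d1) (T2 : measurableType d2)
    (T3 : measurableType d3) (m1 : {sigma_finite_measure set T1 -> \bar R})
    (m2 : {sigma_finite_measure set T2 -> \bar R})
    (m3 : {sigma_finite_measure set T3 -> \bar R}) :
  measure_preserving (prodm m1 (prodm m2 m3)) (prodm (prodm m1 m2) m3)
    (fun z => ((z.1, z.2.1), z.2.2)).
Proof.
have mas : measurable_fun [set: T1 * (T2 * T3)] (fun z => ((z.1, z.2.1), z.2.2)).
  apply: measurable_fun_pair; last exact: measurableT_comp.
  by apply: measurable_fun_pair => //; exact: measurableT_comp.
split=> // A mA.
transitivity (\int[m1]_x \int[m2]_y m3 (xsection A (x, y))).
  apply: eq_integral => x _; apply: eq_integral => y _ /=.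
  by congr (m3 _); apply/seteqP; split=> z; rewrite /xsection /= !inE/= inE.
rewrite -(@fubini_tonelli1 _ _ _ _ _ m1 m2 (fun z => m3 (xsection A z)))//.
exact: measurable_fun_xsection.
Qed.

End measure_preserving_theory.

Lemma measurable_pair_on d d1 d2 (T : measurableType d)
    (T1 : measurableType d1) (T2 : measurableType d2) (D : set T)
    (f : T -> T1) (g : T -> T2) :
  measurable_fun D f -> measurable_fun D g ->
  measurable_fun D (fun x => (f x, g x)).
Proof.
move=> mf mg mD.
apply: (@eq_measurable_fun _ _ _ _ _ (fun x => ((f \_ D) x, (g \_ D) x))) => //.
  by move=> x xD; rewrite /patch xD.
apply: measurable_funTS; apply: measurable_fun_pair;
  exact/(measurable_restrictT _ mD).
Qed.

(** * Lebesgue measure and measurability on row vectors *)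

Section lebesgue_rV_theory.
Context {R : realType}.
Implicit Types n : nat.

(** The sigma-algebra of R^n is generated by open sets, not by coordinates. Coordinatewise
    measurability is enough because [consV] is measurable, which adds one coordinate at a time. *)
Lemma measurable_rV_coord d (T : measurableType d) n (D : set T)
    (f : T -> 'rV[R]_n) :
  (forall i, measurable_fun D (fun x => f x 0 i)) -> measurable_fun D f.
Proof.
elim: n f => [|n IH] f mf.
  have -> : f = cst 0 by apply/funext => x; apply/rowP => -[].
  exact: measurable_cst.
have -> : f = @consV R n \o (fun x => unconsV (f x)).
  by apply/funext => x /=; rewrite unconsVK.
apply: measurableT_comp; first exact: measurable_consV.
rewrite /unconsV; apply: measurable_pair_on; first exact: mf.
apply: IH => i; under eq_fun do rewrite /= mxE; exact: mf.
Qed.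

Lemma measurable_coord n (i : 'I_n) :
  measurable_fun setT (fun x : 'rV[R]_n => x 0 i).
Proof.
elim: n i => [[]//|n IH] i.
case: (unliftP 0 i) => [k ->|->].
  have -> : (fun x : 'rV[R]_n.+1 => x 0 (lift 0 k)) =
      (fun x : 'rV[R]_n => x 0 k) \o (fun x => (unconsV x).2).
    apply/funext => x /=; rewrite mxE; congr (x _ _); exact: val_inj.
  apply: measurableT_comp; first exact: IH.
  by apply: measurableT_comp => //; exact: measurable_unconsV.
have -> : (fun x : 'rV[R]_n.+1 => x 0 0) = (fun x => (unconsV x).1) by [].
by apply: measurableT_comp => //; exact: measurable_unconsV.
Qed.

Lemma measurable_coord_comp d (T : measurableType d) n (D : set T)
    (f : T -> 'rV[R]_n) i :
  measurable_fun D f -> measurable_fun D (fun x => f x 0 i).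
Proof. by move=> mf; apply: (measurableT_comp (measurable_coord i) mf). Qed.

Lemma measurable_rV_add d (T : measurableType d) n (D : set T)
    (f g : T -> 'rV[R]_n) : measurable_fun D f -> measurable_fun D g ->
  measurable_fun D (fun x => f x + g x).
Proof.
move=> mf mg; apply: measurable_rV_coord => i; under eq_fun do rewrite mxE.
by apply: measurable_funD; exact: measurable_coord_comp.
Qed.

Lemma measurable_rV_opp d (T : measurableType d) n (D : set T)
    (f : T -> 'rV[R]_n) : measurable_fun D f ->
  measurable_fun D (fun x => - f x).
Proof.
move=> mf; apply: measurable_rV_coord => i; under eq_fun do rewrite mxE.
by apply: measurableT_comp => //; exact: measurable_coord_comp.
Qed.

Lemma measurable_rV_scale d (T : measurableType d) n (D : set T)
    (h : T -> R) (f : T -> 'rV[R]_n) :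
  measurable_fun D h -> measurable_fun D f ->
  measurable_fun D (fun x => h x *: f x).
Proof.
move=> mh mf; apply: measurable_rV_coord => i; under eq_fun do rewrite mxE.
by apply: measurable_funM => //; exact: measurable_coord_comp.
Qed.

Lemma lebesgue_measure_shift (a : R) :
  measure_preserving (@lebesgue_measure R) (@lebesgue_measure R) (+%R^~ a).
Proof.
have ma : measurable_fun [set: measurableTypeR R]
    (+%R^~ a : measurableTypeR R -> measurableTypeR R).
  exact: measurable_funD.
split=> // A mA; apply/esym.
have := @lebesgue_measure_unique R
  (pushforward lebesgue_measure (+%R^~ a : measurableTypeR R -> measurableTypeR R)).
move=> /(_ ma); apply => // _ [[x y] _ <-].
transitivity (@lebesgue_measure R `]x - a, y - a]%classic).
  rewrite !lebesgue_measure_itv /= !lte_fin ltrD2r -!EFinB opprB.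
  by congr (if _ then EFin _ else _); ring.
congr lebesgue_measure.
by apply/seteqP; split=> z; rewrite /= !in_itv /= ltrBlDr lerBrDr.
Qed.

Lemma lebesgue_measure_opp :
  measure_preserving (@lebesgue_measure R) (@lebesgue_measure R) -%R.
Proof. by split=> [|A mA]; [exact: oppr_measurable|exact: lebesgue_measureN]. Qed.

Lemma consV_mpres n : measure_preserving
  (prodm (@lebesgue_measure R) (@lebesgue_rV R n)) (@lebesgue_rV R n.+1) (@consV R n).
Proof. by split=> [|A mA]; [exact: measurable_consV|]. Qed.

Lemma unconsV_mpres n : measure_preserving (@lebesgue_rV R n.+1)
  (prodm (@lebesgue_measure R) (@lebesgue_rV R n)) (@unconsV R n).
Proof.
apply: (mpres_can (consV_mpres n)); first exact: measurable_unconsV.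
exact: consVK.
Qed.

Lemma lebesgue_rV_ind n (f : 'rV[R]_n.+1 -> 'rV[R]_n.+1) g h :
  measure_preserving (@lebesgue_measure R) (@lebesgue_measure R) g ->
  measure_preserving (@lebesgue_rV R n) (@lebesgue_rV R n) h ->
  (forall x, f x = consV (g (unconsV x).1, h (unconsV x).2)) ->
  measure_preserving (@lebesgue_rV R n.+1) (@lebesgue_rV R n.+1) f.
Proof.
move=> mg mh fE.
have := mpres_comp (mpres_comp (unconsV_mpres n) (mpres_prod mg mh))
  (consV_mpres n).
by congr measure_preserving; apply/funext => x; rewrite fE.
Qed.

Lemma lebesgue_rV_shift n (a : 'rV[R]_n) :
  measure_preserving (@lebesgue_rV R n) (@lebesgue_rV R n) (+%R^~ a).
Proof.
elim: n a => [|n IH] a.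
  rewrite (_ : +%R^~ a = id); first exact: mpres_id.
  by apply/funext => x; apply/rowP => -[].
have h1 := lebesgue_measure_shift (a 0 0).
have h2 := IH (@rsubmx R 1 1 n a).
apply: (lebesgue_rV_ind h1 h2).
move=> x; rewrite -{1}[x + a]unconsVK; congr consV.
by rewrite /unconsV /= raddfD /= mxE.
Qed.

Lemma lebesgue_rV_opp n :
  measure_preserving (@lebesgue_rV R n) (@lebesgue_rV R n) -%R.
Proof.
elim: n => [|n IH].
  rewrite (_ : -%R = id); first exact: mpres_id.
  by apply/funext => x; apply/rowP => -[].
apply: (lebesgue_rV_ind lebesgue_measure_opp IH) => x.
rewrite -{1}[- x]unconsVK; congr consV.
by rewrite /unconsV /= raddfN /= mxE.
Qed.

Lemma measurable_row_mx m n : measurable_fun setT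
  (fun z : 'rV[R]_m * 'rV[R]_n => row_mx z.1 z.2).
Proof.
apply: measurable_rV_coord => i; under eq_fun do rewrite mxE.
by case: (fintype.split i) => j; apply: measurable_coord_comp.
Qed.

(** The measure of R^n is built by adding coordinates in front, hence the induction on m: the first
    coordinate is split off, the rest is concatenated, and the coordinate is put back. For m = 0 the
    first factor is a Dirac mass. *)
Lemma row_mx_mpres m n : measure_preserving
  (prodm (@lebesgue_rV R m) (@lebesgue_rV R n)) (@lebesgue_rV R (m + n))
  (fun z => row_mx z.1 z.2).
Proof.
elim: m => [|m IH].
  split=> [|A mA]; first exact: measurable_row_mx.
  rewrite [LHS](_ : _ = \int[dirac (0%R : 'rV[R]_0)]_x lebesgue_rV n
    (xsection ((fun z => row_mx z.1 z.2) @^-1` A) x))%E; last by [].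
  rewrite integral_dirac//; last first.
    apply: measurable_fun_xsection.
    by rewrite -[X in measurable X]setTI; apply: measurable_row_mx.
  rewrite diracT mul1e; congr (lebesgue_rV n _).
  apply/seteqP; split=> x; rewrite /xsection /= inE /=;
  by rewrite row_thin_mx.
have mas : measurable_fun setT
   (fun z : (measurableTypeR R * 'rV[R]_m) * 'rV[R]_n =>
     (z.1.1, (z.1.2, z.2))).
  apply: measurable_fun_pair; first exact: measurableT_comp.
  by apply: measurable_fun_pair => //; exact: measurableT_comp.
have as1 := mpres_can (mpres_assoc (@lebesgue_measure R) (@lebesgue_rV R m)
  (@lebesgue_rV R n)) mas (fun z => match z with (_, (_, _)) => erefl end).
have h1 := mpres_prod (unconsV_mpres m) (mpres_id (@lebesgue_rV R n)).
have h2 := mpres_prod (mpres_id (@lebesgue_measure R)) IH.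
have := mpres_comp (mpres_comp (mpres_comp h1 as1) h2) (consV_mpres (m + n)).
congr measure_preserving; apply/funext => -[x y] /=.
apply/rowP => i; rewrite !mxE.
case: (@splitP 1 (m + n) i) => j ij; rewrite ?mxE.
  case: splitP => k ik; rewrite ?mxE.
    by rewrite (ord1 j) /= mulr1n; congr (x _ _); apply: val_inj;
       rewrite /= -ik ij (ord1 j).
  by move: ik; rewrite ij (ord1 j) addSn.
case: splitP => k ik; case: splitP => l il; rewrite ?mxE.
- by congr (x _ _); apply: val_inj; rewrite /= -ik -il.
- exfalso; have := ltn_ord k; rewrite -[nat_of_ord k]ik => jm.
  by have := leq_addr l m.+1; rewrite -il ij add1n ltnS leqNgt jm.
- exfalso; have := ltn_ord l; rewrite -[nat_of_ord l]il ij ik => jm.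
  by move: jm; rewrite add1n ltnS ltnNge leq_addr.
- congr (y _ _); apply: val_inj => /=; apply/eqP.
  by rewrite -(eqn_add2l m.+1) -il ij ik add1n addSn.
Qed.

Lemma castmx_mpres m n (e : (1 = 1)%N * (m = n)) : measure_preserving
  (@lebesgue_rV R m) (@lebesgue_rV R n) (castmx e).
Proof.
case: e => e1 e2; case: n / e2; rewrite (eq_irrelevance e1 erefl).
exact: mpres_id.
Qed.

End lebesgue_rV_theory.

(** * Borel sets and measures on products of two vector spaces *)

Section borel_rV.
Context {R : realType}.

Lemma measurable_fun_continuous_rV n (V : set 'rV[R]_n) (f : 'rV[R]_n -> R) :
  open V -> (forall x, V x -> {for x, continuous f}) -> measurable_fun V f.
Proof.
move=> oV cf.
apply: (measurability _ (measurable_realfun.RGenOpens.measurableE R)).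
move=> _ [_ [a [b ->] <-]]; apply: open_measurable_rV.
rewrite openE => x [Vx fx]; rewrite /interior.
apply: filterI; first exact: open_nbhs_nbhs.
by apply: (cf x Vx); apply: open_nbhs_nbhs; split=> //; exact: interval_open.
Qed.

(** The product carries the product sigma-algebra, so an open set has to be a countable union of
    measurable boxes. A ball of the product is a box of two balls of the same radius, and each
    factor has a countable base of rational balls. *)
Lemma open_measurable_rV2 m n (O : set ('rV[R]_m * 'rV[R]_n)%type) :
  open O -> measurable O.
Proof.
move=> oO.
pose B k (z : 'rV[rat]_k * nat) : set 'rV[R]_k :=
  ball (map_mx (@ratr R) z.1) (z.2.+1%:R^-1 : R).
have -> : O = \bigcup_k (if unpickle k is Some (z1, z2) then
    if `[< B m z1 `*` B n z2 `<=` O >] then B m z1 `*` B n z2 else set0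
    else set0).
  apply/seteqP; split=> [[x y] Oxy|x [k _]]; last first.
    by case: unpickle => [[z1 z2]|]//; case: asboolP => // + Bx; apply.
  have /nbhs_ballP[e /= e0 eO] : nbhs (x, y) O by exact: open_nbhs_nbhs.
  have := open_bigcup_ball (ball_open x e).
  move=> /seteqP[+ _] => /(_ x (ballxx x e0))[z1 /= z1x xz1].
  have := open_bigcup_ball (ball_open y e).
  move=> /seteqP[+ _] => /(_ y (ballxx y e0))[z2 /= z2y yz2].
  exists (pickle (z1, z2)) => //=; rewrite pickleK; case: asboolP => //.
  by case=> -[x' y'] [/= Bx' By']; apply: eO; split; [exact: z1x|exact: z2y].
apply: bigcupT_measurable => k; case: unpickle => // -[z1 z2].
case: asboolP => // _.
by apply: measurableX; exact: ball_measurable_rV.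
Qed.

Lemma measurable_rV2E m n :
  @measurable _ ('rV[R]_m * 'rV[R]_n)%type =
  <<s @open ('rV[R]_m * 'rV[R]_n)%type >>.
Proof.
apply/seteqP; split=> A; last first.
  move=> mA; apply: (smallest_sub _ _ mA); first exact: sigma_algebra_measurable.
  by move=> O; exact: open_measurable_rV2.
pose T := g_sigma_algebraType (@open ('rV[R]_m * 'rV[R]_n)%type).
have m1 : measurable_fun [set: T] (fst : T -> 'rV[R]_m).
  apply: (@measurability _ _ _ 'rV[R]_m _ _ open) => //.
  move=> _ [U oU <-]; rewrite setTI; apply: sub_sigma_algebra.
  by apply: open_comp => // -[x y] _; exact: cvg_fst.
have m2 : measurable_fun [set: T] (snd : T -> 'rV[R]_n).
  apply: (@measurability _ _ _ 'rV[R]_n _ _ open) => //.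
  move=> _ [U oU <-]; rewrite setTI; apply: sub_sigma_algebra.
  by apply: open_comp => // -[x y] _; exact: cvg_snd.
have := @measurable_fun_pair _ _ _ T _ _ _ _ m1 m2.
move=> /(_ measurableT A) mid mA; have := mid mA; rewrite setTI.
by congr (_ _); apply/seteqP; split=> -[].
Qed.

Lemma lebesgue_rV_ball n (x : 'rV[R]_n) (e : R) : (lebesgue_rV n (ball x e) < +oo)%E.
Proof.
have [e0|e0] := leP e 0.
  by rewrite (_ : ball x e = set0) ?measure0// -subset0 => y [] /lt_geF; rewrite e0.
have -> : ball x e = [set v | forall i, (ball (x 0 i) e) (v 0 i)].
  apply/seteqP; split=> [y [_ xy] i|y xy]; first exact: xy.
  by split=> // i j; rewrite (ord1 i); exact: xy.
have mb i : measurable (ball (x 0 i) e : set (measurableTypeR R)).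
  by apply: measurable_realfun.open_measurable; exact: ball_open.
rewrite (@lebesgue_rV_box R n (fun i => ball (x 0 i) e) mb).2.
under eq_bigr do rewrite lebesgue_measure_ball ?ltW//.
by rewrite prodEFin ltry.
Qed.

(** Open sets are stable under intersection and generate the product sigma-algebra, and balls of
    integer radius exhaust the space. Volume preservation of the flow can thus be checked on open
    sets, which behave well under limits of maps. *)
Lemma measure_rV2_unique m n
    (m1 m2 : {measure set ('rV[R]_m * 'rV[R]_n)%type -> \bar R}) :
  (forall O, open O -> m1 O = m2 O) ->
  (forall k : nat, (m1 (ball (0%R, 0%R) k%:R) < +oo)%E) ->
  forall A, measurable A -> m1 A = m2 A.
Proof.
move=> m12 foo A mA.
apply: (measure_unique (@open ('rV[R]_m * 'rV[R]_n)%type)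
  (fun k : nat => ball (0%R, 0%R) k%:R)) => //.
- exact: measurable_rV2E.
- by move=> U V; exact: openI.
- move=> k; have [k0|k0] := ltP 0 (k%:R : R); first exact: ball_open.
  rewrite [X in open X](_ : _ = set0); first exact: open0.
  by rewrite -subset0 => -[x y] [[/lt_geF]]; rewrite k0.
- apply/seteqP; split=> // z _.
  exists (Num.bound `|z|).+1 => //.
  have bz : `|z| < (Num.bound `|z|).+1%:R.
    rewrite (lt_le_trans (archi_boundP _))// ler_nat//.
  by rewrite -ball_normE /ball_ /= (_ : (0, 0) = 0)// sub0r normrN.
Qed.

Lemma prodm_rV2_ball m n k :
  (prodm (@lebesgue_rV R m) (@lebesgue_rV R n) (ball (0%R, 0%R) k) < +oo)%E.
Proof.
have -> : ball (0%R, 0%R) k = ball (0 : 'rV[R]_m) k `*` ball (0 : 'rV[R]_n) k.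
  by apply/seteqP; split=> -[].
have := product_measure1E (@lebesgue_rV R m) (@lebesgue_rV R n)
  (ball_measurable_rV 0 k) (ball_measurable_rV 0 k).
move=> h; rewrite [ltLHS]h lte_mul_pinfty//; last exact: lebesgue_rV_ball.
by rewrite ge0_fin_numE ?lebesgue_rV_ball.
Qed.

End borel_rV.

(** * Splitting a vector into old and new coordinates *)

Section extend_theory.
Context {R : realType} (D : dhmc R) (N : nat).
Local Notation vec := 'rV[R]_(dim D N).
Local Notation vec' := 'rV[R]_(dim D N.+1 - dim D N).
Implicit Types (x : vec) (y : vec') (z : 'rV[R]_(dim D N.+1)).

Lemma extendK1 x y : old_part (extend x y) = x.
Proof.
rewrite /old_part /extend.
have -> : castmx (erefl 1%N, esym (dim_split D N))
  (castmx (erefl 1%N, dim_split D N) (row_mx x y)) = row_mx x y.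
  by rewrite castmx_comp castmx_id.
by rewrite row_mxKl.
Qed.

Lemma extendK2 x y : new_part (extend x y) = y.
Proof.
rewrite /new_part /extend.
have -> : castmx (erefl 1%N, esym (dim_split D N))
  (castmx (erefl 1%N, dim_split D N) (row_mx x y)) = row_mx x y.
  by rewrite castmx_comp castmx_id.
by rewrite row_mxKr.
Qed.

Lemma extend_parts z : extend (old_part z) (new_part z) = z.
Proof.
by rewrite /extend /old_part /new_part hsubmxK castmx_comp castmx_id.
Qed.

Lemma castmxN m n (e : (1 = 1)%N * (m = n)) (v : 'rV[R]_m) :
  castmx e (- v) = - castmx e v.
Proof.
by case: e => e1 e2; case: n / e2; rewrite (eq_irrelevance e1 erefl).
Qed.

Lemma extendN x y : extend (- x) (- y) = - extend x y.
Proof. by rewrite /extend -castmxN opp_row_mx. Qed.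

Lemma old_partN z : old_part (- z) = - old_part z.
Proof. by rewrite /old_part castmxN raddfN. Qed.

Lemma new_partN z : new_part (- z) = - new_part z.
Proof. by rewrite /new_part castmxN raddfN. Qed.

Lemma extend_mpres : measure_preserving
  (prodm (@lebesgue_rV R (dim D N)) (@lebesgue_rV R (dim D N.+1 - dim D N)))
  (@lebesgue_rV R (dim D N.+1))
  (fun z : vec * vec' => extend z.1 z.2).
Proof.
exact: (mpres_comp (row_mx_mpres _ _) (castmx_mpres (erefl, dim_split D N))).
Qed.

Lemma measurable_old_part d (T : measurableType d) (E : set T)
    (f : T -> 'rV[R]_(dim D N.+1)) :
  measurable_fun E f -> measurable_fun E (fun t => @old_part R D N (f t)).
Proof.
move=> mf; apply: measurable_rV_coord => i.
under eq_fun do rewrite /old_part mxE castmxE ord1.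
exact: measurable_coord_comp.
Qed.

Lemma measurable_new_part d (T : measurableType d) (E : set T)
    (f : T -> 'rV[R]_(dim D N.+1)) :
  measurable_fun E f -> measurable_fun E (fun t => @new_part R D N (f t)).
Proof.
move=> mf; apply: measurable_rV_coord => i.
under eq_fun do rewrite /new_part mxE castmxE ord1.
exact: measurable_coord_comp.
Qed.

Lemma measurable_extend d (T : measurableType d) (E : set T)
    (f : T -> vec) (g : T -> vec') :
  measurable_fun E f -> measurable_fun E g ->
  measurable_fun E (fun t => @extend R D N (f t) (g t)).
Proof.
move=> mf mg; apply: (measurableT_comp extend_mpres.1 (measurable_pair_on mf mg)).
Qed.

End extend_theory.

(** * Increments of functions with partial derivatives *)

Section increments.
Context {R : realType}.

(** Mean value theorem, in a form that does not order [a] and [b]: increments along a coordinate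
    axis may have either sign. *)
Lemma increment_bound (f df : R -> R) (a b c e : R) :
  (forall t, Num.min a b <= t <= Num.max a b ->
     is_derive t 1 f (df t) /\ `|df t - c| <= e) ->
  `|f b - f a - c * (b - a)| <= e * `|b - a|.
Proof.
wlog ab : a b / a <= b => [hw|] fP.
  case/orP: (le_total a b) => [/hw|/hw h]; first exact.
  rewrite -normrN [X in `|X|](_ : _ = f a - f b - c * (a - b)); last by ring.
  by rewrite -(distrC a); apply: h => t tab; apply: fP; rewrite minC maxC.
move: fP; rewrite (min_idPl ab) (max_idPr ab) => fP.
have [||t tab ->] := @MVT_segment R f df a b ab.
- move=> t; rewrite in_itv /= => /andP[? ?].
  by case: (fP t) => //; rewrite !ltW.
- apply: continuous_in_subspaceT => t; rewrite inE /= in_itv /= => tab.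
  have [d _] := fP t tab; apply: differentiable_continuous.
  by apply/derivable1_diffP; case: d.
- rewrite -mulrBl normrM ler_wpM2r//; move: tab; rewrite in_itv /= => tab.
  by have [] := fP t tab.
Qed.

Lemma is_derive_line n (f : 'rV[R]_n -> R) (z v : 'rV[R]_n) t :
  derivable f (z + t *: v) v ->
  is_derive t 1 (fun s : R => f (z + s *: v)) ('D_v f (z + t *: v)).
Proof.
have E : (fun h => h^-1 *: (((fun s : R => f (z + s *: v)) \o shift t) (h *: 1)
    - f (z + t *: v))) =
  (fun h => h^-1 *: ((f \o shift (z + t *: v)) (h *: v) - f (z + t *: v))).
  apply/funext => h; congr (_ *: (f _ - _)) => /=.
  by rewrite scalerDl addrCA -[h *: 1]/(h * 1) mulr1.
by move=> dv; apply: DeriveDef; rewrite /derivable /derive E.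
Qed.

Lemma coord_le_norm n (x : 'rV[R]_n) i : `|x 0 i| <= `|x|.
Proof.
rewrite [leRHS]/Num.norm /= mx_normrE.
exact: (@le_bigmax _ _ _ 0 (fun ij : 'I_1 * 'I_n => `|x ij.1 ij.2|) (0, i)).
Qed.

Lemma norm_le_coord n (x : 'rV[R]_n) e :
  0 <= e -> (forall i, `|x 0 i| <= e) -> `|x| <= e.
Proof.
move=> e0 xe; rewrite [leLHS]/Num.norm /= mx_normrE.
by apply/bigmax_leP; split=> // -[i j] _ /=; rewrite (ord1 i).
Qed.

Lemma norm_lt_coord n (x : 'rV[R]_n) e :
  0 < e -> (forall i, `|x 0 i| < e) -> `|x| < e.
Proof.
move=> e0 xe; rewrite [ltLHS]/Num.norm /= mx_normrE.
by apply/bigmax_ltP; split=> // -[i j] _ /=; rewrite (ord1 i).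
Qed.

Lemma ball_rVE n (x y : 'rV[R]_n) e : 0 < e ->
  ball x e y <-> forall i, `|x 0 i - y 0 i| < e.
Proof.
move=> e0; rewrite -ball_normE /ball_ /=; split=> [xy i|xy].
  by apply: le_lt_trans xy; have := coord_le_norm (x - y) i; rewrite !mxE.
by apply: norm_lt_coord => // i; rewrite !mxE.
Qed.

(** The path from [x] to [y] changes one coordinate at a time; a ball of the sup norm is a cube, so
    the path stays inside. With [c] = 0 this is a Lipschitz bound, and with [c] the gradient at [a]
    it is differentiability at [a]. *)
Lemma partial_increment n (f : 'rV[R]_n -> R) (a x y c : 'rV[R]_n) (r e : R) :
  0 < r -> ball a r x -> ball a r y ->
  (forall z, ball a r z -> forall j, derivable f z (delta_mx 0 j) /\
     `|partial j f z - c 0 j| <= e) ->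
  `|f y - f x - \sum_j c 0 j * (y 0 j - x 0 j)| <= e * \sum_j `|y 0 j - x 0 j|.
Proof.
move=> r0 /(ball_rVE _ _ r0) ax /(ball_rVE _ _ r0) ay fP.
pose z (k : nat) : 'rV[R]_n := \row_i (if (i < k)%N then y 0 i else x 0 i).
have z0 : z 0%N = x by apply/rowP => i; rewrite mxE.
have zn : z n = y by apply/rowP => i; rewrite mxE ltn_ord.
have -> : f y - f x = \sum_(j < n) (f (z j.+1) - f (z j)).
  by rewrite -zn -z0 -(telescope_sumr (fun k => f (z k)))// big_mkord.
rewrite -sumrB mulr_sumr (le_trans (ler_norm_sum _ _ _))// ler_sum// => j _.
have zS s : (z j + s *: delta_mx 0 j) 0 j = x 0 j + s.
  by rewrite !mxE ltnn !eqxx mulr1.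
have zSn s i : i != j -> (z j + s *: delta_mx 0 j) 0 i = z j 0 i.
  by move=> ij; rewrite !mxE (negbTE ij) andbF mulr0 addr0.
have -> : z j.+1 = z j + (y 0 j - x 0 j) *: delta_mx 0 j.
  apply/rowP => i; have [->|ij] := eqVneq i j.
    by rewrite zS mxE leqnn addrC subrK.
  by rewrite zSn// !mxE ltnS leq_eqVlt (negbTE (ij : (i : nat) != j)).
have -> : f (z j) = f (z j + 0 *: delta_mx 0 j) by rewrite scale0r addr0.
have := @increment_bound (fun s => f (z j + s *: delta_mx 0 j))
  (fun s => partial j f (z j + s *: delta_mx 0 j)) 0 (y 0 j - x 0 j) (c 0 j) e.
rewrite subr0; apply => t t01.
have az : ball a r (z j + t *: delta_mx 0 j).
  apply/(ball_rVE _ _ r0) => i; have [->|ij] := eqVneq i j; last first.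
    by rewrite zSn// mxE; case: ifP.
  rewrite zS; move: t01; have := ax j; have := ay j.
  rewrite !ltr_distl ge_min le_max => /andP[? ?] /andP[? ?].
  by move=> /andP[/orP[?|?] /orP[?|?]]; apply/andP; split; lra.
by have [dv ?] := fP _ az j; split=> //; exact: is_derive_line.
Qed.

End increments.

Lemma ler_sum2 (R : numDomainType) (I J : finType) (F : I -> J -> R) i j :
  (forall i j, 0 <= F i j) -> F i j <= \sum_i \sum_j F i j.
Proof.
move=> F0; rewrite (bigD1 i)//= (bigD1 j)//= -addrA lerDl addr_ge0//.
  by rewrite sumr_ge0.
by apply: sumr_ge0 => k _; exact: sumr_ge0.
Qed.

(** * Local Lipschitz bound for the force, and the chain rule *)

Section smooth_potential.
Context {R : realType} {n : nat}.
Variables (V : set 'rV[R]_n) (U : 'rV[R]_n -> R).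
Hypothesis oV : open V.
Hypothesis sU : smooth_on V U.

Lemma gradient_lipschitz_near x : V x -> exists2 r : R, 0 < r &
  exists2 L : R, 0 <= L & forall y y', ball x r y -> ball x r y' ->
    V y /\ `|gradient U y - gradient U y'| <= L * `|y - y'|.
Proof.
move=> Vx.
(* At [x] the double sum dominates every second derivative; the added 1 leaves room for their
   variation near [x]. *)
pose M : R := \sum_(k < n) \sum_(j < n) `|partial j (partial k U) x| + 1.
have M0 : 0 <= M.
  by rewrite addr_ge0// sumr_ge0// => k _; rewrite sumr_ge0.
have nV : nbhs x V by exact: open_nbhs_nbhs.
have nM : \forall y \near x, forall k j, `|partial j (partial k U) y| <= M.
  apply: (@filter_forall _ _ (fun k y => forall j,
    `|partial j (partial k U) y| <= M) (nbhs x) _) => k.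
  apply: (@filter_forall _ _ (fun j y => `|partial j (partial k U) y| <= M) (nbhs x) _) => j.
  have [/cvgrPdist_le/(_ 1 ltr01) + _] := sU [:: j; k] Vx.
  apply: filterS => y /= xy.
  move: xy.
  have := @ler_sum2 R _ _ (fun k j : 'I_n => `|partial j (partial k U) x|) k j
    (fun _ _ => normr_ge0 _).
  rewrite /= /M; move: (partial j (partial k U) x) (partial j (partial k U) y) => a b.
  move: (\sum_(k < n) _) => S aS ab; rewrite -(subKr a b).
  by rewrite (le_trans (ler_normB _ _))// lerD.
have [r /= r0 rP] := (nbhs_ballP _ _).1 (filterI nV nM).
exists r => //; exists (M * n%:R); first by rewrite mulr_ge0.
move=> y y' xy xy'; split; first by have [] := rP _ xy.
apply: norm_le_coord => [|k]; first by rewrite !mulr_ge0.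
rewrite !mxE.
have := @partial_increment _ _ (partial k U) x y' y 0 r M r0 xy' xy.
rewrite [X in _ - X]big1 ?subr0; last by move=> j _; rewrite mxE mul0r.
move=> le; apply: (le_trans (le _)) => [z /rP[Vz zM] j|].
  by rewrite mxE subr0; split=> //; have [_] := sU [:: k] Vz; exact.
rewrite -mulrA ler_wpM2l//.
have -> : n%:R * `|y - y'| = \sum_(j < n) `|y - y'|.
  by rewrite sumr_const card_ord mulr_natl.
by apply: ler_sum => j _; have := coord_le_norm (y - y') j; rewrite !mxE.
Qed.

Lemma is_derive_coord (q : R -> 'rV[R]_n) (v : 'rV[R]_n) (t : R) i :
  is_derive t 1 q v -> is_derive t 1 (fun s => q s 0 i) (v 0 i).
Proof.
move=> [dq dv]; have dc := (derivable_mxP q t 1).1 dq.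
by apply: DeriveDef; [exact: dc|rewrite -dv derive_mx// mxE].
Qed.

Lemma is_derive_continuous (q : R -> 'rV[R]_n) (v : 'rV[R]_n) (t : R) :
  is_derive t 1 q v -> {for t, continuous q}.
Proof.
by move=> [dq _]; apply: differentiable_continuous; exact/derivable1_diffP.
Qed.

(** Chain rule along a curve. Smoothness is stated through partial derivatives, so the linear
    approximation of [U] near [q t] comes from [partial_increment] with the gradient at [q t] as
    slope. *)
Lemma is_derive_potential (q : R -> 'rV[R]_n) (v : 'rV[R]_n) (t : R) :
  V (q t) -> is_derive t 1 q v ->
  is_derive t 1 (fun s => U (q s)) (\sum_j gradient U (q t) 0 j * v 0 j).
Proof.
move=> Vq dq; set S := \sum_j _.
suff H : (fun h : R => h^-1 *: (((fun s => U (q s)) \o shift t) (h *: 1)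
    - U (q t))) @ 0^' --> S.
  by apply: DeriveDef; [apply/cvg_ex; exists S|exact: cvg_lim].
pose D j (h : R) := h^-1 *: (q (h *: 1 + t) 0 j - q t 0 j).
have Dv j : D j @ 0^' --> v 0 j.
  have [/cvg_ex[l dl] dv] := is_derive_coord j dq.
  by rewrite -dv (_ : 'D_1 _ t = l); [exact: dl|exact: cvg_lim dl].
have SD : (fun h => \sum_j gradient U (q t) 0 j * D j h) @ 0^' --> S.
  rewrite /S; elim: (index_enum _) => [|j r IH].
    by rewrite big_nil; under eq_fun do rewrite big_nil; exact: cvg_cst.
  rewrite big_cons; under eq_fun do rewrite big_cons.
  by apply: (cvgD _ IH); apply: cvgMl_tmp; exact: Dv.
(* The error of the linear approximation, divided by [h], tends to 0 because the difference
   quotients [D j] stay bounded; [M] bounds their sum for small [h]. *)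
have E0 : (fun h => h^-1 *: (((fun s => U (q s)) \o shift t) (h *: 1) - U (q t)) -
    \sum_j gradient U (q t) 0 j * D j h) @ 0^' --> (0 : R).
  apply/cvgrPdist_le => e e0.
  pose M := \sum_(j < n) (`|v 0 j| + 1) + 1.
  have M0 : 0 < M by rewrite ltr_wpDl// sumr_ge0// => j _; rewrite addr_ge0.
  have e'0 : 0 < e / M by rewrite divr_gt0.
  have nV : nbhs (q t) V by exact: open_nbhs_nbhs.
  have ng : \forall y \near q t, forall j,
      `|partial j U y - gradient U (q t) 0 j| <= e / M.
    apply: (@filter_forall _ _ (fun j y =>
      `|partial j U y - gradient U (q t) 0 j| <= e / M) (nbhs (q t)) _) => j.
    have [/cvgrPdist_le/(_ _ e'0) + _] := sU [:: j] Vq.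
    by apply: filterS => y /=; rewrite mxE distrC.
  have [r /= r0 rP] := (nbhs_ballP _ _).1 (filterI nV ng).
  have cq : (fun h : R => q (h *: 1 + t)) @ 0^' --> q t.
    apply: (@cvg_within_filter _ _ _ (nbhs (0 : R))).
    have -> : (fun h : R => q (h *: 1 + t)) = q \o shift t.
      by apply/funext => h /=; rewrite -[h *: 1]/(h * 1) mulr1.
    by rewrite cvg_comp_shift add0r; exact: (is_derive_continuous dq).
  have nq : \forall h \near (0 : R)^', ball (q t) r (q (h *: 1 + t)).
    by apply: (cq (ball (q t) r)); exact: nbhsx_ballx.
  have nD : \forall h \near (0 : R)^', forall j, `|D j h| <= `|v 0 j| + 1.
    apply: (@filter_forall _ _ (fun j h => `|D j h| <= `|v 0 j| + 1) 0^' _) => j.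
    have /cvgrPdist_le/(_ 1 ltr01) := Dv j; apply: filterS => h vD.
    rewrite -(subrK (v 0 j) (D j h)) (le_trans (ler_normD _ _))// addrC lerD//.
    by rewrite distrC.
  near=> h.
  rewrite sub0r normrN.
  have h0 : h != 0 by near: h; exact: nbhs_dnbhs_neq.
  have qh : ball (q t) r (q (h *: 1 + t)).
    by near: h; exact: nq.
  have Dh : forall j, `|D j h| <= `|v 0 j| + 1 by near: h; exact: nD.
  have le : `|U (q (h *: 1 + t)) - U (q t) -
      \sum_j gradient U (q t) 0 j * (q (h *: 1 + t) 0 j - q t 0 j)| <=
      e / M * \sum_j `|q (h *: 1 + t) 0 j - q t 0 j|.
    apply: (partial_increment r0 (ballxx _ r0) qh) => y /rP[Vy yP] j.
    by split; [have [_] := sU [::] Vy; exact|exact: yP].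
  rewrite (_ : _ - _ = h^-1 * (U (q (h *: 1 + t)) - U (q t) -
    \sum_j gradient U (q t) 0 j * (q (h *: 1 + t) 0 j - q t 0 j))); last first.
    rewrite mulrBr mulr_sumr; congr (_ - _); apply: eq_bigr => j _.
    by rewrite /D mulrCA.
  rewrite normrM; apply: (le_trans (ler_wpM2l (normr_ge0 _) le)).
  rewrite mulrCA mulr_sumr -[leRHS](divfK (lt0r_neq0 M0)).
  rewrite ler_wpM2l ?(ltW e'0)// /M.
  apply: (@le_trans _ _ (\sum_(j < n) (`|v 0 j| + 1))); last by rewrite lerDl.
  by apply: ler_sum => j _; have := Dh j; rewrite /D normrM.
have := cvgD E0 SD; rewrite add0r; under eq_cvg do rewrite subrK.
by move=> /(_ _); apply.
Unshelve. all: by end_near.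
Qed.

End smooth_potential.

(** * Volume preservation of the Hamiltonian flow *)

Section symplectic_euler.
Context {R : realType} {n : nat}.
Variables (V : set 'rV[R]_n) (U : 'rV[R]_n -> R) (m : R).
Hypothesis oV : open V.
Hypothesis sU : smooth_on V U.
Hypothesis m0 : 0 < m.
Local Notation vec := 'rV[R]_n.

Definition trajectory (q p : R -> vec) := forall t : R,
  [/\ V (q t), is_derive t 1 q (m^-1 *: p t) &
      is_derive t 1 p (- gradient U (q t))].

(* The force is cut off outside of the domain, so that a step is a composition
   of two shears of the whole space, whatever [V] and [U] are. *)
Definition euler_step (h : R) (z : vec * vec) : vec * vec :=
  let p := z.2 - h *: ((gradient U \_ V) z.1) in (z.1 + (h / m) *: p, p).

(** Compactness of [0, T] in its near-covering form, with the filter at infinity on [k]. The same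
    integer provides the radius, as an inverse, and the Lipschitz constant, so a single limit in [k]
    serves both. *)
Lemma trajectory_tube q p T : trajectory q p ->
  exists k : nat, forall s, 0 <= s <= T -> forall y,
    `|y - q s| < k.+1%:R^-1 ->
    V y /\ `|gradient U y - gradient U (q s)| <= k.+1%:R * `|y - q s|.
Proof.
move=> tr.
have cq s : {for s, continuous q} by have [_ + _] := tr s; exact: is_derive_continuous.
have := (compact_near_coveringP `[0, T]).1 (@segment_compact R 0 T).
move=> /(_ nat \oo (fun k s => forall y, `|y - q s| < k.+1%:R^-1 ->
    V y /\ `|gradient U y - gradient U (q s)| <= k.+1%:R * `|y - q s|) _).
case.
  move=> s _; have [Vs _ _] := tr s.
  have [r r0 [L L0 rL]] := gradient_lipschitz_near oV sU Vs.
  have r20 : 0 < r / 2 by rewrite divr_gt0.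
  have nq : \forall t \near s, ball (q s) (r / 2) (q t).
    by apply: (cq s (ball (q s) (r / 2))); exact: nbhsx_ballx.
  have nk : \forall k \near \oo, k.+1%:R^-1 < r / 2 /\ L <= k.+1%:R.
    near=> k; split; first by near: k; exact: (near_infty_natSinv_lt (PosNum r20)).
    near: k; exists (Num.bound L) => // k /= Lk.
    by rewrite (le_trans (ltW (archi_boundP L0)))// ler_nat (leq_trans Lk).
  exists ([set t | ball (q s) (r / 2) (q t)],
    [set k | k.+1%:R^-1 < r / 2 /\ L <= k.+1%:R]) => //.
  move=> [t k] /= [bt [kr Lk]] y yt.
  have bt' : ball (q s) r (q t) by apply: le_ball bt; lra.
  have by' : ball (q s) r y.
    rewrite (splitr r); apply: ball_triangle bt _.
    by rewrite -ball_normE /ball_ /= distrC (lt_trans yt).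
  have [Vy le] := rL y (q t) by' bt'.
  by split=> //; rewrite (le_trans le)// ler_wpM2r.
move=> k _ /(_ k (leqnn k)) kP; exists k => s sT y; apply: kP.
by rewrite /= in_itv.
Unshelve. all: by end_near.
Qed.

Section one_step.
Variables (q p : R -> vec) (T r L C : R).
Hypothesis tr : trajectory q p.
Hypothesis L0 : 0 <= L.
Hypothesis C0 : 0 <= C.
Hypothesis tube : forall s, 0 <= s <= T -> forall y, `|y - q s| < r ->
  V y /\ `|gradient U y - gradient U (q s)| <= L * `|y - q s|.
Hypothesis speed : forall s, 0 <= s <= T ->
  `|m^-1 *: p s| <= C /\ `|gradient U (q s)| <= C.

Let between (s t u : R) : 0 <= s <= T -> 0 <= t <= T ->
  Num.min s t <= u <= Num.max s t -> 0 <= u <= T.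
Proof.
move=> /andP[s0 sT] /andP[t0 tT] /andP[ul uu]; apply/andP; split.
  by apply: le_trans ul; rewrite le_min s0.
by apply: (le_trans uu); rewrite ge_max sT.
Qed.

Lemma trajectory_pos_lip s t : 0 <= s <= T -> 0 <= t <= T ->
  `|q t - q s| <= C * `|t - s|.
Proof.
move=> sT tT; apply: norm_le_coord => [|i]; first by rewrite mulr_ge0.
have := @increment_bound R (fun u => q u 0 i) (fun u => (m^-1 *: p u) 0 i) s t 0 C.
rewrite mul0r subr0 !mxE; apply => u ust.
have uT := between sT tT ust.
have [_ dq _] := tr u; split; first exact: is_derive_coord.
by rewrite subr0 (le_trans (coord_le_norm _ _))//; have [] := speed uT.
Qed.

Lemma trajectory_mom_lip s t : 0 <= s <= T -> 0 <= t <= T ->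
  `|p t - p s| <= C * `|t - s|.
Proof.
move=> sT tT; apply: norm_le_coord => [|i]; first by rewrite mulr_ge0.
have := @increment_bound R (fun u => p u 0 i)
  (fun u => (- gradient U (q u)) 0 i) s t 0 C.
rewrite mul0r subr0 !mxE; apply => u ust.
have uT := between sT tT ust.
have [_ _ dp] := tr u; split; first exact: is_derive_coord.
rewrite subr0 (le_trans (coord_le_norm _ _))// normrN.
by have [] := speed uT.
Qed.

(** [e'] bounds the error on the force during the step: [L * e] because [z] starts at distance [e]
    from the trajectory, [L * (C * h)] because the trajectory moves by at most [C * h]. The
    conditions [e < r] and [C * h < r] keep both in the tube. The new position is computed with the
    new momentum, hence the nested bound in its error. *)
Lemma euler_step_error s h e (z : vec * vec) :
  0 <= s -> 0 <= h -> s + h <= T -> C * h < r -> 0 <= e -> e < r ->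
  `|z.1 - q s| <= e -> `|z.2 - p s| <= e ->
  let e' := L * e + L * (C * h) in
  `|(euler_step h z).2 - p (s + h)| <= e + h * e' /\
  `|(euler_step h z).1 - q (s + h)| <= e + (h / m) * (C * h + (e + h * e')).
Proof.
move=> s0 h0 shT Chr e0 er zq zp e'.
have sT : 0 <= s <= T by rewrite s0 (le_trans _ shT)// lerDl.
have shT' : 0 <= s + h <= T by rewrite shT addr_ge0.
have e'0 : 0 <= e' by rewrite addr_ge0 ?mulr_ge0.
have [Vz gz] := tube sT (le_lt_trans zq er).
have shE : s + h - s = h by rewrite addrAC subrr add0r.
have ssh : s <= s + h by rewrite lerDl.
set p' := (euler_step h z).2.
have p'E : p' = z.2 - h *: gradient U z.1.
  by rewrite /p' /euler_step /= patchT// inE.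
have ph : `|p' - p (s + h)| <= e + h * e'.
  apply: norm_le_coord => [|i]; first by rewrite addr_ge0 ?mulr_ge0.
  have := @increment_bound R (fun u => p u 0 i)
    (fun u => (- gradient U (q u)) 0 i) s (s + h) (- partial i U z.1) e'.
  rewrite shE (ger0_norm h0) => le.
  rewrite p'E !mxE.
  rewrite (_ : _ - _ = (z.2 - p s) 0 i - (p (s + h) 0 i - p s 0 i -
    (- partial i U z.1) * h)); last by rewrite !mxE; ring.
  rewrite (le_trans (ler_normB _ _))// lerD//.
    exact: (le_trans (coord_le_norm _ _)).
  rewrite [leRHS]mulrC; apply: le => u ust; have [_ _ dp] := tr u.
  split; first exact: is_derive_coord.
  have uT := between sT shT' ust.
  move: ust; rewrite (min_idPl ssh) (max_idPr ssh) => /andP[su ush].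
  have qu : `|q u - q s| <= C * h.
    apply: (le_trans (trajectory_pos_lip sT uT)); rewrite ler_wpM2l//.
    by rewrite ger0_norm ?subr_ge0// lerBlDl.
  have [_ gu] := tube sT (le_lt_trans qu Chr).
  rewrite (_ : _ - _ = (gradient U z.1 - gradient U (q s)) 0 i -
    (gradient U (q u) - gradient U (q s)) 0 i); last by rewrite !mxE; ring.
  rewrite (le_trans (ler_normB _ _))// lerD//.
    by rewrite (le_trans (coord_le_norm _ _))// (le_trans gz)// ler_wpM2l.
  by rewrite (le_trans (coord_le_norm _ _))// (le_trans gu)// ler_wpM2l.
split=> //.
have f0 : 0 <= C * h + (e + h * e') by rewrite !addr_ge0 ?mulr_ge0.
apply: norm_le_coord => [|i].
  by rewrite addr_ge0 ?mulr_ge0 ?invr_ge0 ?(ltW m0)//.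
have := @increment_bound R (fun u => q u 0 i)
  (fun u => (m^-1 *: p u) 0 i) s (s + h) (m^-1 * p' 0 i)
  (m^-1 * (C * h + (e + h * e'))).
rewrite shE (ger0_norm h0) => le.
rewrite [(euler_step h z).1]/(z.1 + (h / m) *: p') !mxE.
rewrite (_ : _ - _ = (z.1 - q s) 0 i - (q (s + h) 0 i - q s 0 i -
  (m^-1 * p' 0 i) * h)); last by rewrite !mxE; ring.
rewrite (le_trans (ler_normB _ _))// lerD//.
  exact: (le_trans (coord_le_norm _ _)).
rewrite [leRHS](_ : _ = m^-1 * (C * h + (e + h * e')) * h); last by ring.
apply: le => u ust; have [_ dq _] := tr u.
split; first exact: is_derive_coord.
have uT := between sT shT' ust.
move: ust; rewrite (min_idPl ssh) (max_idPr ssh) => /andP[su ush].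
rewrite mxE -mulrBr normrM gtr0_norm ?invr_gt0// ler_wpM2l ?invr_ge0 ?(ltW m0)//.
rewrite (_ : _ - _ = (p u - p (s + h)) 0 i - (p' - p (s + h)) 0 i); last first.
  by rewrite !mxE; ring.
rewrite (le_trans (ler_normB _ _))// lerD//.
  rewrite (le_trans (coord_le_norm _ _))//.
  apply: (le_trans (trajectory_mom_lip shT' uT)); rewrite ler_wpM2l//.
  by rewrite ler0_norm ?subr_le0// opprB lerBlDr addrC -lerBlDr; lra.
exact: (le_trans (coord_le_norm _ _)).
Qed.

(** Discrete Gronwall inequality. [K] and [K'] add the contributions of the momentum and of the
    position in [euler_step_error], with one factor [h] replaced by [T] in the terms of higher
    order. *)
Lemma euler_iter_error (k : nat) (h e0 : R) (z : vec * vec) :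
  let K := L + (1 + L * T) / m in
  let K' := L * C + (L * C * T + C) / m in
  let e k := (1 + K * h) ^+ k * (e0 + k%:R * (K' * h ^+ 2)) in
  0 <= h -> h <= T -> k%:R * h <= T -> C * h < r -> 0 <= e0 -> e k < r ->
  `|z.1 - q 0| <= e0 -> `|z.2 - p 0| <= e0 ->
  let w := iter k (euler_step h) z in
  `|w.1 - q (k%:R * h)| <= e k /\ `|w.2 - p (k%:R * h)| <= e k.
Proof.
move=> K K' e h0 hT + Chr e00 + zq zp.
have T0 : 0 <= T := le_trans h0 hT.
have K0 : 0 <= K.
  by rewrite addr_ge0// mulr_ge0 ?invr_ge0 ?(ltW m0)// addr_ge0 ?mulr_ge0.
have K'0 : 0 <= K'.
  by rewrite addr_ge0 ?mulr_ge0 ?invr_ge0 ?addr_ge0 ?mulr_ge0 ?(ltW m0).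
have Kh1 : 1 <= 1 + K * h by rewrite lerDl mulr_ge0.
have Kh2 : 0 <= K' * h ^+ 2 by rewrite mulr_ge0 ?exprn_ge0.
have e_ge0 j : 0 <= e j.
  by rewrite mulr_ge0 ?exprn_ge0 ?addr_ge0 ?mulr_ge0 ?(le_trans ler01 Kh1).
have eS j : (1 + K * h) * e j + K' * h ^+ 2 <= e j.+1.
  have -> : e j.+1 = (1 + K * h) * e j + (1 + K * h) ^+ j.+1 * (K' * h ^+ 2).
    by rewrite /e exprS -natr1; ring.
  by rewrite lerD2l ler_peMl// exprn_ege1.
have e_incr j : e j <= e j.+1.
  apply: le_trans (eS j); rewrite mulrDl mul1r -addrA lerDl.
  by rewrite addr_ge0// mulr_ge0 ?e_ge0// mulr_ge0.
have step (j : nat) (w : vec * vec) : j.+1%:R * h <= T -> e j < r ->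
    `|w.1 - q (j%:R * h)| <= e j -> `|w.2 - p (j%:R * h)| <= e j ->
    `|(euler_step h w).1 - q (j.+1%:R * h)| <= e j.+1 /\
    `|(euler_step h w).2 - p (j.+1%:R * h)| <= e j.+1.
  move=> jT ejr wq wp.
  have jE : j.+1%:R * h = j%:R * h + h by rewrite -natr1; ring.
  rewrite jE in jT *.
  have [] := @euler_step_error (j%:R * h) h (e j) w (mulr_ge0 (ler0n _ _) h0)
    h0 jT Chr (e_ge0 j) ejr wq wp.
  have M0 : 0 <= m^-1 by rewrite invr_ge0 ltW.
  have Th : 0 <= T - h by rewrite subr_ge0.
  have E0 := e_ge0 j.
  move=> h1 h2; split; [apply: (le_trans h2)|apply: (le_trans h1)];
    apply: le_trans (eS j); rewrite -subr_ge0.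
    (* The slack between the two bounds is written as a sum of visibly nonnegative terms, [T - h]
       among them. *)
    have -> : (1 + K * h) * e j + K' * h ^+ 2 -
      (e j + h / m * (C * h + (e j + h * (L * e j + L * (C * h))))) =
      h * m^-1 * (T - h) * (L * e j) + h * m^-1 * (T - h) * (L * C * h) +
      L * h * e j + L * C * (h * h).
      by rewrite /K /K'; ring.
    by move: (T - h) (e j) Th E0 => u a u0 a0; rewrite !addr_ge0 ?mulr_ge0.
  have -> : (1 + K * h) * e j + K' * h ^+ 2 -
    (e j + h * (L * e j + L * (C * h))) =
    (1 + L * T) * m^-1 * h * e j + (L * C * T + C) * m^-1 * (h * h).
    by rewrite /K /K'; ring.
  by move: (e j) E0 => a a0; rewrite !(addr_ge0, mulr_ge0).
elim: k => [|k IH] kT ekr.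
  by rewrite /= mul0r /e expr0 mul1r mul0r addr0.
have kT' : k%:R * h <= T by rewrite (le_trans _ kT)// ler_wpM2r// ler_nat.
have ekr' : e k < r := le_lt_trans (e_incr k) ekr.
have [w1 w2] := IH kT' ekr'.
exact: step.
Qed.

End one_step.

(** The iterates may start anywhere within [d] of the trajectory, with the same [N]. This uniformity
    is what later gives the continuity of the flow in its initial point. *)
Lemma euler_cvg q p T : trajectory q p -> 0 <= T -> forall e, 0 < e ->
  exists2 d : R, 0 < d & exists N, forall k (z : vec * vec), (N <= k)%N ->
  `|z.1 - q 0| <= d -> `|z.2 - p 0| <= d ->
  let w := iter k (euler_step (T / k%:R)) z in
  `|w.1 - q T| < e /\ `|w.2 - p T| < e.
Proof.
move=> tr T0 e e0.
have [j tube] := trajectory_tube T tr.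
set r : R := j.+1%:R^-1 in tube; set L : R := j.+1%:R in tube.
have r0 : 0 < r by rewrite invr_gt0.
have L0 : 0 <= L by [].
have [C C0 speed] : exists2 C : R, 0 <= C & forall s, 0 <= s <= T ->
    `|m^-1 *: p s| <= C /\ `|gradient U (q s)| <= C.
  have := (compact_near_coveringP `[0, T]).1 (@segment_compact R 0 T).
  move=> /(_ nat \oo (fun k s => `|m^-1 *: p s| <= k%:R /\
    `|gradient U (q s)| <= k%:R) _); case.
    move=> s; rewrite /= in_itv /= => sT.
    have [Vs dq dp] := tr s.
    have [a a0 [l l0 al]] := gradient_lipschitz_near oV sU Vs.
    have /cvgrPdist_le/(_ 1 ltr01) np := is_derive_continuous dp.
    have nq : \forall t \near s, ball (q s) a (q t).
      have cq := is_derive_continuous dq.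
      by apply: (cq (ball (q s) a)); exact: nbhsx_ballx.
    (* The sum of a bound for the velocity and one for the force near time [s], so that one constant
       dominates both. *)
    pose c := m^-1 * (`|p s| + 1) + (`|gradient U (q s)| + l * a).
    have c0 : 0 <= c.
      by rewrite addr_ge0 ?mulr_ge0 ?invr_ge0 ?addr_ge0 ?mulr_ge0 ?(ltW m0) ?(ltW a0).
    exists ([set t | ball (q s) a (q t) /\ `|p s - p t| <= 1],
      [set k | (Num.bound c <= k)%N]).
      by split; [exact: (filterI nq np)|exists (Num.bound c)].
    move=> [t k] /= [[qt pt] ck].
    have ck' : c <= k%:R by rewrite (le_trans (ltW (archi_boundP c0)))// ler_nat.
    split; apply: le_trans ck'.
      rewrite normrZ gtr0_norm ?invr_gt0// ler_wpDr//.
        by rewrite addr_ge0 ?mulr_ge0// ltW.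
      rewrite ler_wpM2l ?invr_ge0 ?(ltW m0)// -(subKr (p s) (p t)).
      by rewrite (le_trans (ler_normB _ _))// lerD2l.
    rewrite ler_wpDl//.
      by rewrite mulr_ge0 ?invr_ge0 ?addr_ge0 ?(ltW m0).
    have [_ le] := al (q t) (q s) qt (ballxx _ a0).
    rewrite -(subrK (gradient U (q s)) (gradient U (q t))).
    rewrite (le_trans (ler_normD _ _))// addrC lerD2l (le_trans le)//.
    rewrite ler_wpM2l//; move: qt; rewrite -ball_normE /ball_ /= distrC.
    exact: ltW.
  move=> k _ /(_ k (leqnn k)) kP. exists k%:R; first by []. move=> s sT.
  by apply: (kP s); rewrite /= in_itv.
set K := L + (1 + L * T) / m.
set K' := L * C + (L * C * T + C) / m.
have K0 : 0 <= K.
  by rewrite addr_ge0// mulr_ge0 ?invr_ge0 ?(ltW m0)// addr_ge0 ?mulr_ge0.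
have K'0 : 0 <= K'.
  by rewrite addr_ge0 ?mulr_ge0 ?invr_ge0 ?addr_ge0 ?mulr_ge0 ?(ltW m0).
pose M := expR (K * T).
have M0 : 0 < M by exact: expR_gt0.
pose eta := Num.min e r.
have eta0 : 0 < eta by rewrite lt_min e0.
(* An initial error [eta / (4 * M)] is amplified by at most [M = expR (K * T)] and contributes at
   most [eta / 4]. As [eta] is at most [r], the iterates also stay in the tube. *)
exists (eta / (2 * M) / 2); first by rewrite !divr_gt0// mulr_gt0.
(* For [k] above [B], the second term forces [C * h < r], and the last one forces the accumulated
   local errors [M * T * K' * T / k] below [eta / 2]. *)
pose B := 1 + C * T / r + 2 * M * T * K' * T / eta.
have B0 : 0 <= B.
  by rewrite !addr_ge0// ?mulr_ge0 ?invr_ge0 ?(ltW m0) ?(ltW eta0) ?(ltW M0) ?(ltW r0).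
exists (Num.bound B).+1 => k z kB zq zp.
have kB' : B < k%:R.
  by rewrite (lt_le_trans (archi_boundP B0))// ler_nat (leq_trans _ kB).
have k0 : 0 < k%:R :> R by exact: le_lt_trans kB'.
have hk : k%:R * (T / k%:R) = T by rewrite mulrC divfK// gt_eqF.
set h := T / k%:R.
have h0 : 0 <= h by rewrite divr_ge0// ltW.
have hT : h <= T by rewrite ler_pdivrMr// ler_peMr// ler1n -(ltr0n R).
have Chr : C * h < r.
  rewrite /h mulrA ltr_pdivrMr// [ltRHS]mulrC -ltr_pdivrMr//.
  apply: le_lt_trans kB'; rewrite /B -addrA addrCA lerDl addr_ge0//.
  by rewrite ?mulr_ge0 ?invr_ge0 ?(ltW eta0) ?(ltW M0).
have erb : (1 + K * h) ^+ k * (eta / (2 * M) / 2 + k%:R * (K' * h ^+ 2)) < eta.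
  have le1 : (1 + K * h) ^+ k <= M.
    rewrite /M (_ : K * T = k%:R * (K * h)); last by rewrite mulrCA hk.
    rewrite expRM_natl.
    by rewrite lerXn2r ?nnegrE ?expR_ge0 ?expR_ge1Dx// addr_ge0// mulr_ge0.
  apply: (@le_lt_trans _ _ (M * (eta / (2 * M) / 2 + k%:R * (K' * h ^+ 2)))).
    by rewrite ler_wpM2r// addr_ge0 ?mulr_ge0 ?invr_ge0 ?mulr_ge0 ?exprn_ge0 ?(ltW eta0) ?(ltW M0).
  have -> : M * (eta / (2 * M) / 2 + k%:R * (K' * h ^+ 2)) =
      eta / 4 + M * T * K' * T / k%:R.
    by rewrite /h; field; rewrite !gt_eqF.
  have : M * T * K' * T / k%:R < eta / 2; last by move: eta0; lra.
  rewrite ltr_pdivrMr// [ltRHS]mulrC -ltr_pdivrMr ?divr_gt0//.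
  apply: le_lt_trans kB'; rewrite /B.
  have -> : M * T * K' * T / (eta / 2) = 2 * M * T * K' * T / eta.
    by field; rewrite gt_eqF.
  by rewrite lerDr addr_ge0// ?mulr_ge0 ?invr_ge0 ?(ltW r0).
have [] := @euler_iter_error q p T r L C tr L0 C0 tube speed k h
  (eta / (2 * M) / 2) z h0 hT _ Chr _ _ zq zp.
- by rewrite hk.
- by rewrite !divr_ge0 ?mulr_ge0 ?(ltW eta0) ?(ltW M0).
- by rewrite (lt_le_trans erb)// ge_min lexx orbT.
- rewrite -/K -/K' hk => w1 w2.
  by split; [apply: le_lt_trans w1 _|apply: le_lt_trans w2 _];
    rewrite (lt_le_trans erb)// ge_min lexx.
Qed.

End symplectic_euler.

(** * The flow as the limit of the scheme: reversal, energy, continuity, volume *)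

Lemma is_derive_rV (R : realType) n (q : R -> 'rV[R]_n) (v : 'rV[R]_n) (t : R) :
  (forall i, is_derive t 1 (fun s => q s 0 i) (v 0 i)) -> is_derive t 1 q v.
Proof.
move=> dq; have dq' : derivable q t 1.
  by apply/derivable_mxP => i j; rewrite (ord1 i); have [] := dq j.
apply: DeriveDef => //; rewrite derive_mx//; apply/rowP => j; rewrite mxE.
by have [_] := dq j.
Qed.

Lemma is_derive_reverse (R : realType) n (q : R -> 'rV[R]_n) v (T t : R) :
  is_derive (T - t) 1 q v -> is_derive t 1 (fun s => q (T - s)) (- v).
Proof.
move=> dq; apply: is_derive_rV => i.
have h := is_derive_coord i dq.
have hT : is_derive t 1 (fun s : R => T - s) (-1).
  have := is_deriveB (@is_derive_cst R R R T t 1) (@is_derive_id R R t 1).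
  by rewrite sub0r.
have := @is_derive1_comp R (fun s => q s 0 i) (fun s => T - s) t _ _ h hT.
by rewrite mxE mulrN1.
Qed.

Section hamiltonian_flow_theory.
Context {R : realType} {n : nat}.
Variables (V : set 'rV[R]_n) (U : 'rV[R]_n -> R) (m : R).
Hypothesis oV : open V.
Hypothesis sU : smooth_on V U.
Hypothesis m0 : 0 < m.
Local Notation vec := 'rV[R]_n.
Variable phi : R -> vec * vec -> vec * vec.
Hypothesis phi0 : forall z, V z.1 -> phi 0 z = z.
Hypothesis phiP : forall z, V z.1 ->
  trajectory V U m (fun t => (phi t z).1) (fun t => (phi t z).2).

Definition flip (z : vec * vec) := (z.1, - z.2).

Lemma flow_dom t z : V z.1 -> V (phi t z).1.
Proof. by move=> Vz; have [] := phiP Vz t. Qed.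

(** Two trajectories with the same initial point are approximated by the same Euler iterates. *)
Lemma flow_unique q p T : trajectory V U m q p -> 0 <= T ->
  phi T (q 0, p 0) = (q T, p T).
Proof.
move=> tr T0; set z := (q 0, p 0).
have Vz : V z.1 by have [] := tr 0.
have tr' := phiP Vz.
suff : forall e, 0 < e -> `|(phi T z).1 - q T| < e /\ `|(phi T z).2 - p T| < e.
  move=> le; rewrite [LHS]surjective_pairing; congr pair; apply/eqP;
  rewrite -subr_eq0 -normr_eq0 -[_ == _]negbK -normr_gt0 normr_id;
  apply/negP => h.
    by have [] := le _ h; rewrite ltxx.
  by have [_] := le _ h; rewrite ltxx.
move=> e e0; have e20 : 0 < e / 2 by rewrite divr_gt0.
have [d d0 [N NP]] := euler_cvg oV sU m0 tr T0 e20.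
have [d' d'0 [N' N'P]] := euler_cvg oV sU m0 tr' T0 e20.
have [|| w1 w2] := NP (maxn N N') z (leq_maxl _ _); rewrite ?subrr ?normr0 ?ltW//.
have [|| w1' w2'] := N'P (maxn N N') z (leq_maxr _ _);
  rewrite ?phi0// ?subrr ?normr0 ?ltW//.
split; rewrite (splitr e).
  by rewrite (le_lt_trans (ler_distD (iter (maxn N N') (euler_step V U m
    (T / (maxn N N')%:R)) z).1 _ _))// distrC ltrD// distrC.
by rewrite (le_lt_trans (ler_distD (iter (maxn N N') (euler_step V U m
  (T / (maxn N N')%:R)) z).2 _ _))// distrC ltrD// distrC.
Qed.

Lemma trajectory_reverse q p T : trajectory V U m q p ->
  trajectory V U m (fun s => q (T - s)) (fun s => - p (T - s)).
Proof.
move=> tr t; have [Vq dq dp] := tr (T - t); split => //.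
  by rewrite scalerN; exact: is_derive_reverse.
have := is_derive_reverse dp; rewrite opprK => h.
exact: is_deriveN.
Qed.

(** The time-reversed trajectory, with opposite momenta, solves the same equation, so uniqueness
    identifies it with the flow from its own starting point. *)
Lemma flow_reverse T z : V z.1 -> 0 <= T -> phi T (flip (phi T z)) = flip z.
Proof.
move=> Vz T0; have := flow_unique (trajectory_reverse T (phiP Vz)) T0.
by rewrite subr0 subrr phi0.
Qed.

(** Reversal about time 0 reduces negative times to positive ones, where the Euler scheme is
    available. *)
Lemma flow_opp T z : V z.1 -> 0 <= T -> phi (- T) z = flip (phi T (flip z)).
Proof.
move=> Vz T0; have := flow_unique (trajectory_reverse 0 (phiP Vz)) T0.
rewrite subr0 sub0r phi0// => ->.
by rewrite /flip /= opprK -surjective_pairing.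
Qed.

Lemma flow_energy T z : V z.1 ->
  U (phi T z).1 + (\sum_i (phi T z).2 0 i ^+ 2) / (2 * m) =
  U z.1 + (\sum_i z.2 0 i ^+ 2) / (2 * m).
Proof.
move=> Vz.
pose H (t : R) : R := U (phi t z).1 + (\sum_i (phi t z).2 0 i ^+ 2) / (2 * m).
suff dH (t : R) : is_derive t 1 H 0.
  by have := is_derive_0_is_cst T 0 dH; rewrite /H phi0.
have [Vt dq dp] := phiP Vz t.
have h1 := is_derive_potential oV sU Vt dq.
have h2 i : is_derive t 1 (fun s => (phi s z).2 0 i ^+ 2)
    (2 * (phi t z).2 0 i * (- gradient U (phi t z).1) 0 i).
  have di := is_derive_coord i dp.
  have := @is_deriveX _ _ (fun s => (phi s z).2 0 i) 2 t 1 _ di.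
  by move=> h; apply: is_derive_eq; rewrite expr1.
have h3 : is_derive t 1 (fun s => \sum_i (phi s z).2 0 i ^+ 2)
    (\sum_i 2 * (phi t z).2 0 i * (- gradient U (phi t z).1) 0 i).
  have := is_derive_sum h2.
  rewrite (_ : \sum_(i < n) _ = (fun s => \sum_i (phi s z).2 0 i ^+ 2))//.
  by apply/funext => s; rewrite fct_sumE.
have h4 := is_deriveZ (2 * m)^-1 h3.
have := is_deriveD h1 h4.
rewrite [X in is_derive _ _ X _](_ : _ = H); last first.
  by apply/funext => s; rewrite /H [_ / _]mulrC.
move=> h; apply: is_derive_eq.
rewrite -[X in _ + X]/(_ * _) mulr_sumr -big_split big1// => i _ /=.
by rewrite !mxE; field; rewrite gt_eqF.
Qed.

Lemma euler_cvg_flow T z : V z.1 -> 0 <= T ->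
  (fun k => (iter k (euler_step V U m (T / k%:R)) z)) @ \oo --> phi T z.
Proof.
move=> Vz T0; apply/cvgrPdist_lt => e e0.
have [d d0 [N NP]] := euler_cvg oV sU m0 (phiP Vz) T0 e0.
exists N => // k /= Nk; have := NP k z Nk.
rewrite phi0// !subrr !normr0 => /(_ (ltW d0) (ltW d0))[w1 w2].
by rewrite distrC [ltLHS]prod_normE gt_max; apply/andP.
Qed.

(** The iterates from a nearby [y] converge to the flow of [y], and by the uniformity in [euler_cvg]
    they are also close to the flow of [z]. The number of steps may depend on [y]; the radius around
    [z] does not. *)
Lemma flow_continuous T z : V z.1 -> 0 <= T -> {for z, continuous (phi T)}.
Proof.
move=> Vz T0; apply/cvgrPdist_le => e e0.
have e20 : 0 < e / 2 by rewrite divr_gt0.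
have [d d0 [N NP]] := euler_cvg oV sU m0 (phiP Vz) T0 e20.
have nV : \forall y \near z, V y.1.
  have nz : nbhs z.1 V by exact: open_nbhs_nbhs.
  exists (V, setT) => /=; last by move=> y [].
  by split=> //; exact: filterT.
have nd : \forall y \near z, `|z - y| < d.
  by have := nbhsx_ballx z d d0; apply: filterS => y; rewrite -ball_normE.
near=> y.
have Vy : V y.1 by near: y.
have zy : `|z - y| < d by near: y.
move: zy; rewrite [ltLHS]prod_normE gt_max => /andP[/= y1 y2].
have := euler_cvg_flow Vy T0.
move=> /cvgrPdist_lt/(_ _ e20)[N' _ N'P].
have {N'P} := N'P (maxn N N') (leq_maxr _ _).
have := NP (maxn N N') y (leq_maxl _ _).
rewrite phi0// distrC (ltW y1) distrC (ltW y2) => /(_ isT isT).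
move: (iter _ _ _) => w [w1 w2] yw.
have zw : `|w - phi T z| < e / 2 by rewrite [ltLHS]prod_normE gt_max w1.
by rewrite (le_trans (ler_distD w _ _))// (splitr e) lerD// distrC ltW.
Unshelve. all: by end_near. Qed.

Let leb2 := prodm (@lebesgue_rV R n) (@lebesgue_rV R n).

Lemma measurable_force : measurable_fun setT (gradient U \_ V).
Proof.
have mV : measurable V by exact: open_measurable_rV.
apply/(measurable_restrictT _ mV); apply: measurable_rV_coord => i.
under eq_fun do rewrite mxE.
apply: measurable_fun_continuous_rV => // x Vx.
by have [] := sU [:: i] Vx.
Qed.

Lemma measurable_euler_step d (T : measurableType d) (E : set T)
    (h : T -> R) (z : T -> vec * vec) :
  measurable_fun E h -> measurable_fun E z ->
  measurable_fun E (fun x => euler_step V U m (h x) (z x)).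
Proof.
move=> mh mz.
have mz1 : measurable_fun E (fun x => (z x).1) by exact: measurableT_comp.
have mz2 : measurable_fun E (fun x => (z x).2) by exact: measurableT_comp.
have mp : measurable_fun E
    (fun x => (z x).2 - h x *: ((gradient U \_ V) (z x).1)).
  apply: measurable_rV_add => //; apply: measurable_rV_opp.
  by apply: measurable_rV_scale => //; exact: (measurableT_comp measurable_force).
apply: measurable_pair_on => //.
apply: measurable_rV_add => //; apply: measurable_rV_scale => //.
exact: measurable_funM.
Qed.

Lemma euler_step_mpres h : measure_preserving leb2 leb2 (euler_step V U m h).
Proof.
have kick : measure_preserving leb2 leb2
    (fun z => (z.1, z.2 + - (h *: (gradient U \_ V) z.1))).
  apply: (@mpres_fiber _ _ _ _ _ _ _ (lebesgue_rV n) (lebesgue_rV n)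
    (lebesgue_rV n) (fun q p => p + - (h *: (gradient U \_ V) q))).
    apply: measurable_rV_add => //; apply: measurable_rV_opp.
    by apply: measurable_rV_scale => //; exact: (measurableT_comp measurable_force).
  by move=> q; exact: lebesgue_rV_shift.
have drift : measure_preserving leb2 leb2
    (fun z : vec * vec => (z.1, z.2 + (h / m) *: z.1)).
  apply: (@mpres_fiber _ _ _ _ _ _ _ (lebesgue_rV n) (lebesgue_rV n)
    (lebesgue_rV n) (fun p q => q + (h / m) *: p)).
    by apply: measurable_rV_add => //; exact: measurable_rV_scale.
  by move=> p; exact: lebesgue_rV_shift.
have sw := mpres_swap (@lebesgue_rV R n) (@lebesgue_rV R n).
exact: (mpres_comp kick (mpres_comp sw (mpres_comp drift sw))).
Qed.

Lemma euler_iter_mpres h k :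
  measure_preserving leb2 leb2 (iter k (euler_step V U m h)).
Proof.
elim: k => [|k IH]; first exact: mpres_id.
exact: (mpres_comp IH (euler_step_mpres h)).
Qed.

Lemma measurable_flip d (T : measurableType d) (E : set T)
    (z : T -> vec * vec) :
  measurable_fun E z -> measurable_fun E (fun x => flip (z x)).
Proof.
move=> mz; apply: measurable_pair_on; first exact: measurableT_comp.
by apply: measurable_rV_opp; exact: measurableT_comp.
Qed.

Lemma flip_mpres : measure_preserving leb2 leb2 flip.
Proof.
exact: (mpres_prod (mpres_id (@lebesgue_rV R n)) (lebesgue_rV_opp n)).
Qed.

Lemma pair_norm_lt (z : vec * vec) e : `|z| < e -> `|z.1| < e /\ `|z.2| < e.
Proof. by rewrite [ltLHS]prod_normE gt_max => /andP. Qed.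

(** Joint measurability in time and initial point: the flow is a pointwise limit of Euler iterates,
    which are measurable in both. The scheme is run for time [|t|], and [flow_opp] supplies the
    negative times. *)
Lemma measurable_flow d (T : measurableType d) (E : set T)
    (t : T -> R) (z : T -> vec * vec) : (forall x, E x -> V (z x).1) ->
  measurable_fun E t -> measurable_fun E z ->
  measurable_fun E (fun x => phi (t x) (z x)).
Proof.
move=> Vz mt mz mE.
have abs (w : T -> vec * vec) : (forall x, E x -> V (w x).1) ->
    measurable_fun E w -> measurable_fun E (fun x => phi `|t x| (w x)).
  move=> Vw mw.
  have mit k : measurable_fun E
      (fun x => iter k (euler_step V U m (`|t x| / k%:R)) (w x)).
    elim: {1}k => [//|j IH] /=; apply: measurable_euler_step => //.
    by apply: measurable_funM => //; exact: measurableT_comp.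
  have cit x : E x -> (fun k => iter k (euler_step V U m (`|t x| / k%:R)) (w x))
      @ \oo --> phi `|t x| (w x).
    by move=> Ex; apply: euler_cvg_flow => //; exact: Vw.
  rewrite (_ : (fun _ => _) = fun x => ((phi `|t x| (w x)).1, (phi `|t x| (w x)).2));
    last by apply/funext => x; exact: surjective_pairing.
  apply: measurable_pair_on; apply: measurable_rV_coord => i.
    apply: (@measurable_fun_cvg _ _ _ _
      (fun k x => (iter k (euler_step V U m (`|t x| / k%:R)) (w x)).1 0 i)).
      by move=> k; apply: measurable_coord_comp; exact: measurableT_comp.
    move=> x /cit/cvgrPdist_lt cx; apply/cvgrPdist_lt => e /cx; apply: filterS => k.
    move=> /pair_norm_lt[le _]; apply: le_lt_trans le.
    by have := coord_le_norm ((phi `|t x| (w x)).1 -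
      (iter k (euler_step V U m (`|t x| / k%:R)) (w x)).1) i; rewrite !mxE.
  apply: (@measurable_fun_cvg _ _ _ _
    (fun k x => (iter k (euler_step V U m (`|t x| / k%:R)) (w x)).2 0 i)).
    by move=> k; apply: measurable_coord_comp; exact: measurableT_comp.
  move=> x /cit/cvgrPdist_lt cx; apply/cvgrPdist_lt => e /cx; apply: filterS => k.
  move=> /pair_norm_lt[_ le]; apply: le_lt_trans le.
  by have := coord_le_norm ((phi `|t x| (w x)).2 -
    (iter k (euler_step V U m (`|t x| / k%:R)) (w x)).2) i; rewrite !mxE.
rewrite (_ : (fun _ => _) = fun x => phi (t x) (z x))//.
apply: (@eq_measurable_fun _ _ _ _ _ (fun x => if 0 <= t x then
   phi `|t x| (z x) else flip (phi `|t x| (flip (z x))))).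
  move=> x; rewrite inE => Ex; case: ifPn => [t0|].
    by rewrite ger0_norm.
  rewrite -ltNge => t0; rewrite ltr0_norm// -flow_opp ?opprK ?oppr_ge0 ?(ltW t0)//.
  exact: Vz.
apply: (measurable_fun_if mE).
- exact: measurable_fun_ler.
- apply: (measurable_funS mE) => //; exact: abs.
- apply: (measurable_funS mE) => //; apply: measurable_flip; apply: abs => //.
  exact: measurable_flip.
- exact: mE.
Qed.

(** The identity outside the domain makes this a measure-preserving map of the whole space, which
    composes with the other such maps. *)
Definition total_flow (T : R) (z : vec * vec) := if z.1 \in V then phi T z else z.

(** The scheme gives one inequality only: if the flow sends [z] into an open set, so do all but
    finitely many Euler maps, hence the preimage lies in the lower limit of sets of volume [leb2 O].
    Reversibility turns this bound into the opposite one, and open sets determine the measure. *)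
Lemma total_flow_mpres T : 0 <= T -> measure_preserving leb2 leb2 (total_flow T).
Proof.
move=> T0.
pose X : set (vec * vec) := [set z | V z.1].
have oX : open X.
  rewrite openE => z Vz; exists (V, setT); last by move=> y [].
  by split; [exact: open_nbhs_nbhs|exact: filterT].
have mX : measurable X by exact: open_measurable_rV2.
have mphi : measurable_fun X (phi T).
  by apply: (@measurable_flow _ _ X (fun=> T) id) => //; exact: measurable_id.
have oP O : open O -> open (X `&` phi T @^-1` O).
  move=> oO; rewrite openE => z [Vz Oz]; apply: filterI.
    exact: open_nbhs_nbhs.
  have := flow_continuous Vz T0; apply; exact: open_nbhs_nbhs.
have le O : open O -> (leb2 (X `&` phi T @^-1` O) <= leb2 O)%E.
  move=> oO; have mO : measurable O by exact: open_measurable_rV2.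
  pose F k := iter k (euler_step V U m (T / k%:R)).
  have mFO k : measurable (F k @^-1` O).
    by rewrite -[X in measurable X]setTI; apply: (euler_iter_mpres _ k).1.
  (* Increasing in [j], with union the lower limit of the preimages of [O] under the Euler maps. *)
  pose B j := \bigcap_(k in [set k | (j <= k)%N]) F k @^-1` O.
  have mB j : measurable (B j) by exact: bigcap_measurableType.
  have mBu : measurable (\bigcup_j B j) by exact: bigcupT_measurable.
  have sub : X `&` phi T @^-1` O `<=` \bigcup_j B j.
    move=> z [Vz Oz]; have := euler_cvg_flow Vz T0.
    move=> /(_ O (open_nbhs_nbhs (conj oO Oz)))[j _ jP].
    by exists j => // k /= jk; exact: jP.
  apply: (@le_trans _ _ (leb2 (\bigcup_j B j))).
    rewrite le_measure ?inE//; apply: open_measurable_rV2; exact: oP.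
  have ndB : nondecreasing_seq B.
    move=> i j ij; apply/subsetPset => z Bz k /= jk; apply: Bz => /=.
    exact: leq_trans jk.
  have cB := nondecreasing_cvg_mu (mu := leb2) mB mBu ndB.
  rewrite -(cvg_lim _ cB)//; apply: lime_le; first by apply/cvg_ex; eexists; exact: cB.
  apply: nearW => j /=.
  rewrite -((euler_iter_mpres (T / j%:R) j).2 O mO) le_measure ?inE//.
    exact: mFO.
  by move=> z; apply => /=.
have flipO O : open O -> open (@flip @^-1` O).
  move=> oO; rewrite openE => z Oz.
  have /nbhs_ballP[e /= e0 eO] : nbhs (flip z) O by exact: open_nbhs_nbhs.
  apply/nbhs_ballP; exists e => //= y [zy1 zy2]; apply: eO; split=> //=.
  move: zy2; rewrite -ball_normE /ball_ /=.
  by rewrite -opprD normrN.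
(* For the converse, the bound [le] is applied to the flipped preimage of [O]: by [flow_reverse] the
   flow carries the flipped [O] into it. *)
have eqO O : open O -> O `<=` X -> leb2 (X `&` phi T @^-1` O) = leb2 O.
  move=> oO OX; apply/eqP; rewrite eq_le le//=.
  have oO' := oP _ oO; have mO' := open_measurable_rV2 oO'.
  rewrite -(flip_mpres.2 _ mO') -(flip_mpres.2 _ (open_measurable_rV2 oO)).
  apply: le_trans (le _ (flipO _ oO')).
  rewrite le_measure ?inE//.
  - by apply: open_measurable_rV2; exact: flipO.
  - by apply: open_measurable_rV2; apply: oP; exact: flipO.
  move=> z Oz; have Vz : V z.1 by exact: (OX _ Oz).
  by split=> //; split; [exact: flow_dom|rewrite /= flow_reverse].
have mtot : measurable_fun setT (total_flow T).
  apply: measurable_fun_if => //.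
  - apply: (measurable_fun_bool true); rewrite setTI.
    rewrite (_ : _ @^-1` _ = X)//; apply/seteqP; split=> z; first exact: set_mem.
    exact: mem_set.
  - rewrite setTI; apply: (measurable_funS mX) mphi => z /=.
    exact: set_mem.
split=> // A mA; apply/esym.
have := @measure_rV2_unique R n n leb2 (pushforward leb2 (total_flow T)).
move=> /(_ mtot); apply; [move=> O oO|move=> k; exact: prodm_rV2_ball|by []].
have mO := open_measurable_rV2 oO.
have oOX : open (O `&` X) by exact: openI.
have mOX : measurable (O `\` X) by exact: measurableD.
have mpO := open_measurable_rV2 (oP _ oOX).
(* [O] is split along the domain: inside, the flow applies; outside, [total_flow] fixes every
   point. *)
transitivity (leb2 ((X `&` phi T @^-1` (O `&` X)) `|` (O `\` X))); last first.
  congr (leb2 _); apply/seteqP; split=> z; rewrite /= /total_flow.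
    move=> [[Vz []]|[Oz nVz]]; first by rewrite mem_set.
    by rewrite memNset.
  case: ifPn => [/set_mem Vz Oz|/negP nVz Oz]; [left|right].
    by split=> //; split=> //; exact: flow_dom.
  by split=> // Xz; apply: nVz; exact: mem_set.
have -> : leb2 ((X `&` phi T @^-1` (O `&` X)) `|` (O `\` X)) =
    (leb2 (X `&` phi T @^-1` (O `&` X)) + leb2 (O `\` X))%E.
  by apply: measureU => //; rewrite -subset0 => z [[Vz _] [_ /(_ Vz)]].
rewrite (eqO _ oOX); last by move=> z [].
have <- : leb2 ((O `&` X) `|` (O `\` X)) = (leb2 (O `&` X) + leb2 (O `\` X))%E.
  apply: measureU => //; first exact: measurableI.
  by rewrite -subset0 => z [[_ Xz] [_ /(_ Xz)]].
congr (leb2 _); apply/seteqP; split=> [z Oz|z [[]|[]]//].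
by have [Xz|nXz] := pselect (X z); [left|right].
Qed.

End hamiltonian_flow_theory.

(** * Measurability of events and of the kernels by number of events *)

Section dhmc_measurability.
Context {R : realType} (D : dhmc R).
Hypothesis HD : dhmc_setting D.

Local Notation vec N := 'rV[R]_(dim D N).
Local Notation new N := 'rV[R]_(dim D N.+1 - dim D N).
Local Notation mR := (measurableTypeR R).
Local Notation coords N := ((vec N * vec N) * (mR * mR))%type.

Let beta_gt0 : 0 < beta D. Proof. by case: HD => -[]. Qed.
Let mass_gt0 : 0 < mass D. Proof. by case: HD => -[]. Qed.
Let nmass_gt0 : 0 < nmass D. Proof. by case: HD => -[]. Qed.

Lemma dom_open N : open (@dom _ D N).
Proof. by case: HD => _ /(_ N)[]. Qed.

Lemma dom_measurable N : measurable (@dom _ D N).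
Proof. by apply: open_measurable_rV; exact: dom_open. Qed.

Lemma dom_old_part N (q : vec N.+1) : dom q -> dom (old_part q).
Proof.
case: HD => _ /(_ N)[_ _ _ E] _ _ _ dq.
by have : @dom _ D N (old_part q) by rewrite -E; exists q.
Qed.

Lemma dom_extend N (q : vec N) (y : new N) : dom (extend q y) -> dom q.
Proof. by move=> /dom_old_part; rewrite extendK1. Qed.

Lemma flow_trajectory N (z : vec N * vec N) : dom z.1 ->
  trajectory (@dom _ D N) (@pot _ D N) (mass D)
    (fun t => (flow t z).1) (fun t => (flow t z).2).
Proof. by case: HD => _ _ _ _ /(_ N z) h dz t; have [_] := h dz; exact. Qed.

Lemma flow0 N (z : vec N * vec N) : dom z.1 -> flow 0 z = z.
Proof. by case: HD => _ _ _ _ /(_ N z) h dz; have [] := h dz. Qed.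

Lemma pot_smooth N : smooth_on (@dom _ D N) (@pot _ D N).
Proof. by case: HD => _ _ [+ _] _ _; exact. Qed.

Lemma flow_in_dom N t (z : vec N * vec N) : dom z.1 -> dom (flow t z).1.
Proof. by move=> dz; exact: (flow_dom (@flow_trajectory N) t dz). Qed.

Section measurable_functions.
Context {d} {T : measurableType d} (E : set T).

Lemma measurable_kinetic n (p : T -> 'rV[R]_n) :
  measurable_fun E p -> measurable_fun E (fun x => kinetic D (p x)).
Proof.
move=> mp; apply: measurable_funM => //.
apply: measurable_sum => i; apply: measurable_funX.
exact: measurable_coord_comp.
Qed.

Lemma measurable_energy N (q p : T -> vec N) :
  measurable_fun E q -> measurable_fun E p -> (forall x, E x -> dom (q x)) ->
  measurable_fun E (fun x => energy (q x) (p x)).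
Proof.
move=> mq mp dq; apply: measurable_funD => //.
apply: measurable_funD; last exact: measurable_kinetic.
have mpot : measurable_fun (@dom _ D N) (@pot _ D N).
  apply: measurable_fun_continuous_rV; first exact: dom_open.
  by move=> x dx; have [] := pot_smooth [::] dx.
apply: (measurable_comp (@dom_measurable N) _ mpot mq).
by move=> _ [x /dq dx <-].
Qed.

Lemma measurable_dens N (q p : T -> vec N) (y1 y2 : T -> new N) :
  measurable_fun E q -> measurable_fun E p ->
  measurable_fun E y1 -> measurable_fun E y2 ->
  (forall x, E x -> dom (extend (q x) (y1 x))) ->
  measurable_fun E (fun x => dens (q x) (p x) (y1 x) (y2 x)).
Proof.
move=> mq mp my1 my2 de.
have mdens := (let: And5 _ _ _ h _ := HD in (h N).1).
pose f x := (((q x), (p x)), ((y1 x), (y2 x))).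
have mf : measurable_fun E f by do !apply: measurable_pair_on.
have mext : measurable_fun setT
    (fun z : (vec N * vec N) * (new N * new N) => extend z.1.1 z.2.1).
  apply: measurable_extend; first by apply: measurableT_comp => //; exact: measurableT_comp.
  by apply: measurableT_comp => //; exact: measurableT_comp.
have mS : measurable [set z : (vec N * vec N) * (new N * new N) |
    dom z.1.1 /\ new_dom z.1.1 z.2].
  have := mext measurableT _ (@dom_measurable N.+1); rewrite setTI.
  congr measurable; apply/seteqP; split=> z //=; last by case.
  by move=> dz; split=> //; exact: dom_extend dz.
apply: (measurable_comp mS _ mdens mf).
by move=> _ [x /de dx <-]; split=> //; exact: dom_extend dx.
Qed.

End measurable_functions.
(** A state is a dependent record whose dimension varies with the level, so measurability is
    expressed in coordinates, level by level, and over the domain, where [pot], [dens] and [flow]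
    are constrained. Time is an argument because the time left after an event depends on the state,
    and because random times are integrated later. *)
Definition levelwise_measurable (G : R -> state D -> \bar R) := forall N,
  measurable_fun [set z : mR * coords N | dom z.2.1.1]
    (fun z => G z.1 (State z.2.1.1 z.2.1.2 z.2.2.1 z.2.2.2)).

Definition nonneg_on_dom (G : R -> state D -> \bar R) :=
  forall T x, dom (pos x) -> (0 <= G T x)%E.

Lemma measurable_dom_coords N :
  measurable [set z : mR * coords N | dom z.2.1.1].
Proof.
have mp2 : measurable_fun setT (fun z : mR * coords N => z.2.1.1).
  by apply: measurableT_comp => //; apply: measurableT_comp.
by have := mp2 measurableT _ (@dom_measurable N); rewrite setTI.
Qed.

Lemma levelwise_comp d (X : measurableType d) (E : set X) G N
    (t : X -> R) (q p : X -> vec N) (n r : X -> R) :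
  levelwise_measurable G ->
  measurable_fun E t -> measurable_fun E q -> measurable_fun E p ->
  measurable_fun E n -> measurable_fun E r -> (forall x, E x -> dom (q x)) ->
  measurable_fun E (fun x => G (t x) (State (q x) (p x) (n x) (r x))).
Proof.
move=> mG mt mq mp mn mr dq.
pose f x : mR * coords N := (t x, ((q x, p x), (n x, r x))).
have mf : measurable_fun E f by do !apply: measurable_pair_on.
apply: (measurable_comp (@measurable_dom_coords N) _ (mG N) mf).
by move=> _ [x /dq dx <-].
Qed.

(* The change of p_n in an accepted transition is -[jump] in both directions. *)
Definition jump N (q p : vec N) (y1 y2 : new N) : R :=
  nmass D * (energy (extend q y1) (extend p y2) - energy q p +
             (beta D)^-1 * ln (dens q p y1 y2)).

Lemma nkineticE r : nmass D * nkinetic D r = `|r|.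
Proof. by rewrite /nkinetic mulrC divfK// gt_eqF. Qed.

Lemma up_stateE N (q p : vec N) n r (y : new N * new N) :
  0 <= r -> 0 < dens q p y.1 y.2 ->
  up_state (x := State q p n r) y =
  if jump q p y.1 y.2 <= r then
    State (extend q y.1) (extend p y.2) n (r - jump q p y.1 y.2)
  else State q p n (- r).
Proof.
move=> r0 d0; rewrite /up_state /decide /= (lt_geF d0).
rewrite -EFinM -EFinD lee_fin -(ler_pM2l nmass_gt0) nkineticE (ger0_norm r0).
rewrite -/(jump q p y.1 y.2); case: ifP => // _; congr State.
by rewrite /sign r0 mul1r mulrBr nkineticE ger0_norm.
Qed.

(** When the density is zero, [lne 0 = -oo] makes the energy difference +oo and the move is
    rejected; the first conjunct of the test records this. Otherwise [jump] carries the energy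
    difference with the opposite sign. *)
Lemma down_stateE N (q p : vec N.+1) n r :
  r < 0 -> 0 <= dens (old_part q) (old_part p) (new_part q) (new_part p) ->
  down_state (State q p n r) =
  if (0 < dens (old_part q) (old_part p) (new_part q) (new_part p)) &&
     (r <= jump (old_part q) (old_part p) (new_part q) (new_part p)) then
    State (old_part q) (old_part p) n
      (r - jump (old_part q) (old_part p) (new_part q) (new_part p))
  else State q p n (- r).
Proof.
move=> r0; rewrite le_eqVlt => /orP[/eqP d0|d0].
  rewrite /down_state /decide /= -d0 lexx ltxx /=.
  by rewrite gt0_muleNy ?lte_fin ?invr_gt0// oppeK addey// leye_eq.
rewrite d0 /= /down_state /decide /= (lt_geF d0).
rewrite -EFinM -EFinB lee_fin -(ler_pM2l nmass_gt0) nkineticE (ltr0_norm r0).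
have -> : nmass D * (energy (old_part q) (old_part p) - energy q p -
    (beta D)^-1 * ln (dens (old_part q) (old_part p) (new_part q) (new_part p))) =
    - jump (old_part q) (old_part p) (new_part q) (new_part p).
  by rewrite /jump !extend_parts; ring.
rewrite lerN2; case: ifP => // _; congr State.
rewrite /sign leNgt r0 /= mulN1r mulrBr nkineticE (ltr0_norm r0).
rewrite /jump !extend_parts; ring.
Qed.

Lemma dens_ge0 N (q p : vec N) (y : new N * new N) :
  dom (extend q y.1) -> 0 <= dens q p y.1 y.2.
Proof.
move=> dy; have dq := dom_extend dy.
by case: HD => _ _ _ /(_ N)[_ /(_ q p dq)[+ _]] _; exact.
Qed.

Lemma event_upE (f : state D -> \bar R) N (q p : vec N) n r : 0 <= r ->
  event f (State q p n r) =
  (\int[prodm (@lebesgue_rV R _) (@lebesgue_rV R _)]_(y in new_dom q)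
    ((dens q p y.1 y.2)%:E *
     (if (jump q p y.1 y.2 <= r)%R
      then f (State (extend q y.1) (extend p y.2) n (r - jump q p y.1 y.2)%R)
      else f (State q p n (- r)%R))))%E.
Proof.
move=> r0; rewrite /event /= r0; apply: eq_integral => y; rewrite inE => dy.
(* Where the density is zero both integrands vanish, whatever value [jump] takes from [ln 0]. *)
have := dens_ge0 p dy; rewrite le_eqVlt => /orP[/eqP<-|d0].
  by rewrite !mul0e.
by rewrite (up_stateE n r0 d0); case: ifP.
Qed.

Lemma event_downE (f : state D -> \bar R) N (q p : vec N.+1) n r :
  r < 0 -> dom q ->
  event f (State q p n r) =
  if (0 < dens (old_part q) (old_part p) (new_part q) (new_part p)) &&
     (r <= jump (old_part q) (old_part p) (new_part q) (new_part p))
  then f (State (old_part q) (old_part p) n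
      (r - jump (old_part q) (old_part p) (new_part q) (new_part p)))
  else f (State q p n (- r)).
Proof.
move=> r0 dq; rewrite /event ifF ?(lt_geF r0)// down_stateE//; first by case: ifP.
by apply: (@dens_ge0 _ _ _ (new_part q, new_part p)); rewrite /= extend_parts.
Qed.

Lemma event_down0 (f : state D -> \bar R) (q p : vec 0) n r :
  r < 0 -> event f (State q p n r) = f (State q p n (- r)).
Proof. by move=> r0; rewrite /event /= leNgt r0. Qed.

Lemma event_ge0 (f : state D -> \bar R) x : dom (pos x) ->
  (forall y, dom (pos y) -> 0 <= f y)%E -> (0 <= event f x)%E.
Proof.
case: x => N q p n r /= dq f0; have [r0|r0] := leP 0 r.
  rewrite event_upE//; apply: integral_ge0 => y dy; apply: mule_ge0.
    by rewrite lee_fin; exact: dens_ge0.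
  by case: ifP => _; apply: f0.
case: N q p dq => [|N] q p dq; first by rewrite event_down0//; exact: f0.
rewrite event_downE//; case: ifP => _; apply: f0 => //=.
exact: dom_old_part.
Qed.

Lemma measurable_jump d (T : measurableType d) (E : set T) N
    (q p : T -> vec N) (y1 y2 : T -> new N) :
  measurable_fun E q -> measurable_fun E p ->
  measurable_fun E y1 -> measurable_fun E y2 ->
  (forall x, E x -> dom (extend (q x) (y1 x))) ->
  measurable_fun E (fun x => jump (q x) (p x) (y1 x) (y2 x)).
Proof.
move=> mq mp my1 my2 de.
have mq' := measurable_extend mq my1; have mp' := measurable_extend mp my2.
apply: measurable_funM => //; apply: measurable_funD.
  apply: measurable_funB; first exact: measurable_energy.
  by apply: measurable_energy => // x /de; exact: dom_extend.
apply: measurable_funM => //.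
by apply: measurableT_comp; [exact: measurable_ln|exact: measurable_dens].
Qed.

Lemma measurable_coords N (F : set (mR * coords N)) :
  [/\ measurable_fun F (fun z => z.1 : R),
      measurable_fun F (fun z => z.2.1.1),
      measurable_fun F (fun z => z.2.1.2),
      measurable_fun F (fun z => z.2.2.1 : R) &
      measurable_fun F (fun z => z.2.2.2 : R)].
Proof.
by split; apply: measurable_funTS; [exact: measurable_fst| | | | ];
  do 2 apply: measurableT_comp => //.
Qed.

Lemma measurable_reject G N (F : set (mR * coords N)) :
  levelwise_measurable G -> (forall z, F z -> dom z.2.1.1) ->
  measurable_fun F (fun z => G z.1
    (State z.2.1.1 z.2.1.2 z.2.2.1 (- z.2.2.2))).
Proof.
have [mt mq mp mn mr] := measurable_coords F.
move=> mG FE; apply: (levelwise_comp mG) => //.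
exact: (measurableT_comp (@oppr_measurable R setT) mr).
Qed.

Lemma measurable_event_down G N : levelwise_measurable G ->
  measurable_fun [set z : mR * coords N | dom z.2.1.1 /\ z.2.2.2 < 0]
    (fun z => event (G z.1) (State z.2.1.1 z.2.1.2 z.2.2.1 z.2.2.2)).
Proof.
move=> mG; case: N => [|N].
  apply: (@eq_measurable_fun _ _ _ _ _ (fun z : mR * coords 0 => G z.1
      (State z.2.1.1 z.2.1.2 z.2.2.1 (- z.2.2.2)))).
    by move=> z; rewrite inE => -[_ r0]; rewrite event_down0.
  by apply: measurable_reject => // z [].
set F := [set _ | _] => mF.
have [mt mq mp mn mr] := measurable_coords F.
pose d0 (z : mR * coords N.+1) := dens (old_part z.2.1.1) (old_part z.2.1.2)
  (new_part z.2.1.1) (new_part z.2.1.2).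
pose j (z : mR * coords N.+1) := jump (old_part z.2.1.1) (old_part z.2.1.2)
  (new_part z.2.1.1) (new_part z.2.1.2).
have md0 : measurable_fun F d0.
  apply: measurable_dens; try exact: measurable_old_part; try exact: measurable_new_part.
  by move=> z []; rewrite extend_parts.
have mj : measurable_fun F j.
  apply: measurable_jump; try exact: measurable_old_part; try exact: measurable_new_part.
  by move=> z []; rewrite extend_parts.
apply: (@eq_measurable_fun _ _ _ _ _ (fun z : mR * coords N.+1 =>
  if (0 < d0 z) && (z.2.2.2 <= j z) then G z.1 (State (old_part z.2.1.1)
    (old_part z.2.1.2) z.2.2.1 (z.2.2.2 - j z)) else
  G z.1 (State z.2.1.1 z.2.1.2 z.2.2.1 (- z.2.2.2)))) => //.
  by move=> z; rewrite inE => -[dz r0]; rewrite event_downE.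
apply: (measurable_fun_if mF).
- apply: measurable_and; first exact: measurable_fun_ltr.
  exact: measurable_fun_ler.
- set F' := _ `&` _.
  have FF' : F' `<=` F by move=> ? [].
  have [mt' mq' mp' mn' mr'] := measurable_coords F'.
  apply: (levelwise_comp mG) => //.
  + exact: measurable_old_part.
  + exact: measurable_old_part.
  + by apply: measurable_funB => //; exact: (measurable_funS mF).
  + by move=> z /FF'[dz _]; exact: dom_old_part.
- by apply: measurable_reject => // z [[]].
Qed.

(** The upward branch is an integral with parameters. Extended by zero outside the measurable set
    [S] of admissible proposals, its integrand lives on a full product and Tonelli applies. The
    downward branch is a case distinction, and the two are glued along the sign of p_n. *)
Lemma levelwise_event G : levelwise_measurable G -> nonneg_on_dom G ->
  levelwise_measurable (fun T => event (G T)).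
Proof.
move=> mG G0 N; set E := [set z : mR * coords N | dom z.2.1.1].
have mE : measurable E := @measurable_dom_coords N.
have mt F : measurable_fun F (fun z : mR * coords N => z.1 : R).
  by have [] := measurable_coords F.
have mq F : measurable_fun F (fun z : mR * coords N => z.2.1.1).
  by have [] := measurable_coords F.
have mp F : measurable_fun F (fun z : mR * coords N => z.2.1.2).
  by have [] := measurable_coords F.
have mn F : measurable_fun F (fun z : mR * coords N => z.2.2.1 : R).
  by have [] := measurable_coords F.
have mr F : measurable_fun F (fun z : mR * coords N => z.2.2.2 : R).
  by have [] := measurable_coords F.
have mr0 : measurable_fun E (fun z => 0 <= z.2.2.2) by exact: measurable_fun_ler.
pose S := [set w : (mR * coords N) * (new N * new N) |
  dom (extend w.1.2.1.1 w.2.1)].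
pose H (w : (mR * coords N) * (new N * new N)) :=
  ((dens w.1.2.1.1 w.1.2.1.2 w.2.1 w.2.2)%:E *
   (if (jump w.1.2.1.1 w.1.2.1.2 w.2.1 w.2.2 <= w.1.2.2.2)%R
    then G w.1.1 (State (extend w.1.2.1.1 w.2.1) (extend w.1.2.1.2 w.2.2)
      w.1.2.2.1 (w.1.2.2.2 - jump w.1.2.1.1 w.1.2.1.2 w.2.1 w.2.2)%R)
    else G w.1.1 (State w.1.2.1.1 w.1.2.1.2 w.1.2.2.1 (- w.1.2.2.2)%R)))%E.
have w1 d (X : measurableType d) (f : mR * coords N -> X) F :
    measurable_fun setT f ->
    measurable_fun F (fun w : (mR * coords N) * (new N * new N) => f w.1).
  by move=> mf; apply: measurable_funTS; exact: measurableT_comp.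
have y1 F : measurable_fun F
    (fun w : (mR * coords N) * (new N * new N) => w.2.1).
  by apply: measurable_funTS; exact: measurableT_comp.
have y2 F : measurable_fun F
    (fun w : (mR * coords N) * (new N * new N) => w.2.2).
  by apply: measurable_funTS; exact: measurableT_comp.
have mS : measurable S.
  have := measurable_extend (w1 _ _ _ setT (mq setT)) (y1 setT).
  by move=> /(_ measurableT _ (@dom_measurable N.+1)); rewrite setTI.
have mj F : F `<=` S -> measurable_fun F (fun w =>
    jump w.1.2.1.1 w.1.2.1.2 w.2.1 w.2.2).
  move=> FS; apply: measurable_jump => //.
    exact: (w1 _ _ _ _ (mq setT)).
  exact: (w1 _ _ _ _ (mp setT)).
have mH : measurable_fun S H.
  apply: emeasurable_funM.
    apply/measurable_EFinP; apply: measurable_dens => //.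
      exact: (w1 _ _ _ _ (mq setT)).
    exact: (w1 _ _ _ _ (mp setT)).
  apply: measurable_fun_if => //.
  - apply: measurable_fun_ler; first exact: mj.
    exact: (w1 _ _ _ _ (mr setT)).
  - set F := _ `&` _; have FS : F `<=` S by move=> ? [].
    apply: (levelwise_comp mG).
    + exact: (w1 _ _ _ _ (mt setT)).
    + by apply: measurable_extend => //; exact: (w1 _ _ _ _ (mq setT)).
    + by apply: measurable_extend => //; exact: (w1 _ _ _ _ (mp setT)).
    + exact: (w1 _ _ _ _ (mn setT)).
    + by apply: measurable_funB; [exact: (w1 _ _ _ _ (mr setT))|exact: mj].
    + by move=> w /FS.
  - set F := _ `&` _; have FS : F `<=` S by move=> ? [].
    apply: (levelwise_comp mG).
    + exact: (w1 _ _ _ _ (mt setT)).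
    + exact: (w1 _ _ _ _ (mq setT)).
    + exact: (w1 _ _ _ _ (mp setT)).
    + exact: (w1 _ _ _ _ (mn setT)).
    + by apply: measurableT_comp => //; exact: (w1 _ _ _ _ (mr setT)).
    + by move=> w /FS; exact: dom_extend.
have H0 w : (0 <= (H \_ S) w)%E.
  rewrite /patch; case: ifPn => // /set_mem Sw; apply: mule_ge0.
    by rewrite lee_fin; exact: dens_ge0.
  by case: ifP => _; apply: G0 => //=; exact: dom_extend Sw.
have mHS := (measurable_restrictT H mS).1 mH.
have mint := measurable_fun_fubini_tonelli_F (m2 := prodm (@lebesgue_rV R _)
  (@lebesgue_rV R _)) (H \_ S) mHS H0.
have mup : measurable_fun (E `&` (fun z => 0 <= z.2.2.2) @^-1` [set true])
    (fun z => event (G z.1) (State z.2.1.1 z.2.1.2 z.2.2.1 z.2.2.2)).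
  apply: (@eq_measurable_fun _ _ _ _ _ (fun z =>
    \int[prodm (@lebesgue_rV R _) (@lebesgue_rV R _)]_y (H \_ S) (z, y))%E);
    last exact: measurable_funTS.
  move=> z; rewrite inE => -[dz r0]; rewrite event_upE// [RHS]integral_mkcond.
  apply: eq_integral => y _; rewrite /patch.
  by rewrite [(z, y) \in S](_ : _ = (y \in new_dom z.2.1.1)).
pose up (z : mR * coords N) := 0 <= z.2.2.2.
have -> : E = (E `&` up @^-1` [set true]) `|`
    [set z : mR * coords N | dom z.2.1.1 /\ z.2.2.2 < 0].
  apply/seteqP; split=> [z Ez|z [[]|[]]//].
  by have [r0|r0] := leP 0 z.2.2.2; [left|right].
have mupE : measurable (E `&` up @^-1` [set true]) by exact: mr0.
have mdnE : measurable [set z : mR * coords N | dom z.2.1.1 /\ z.2.2.2 < 0].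
  have h : measurable_fun E (fun z => z.2.2.2 < 0) by exact: measurable_fun_ltr.
  have := h mE [set true] I.
  by congr measurable; apply/seteqP; split=> z [].
apply/(measurable_funU _ mupE mdnE); split=> //.
exact: measurable_event_down.
Qed.

Lemma measurable_sign d (X : measurableType d) (E : set X) (r : X -> R) :
  measurable_fun E r -> measurable_fun E (fun x => sign (r x)).
Proof.
move=> mr mE; move: (mE); apply: (measurable_fun_if mE) => //.
exact: measurable_fun_ler.
Qed.

Lemma measurable_hitting_time d (X : measurableType d) (E : set X) N
    (q p : X -> vec N) (n r : X -> R) :
  measurable_fun E n -> measurable_fun E r ->
  measurable_fun E (fun x => hitting_time (State (q x) (p x) (n x) (r x))).
Proof.
move=> mn mr mE; move: (mE); apply: measurable_funM => //=.
apply: (measurable_fun_if mE); first exact: measurable_fun_ler.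
  by apply: measurable_funB => //; apply: (measurable_funS mE) => // ? [].
by apply: measurable_funB => //; apply: (measurable_funS mE) => // ? [].
Qed.

Lemma measurable_advance d (X : measurableType d) (E : set X) G N
    (t s : X -> R) (q p : X -> vec N) (n r : X -> R) :
  levelwise_measurable G ->
  measurable_fun E t -> measurable_fun E s ->
  measurable_fun E q -> measurable_fun E p ->
  measurable_fun E n -> measurable_fun E r -> (forall x, E x -> dom (q x)) ->
  measurable_fun E (fun x => G (t x) (advance (s x)
    (State (q x) (p x) (n x) (r x)))).
Proof.
move=> mG mt ms mq mp mn mr dq.
have mf : measurable_fun E (fun x => flow (s x) (q x, p x)).
  apply: (measurable_flow (@dom_open N) (@pot_smooth N) mass_gt0 (@flow0 N)
    (@flow_trajectory N)) => //.
  exact: measurable_pair_on.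
apply: (levelwise_comp mG) => //.
- exact: (measurableT_comp measurable_fst mf).
- exact: (measurableT_comp measurable_snd mf).
- apply: measurable_funD => //; apply: measurable_funM => //.
  by apply: measurable_funM => //; exact: measurable_sign.
- by move=> x /dq dx; exact: flow_in_dom.
Qed.

Lemma kernel_events_ge0 k (C : set (state D)) :
  nonneg_on_dom (fun T x => kernel_events k T x C).
Proof.
elim: k => [|k IH] T x dx /=; first by case: ifP => // _; rewrite lee_fin.
case: ifP => // _; apply: event_ge0; first exact: flow_in_dom.
by move=> y dy; exact: IH.
Qed.

Lemma levelwise_kernel_events k (C : set (state D)) :
  (forall N, measurable [set z : coords N |
     C (State z.1.1 z.1.2 z.2.1 z.2.2)]) ->
  levelwise_measurable (fun T x => kernel_events k T x C).
Proof.
move=> mC; elim: k => [|k IH] N mE; move: (mE); set E := [set _ | _] in mE *;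
  have [mt mq mp mn mr] := measurable_coords E.
  have mC' : levelwise_measurable (fun _ x => (\1_C x)%:E).
    move=> M; apply: measurable_funTS; apply/measurable_EFinP.
    have mi := @measurable_indic _ _ R setT _ (mC M).
    exact: (measurableT_comp mi measurable_snd).
  apply: (measurable_fun_if mE).
  - by apply: measurable_fun_ltr => //; exact: measurable_hitting_time.
  - apply: (measurable_funS mE); first by move=> ? [].
    by apply: (measurable_advance (t := fun z => z.1) mC').
  - exact: measurable_cst.
have mh : measurable_fun E (fun z => hitting_time
  (State z.2.1.1 z.2.1.2 z.2.2.1 z.2.2.2)) by exact: measurable_hitting_time.
apply: (measurable_fun_if mE).
- exact: measurable_fun_ler.
- apply: (measurable_funS mE); first by move=> ? [].
  apply: (measurable_advance (levelwise_event IH (@kernel_events_ge0 k C))) => //.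
  exact: measurable_funB.
- exact: measurable_cst.
Qed.

End dhmc_measurability.

(** * The pairing at an event: weights and upward moves *)

Lemma mpres_swap23 d1 d2 d3 (T1 : measurableType d1) (T2 : measurableType d2)
    (T3 : measurableType d3) (R : realType)
    (m1 : {sigma_finite_measure set T1 -> \bar R})
    (m2 : {sigma_finite_measure set T2 -> \bar R})
    (m3 : {sigma_finite_measure set T3 -> \bar R}) :
  measure_preserving (prodm (prodm m1 m2) m3) (prodm (prodm m1 m3) m2)
    (fun z => ((z.1.1, z.2), z.1.2)).
Proof.
have mas : measurable_fun setT
   (fun z : (T1 * T2) * T3 => (z.1.1, (z.1.2, z.2))).
  apply: measurable_fun_pair; first exact: measurableT_comp.
  by apply: measurable_fun_pair => //; exact: measurableT_comp.
have as1 := mpres_can (mpres_assoc m1 m2 m3) mas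
  (fun z => match z with (_, (_, _)) => erefl end).
have sw := mpres_prod (mpres_id m1) (mpres_swap m2 m3).
exact: (mpres_comp (mpres_comp as1 sw) (mpres_assoc m1 m3 m2)).
Qed.

(** Each vertical section is a single point. This discards the momenta p_n = 0, where [sign] breaks
    the symmetry, and the thresholds of acceptance. *)
Lemma graph_null d (T : measurableType d) (R : realType)
    (m : {sigma_finite_measure set T -> \bar R}) (c : T -> R) :
  measurable_fun setT c ->
  (prodm m (@lebesgue_measure R)).-negligible
    [set z : T * measurableTypeR R | z.2 = c z.1].
Proof.
move=> mc.
have mG : measurable [set z : T * measurableTypeR R | z.2 = c z.1].
  have h : measurable_fun [set: T * measurableTypeR R]
      (fun z => (z.2 : R) - c z.1).
    by apply: measurable_funB => //; exact: measurableT_comp.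
  have := h measurableT [set 0] (measurable_set1 0); rewrite setTI.
  congr measurable; apply/seteqP; split=> z /=.
    by move/eqP; rewrite subr_eq0 => /eqP.
  by move=> ->; rewrite subrr.
eexists; split; [exact: mG| |by []].
rewrite [LHS]integral0_eq// => x _ /=.
rewrite [X in lebesgue_measure X](_ : _ = [set c x]) ?lebesgue_measure_set1//.
by apply/seteqP; split=> r; rewrite /xsection /= inE.
Qed.

Section detailed_pairing.
Context {R : realType} (D : dhmc R).
Hypothesis HD : dhmc_setting D.
Hypothesis Hsym : proposals_reversible D.

Local Notation vec N := 'rV[R]_(dim D N).
Local Notation new N := 'rV[R]_(dim D N.+1 - dim D N).
Local Notation mR := (measurableTypeR R).
Local Notation phase N := ((vec N * vec N) * mR)%type.
Local Notation proposal N := (((vec N * vec N) * (new N * new N)) * mR)%type.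
Local Notation leb N := (@lebesgue_rV R (dim D N)).
Local Notation lebnew N := (@lebesgue_rV R (dim D N.+1 - dim D N)).
Local Notation phase_measure N :=
  (prodm (prodm (leb N) (leb N)) (@lebesgue_measure R)).
Local Notation proposal_measure N :=
  (prodm (prodm (prodm (leb N) (leb N)) (prodm (lebnew N) (lebnew N)))
    (@lebesgue_measure R)).

Let beta_gt0 : 0 < beta D. Proof. by case: HD => -[]. Qed.
Let nmass_gt0 : 0 < nmass D. Proof. by case: HD => -[]. Qed.

Lemma kineticN n (p : 'rV[R]_n) : kinetic D (- p) = kinetic D p.
Proof. by congr (_ / _); apply: eq_bigr => i _; rewrite mxE sqrrN. Qed.

Lemma energyN N (q p : vec N) : energy q (- p) = energy q p.
Proof. by rewrite /energy kineticN. Qed.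

Lemma densN N (q p : vec N) (y1 y2 : new N) : dom (extend q y1) ->
  dens q (- p) y1 (- y2) = dens q p y1 y2.
Proof. by move=> dy; rewrite -Hsym//; exact: (dom_extend HD dy). Qed.

Lemma jumpN N (q p : vec N) (y1 y2 : new N) : dom (extend q y1) ->
  jump q (- p) y1 (- y2) = jump q p y1 y2.
Proof. by move=> dy; rewrite /jump extendN !energyN densN. Qed.

Definition weight N (q p : vec N) (r : R) : R :=
  expR (- beta D * (energy q p + nkinetic D r)).

Lemma weightNp N (q p : vec N) r : weight q (- p) r = weight q p r.
Proof. by rewrite /weight energyN. Qed.

Lemma weightNr N (q p : vec N) r : weight q p (- r) = weight q p r.
Proof. by rewrite /weight /nkinetic normrN. Qed.

(* The accepted transitions balance: this is where the form of the energy
   difference, with the logarithm of the proposal density, comes from. *)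
Lemma weight_jump N (q p : vec N) (y1 y2 : new N) r :
  0 <= r -> 0 <= r + jump q p y1 y2 -> 0 < dens q p y1 y2 ->
  weight q p (r + jump q p y1 y2) * dens q p y1 y2 =
  weight (extend q y1) (extend p y2) r.
Proof.
move=> r0 rj0 d0; rewrite /weight -{1}[dens q p y1 y2]lnK ?posrE// -expRD.
congr expR; rewrite /nkinetic !ger0_norm// /jump.
by field; rewrite !gt_eqF.
Qed.

Definition observable (a : state D -> \bar R) :=
  levelwise_measurable (fun=> a) /\ forall x, dom (pos x) -> (0 <= a x)%E.

Lemma observable_comp d (X : measurableType d) (E : set X) a N
    (q p : X -> vec N) (n r : X -> R) : observable a ->
  measurable_fun E q -> measurable_fun E p ->
  measurable_fun E n -> measurable_fun E r -> (forall x, E x -> dom (q x)) ->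
  measurable_fun E (fun x => a (State (q x) (p x) (n x) (r x))).
Proof.
move=> [ma _] mq mp mn mr dq.
exact: (levelwise_comp HD (t := fun=> 0) ma).
Qed.

Lemma observable_event a : observable a -> observable (event a).
Proof.
move=> [ma a0]; split; first by apply: (levelwise_event HD ma) => T x; exact: a0.
by move=> x dx; exact: event_ge0.
Qed.

Lemma measurable_weight d (X : measurableType d) (E : set X) N
    (q p : X -> vec N) (r : X -> R) :
  measurable_fun E q -> measurable_fun E p -> measurable_fun E r ->
  (forall x, E x -> dom (q x)) ->
  measurable_fun E (fun x => weight (q x) (p x) (r x)).
Proof.
move=> mq mp mr dq; apply: measurableT_comp => //.
apply: measurable_funM => //; apply: measurable_funD.
  exact: (measurable_energy HD).
by apply: measurable_funM => //; exact: measurableT_comp.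
Qed.

Lemma measurable_phase N (E : set (phase N)) :
  [/\ measurable_fun E (fun y => y.1.1), measurable_fun E (fun y => y.1.2) &
      measurable_fun E (fun y => y.2 : R)].
Proof.
by split; apply: measurable_funTS; [| |exact: measurable_snd];
  apply: measurableT_comp.
Qed.

Lemma measurable_proposal N (E : set (proposal N)) :
  [/\ measurable_fun E (fun y => y.1.1.1), measurable_fun E (fun y => y.1.1.2),
      measurable_fun E (fun y => y.1.2.1), measurable_fun E (fun y => y.1.2.2) &
      measurable_fun E (fun y => y.2 : R)].
Proof.
by split; apply: measurable_funTS; [| | | |exact: measurable_snd];
  do 2 apply: measurableT_comp => //.
Qed.

(** The end of [N, N + 1] towards which the index momentum [r] points; for nonzero [r], the end it
    comes from is [exit_idx N (- r)]. *)
Definition exit_idx N (r : R) : R := if 0 <= r then N.+1%:R else N%:R.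

Definition pairing_term N (a b : state D -> \bar R) (y : phase N) : \bar R :=
  ((weight y.1.1 y.1.2 y.2)%:E *
   (a (State y.1.1 (- y.1.2) (exit_idx N y.2) (- y.2)%R) *
    event b (State y.1.1 y.1.2 (exit_idx N y.2) y.2)))%E.

Definition phase_dom N : set (phase N) := [set y | dom y.1.1].

(* Every event takes place at [exit_idx]. Reversing time exchanges the state
   before the event with the flipped state after it. *)
Definition pairing (a b : state D -> \bar R) : \bar R :=
  (\sum_(N <oo) \int[phase_measure N]_y (@pairing_term N a b \_ @phase_dom N) y)%E.

Definition up_accept_set N : set (proposal N) :=
  [set z | dom (extend z.1.1.1 z.1.2.1) /\
    (0 < z.2 /\ jump z.1.1.1 z.1.1.2 z.1.2.1 z.1.2.2 <= z.2)].

Definition up_accept N (a b : state D -> \bar R) (z : proposal N) : \bar R :=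
  ((weight z.1.1.1 z.1.1.2 z.2 * dens z.1.1.1 z.1.1.2 z.1.2.1 z.1.2.2)%:E *
   (a (State z.1.1.1 (- z.1.1.2) N.+1%:R (- z.2)%R) *
    b (State (extend z.1.1.1 z.1.2.1) (extend z.1.1.2 z.1.2.2) N.+1%:R
      (z.2 - jump z.1.1.1 z.1.1.2 z.1.2.1 z.1.2.2)%R)))%E.

Definition up_reject_set N : set (proposal N) :=
  [set z | dom (extend z.1.1.1 z.1.2.1) /\
    (0 < z.2 /\ z.2 < jump z.1.1.1 z.1.1.2 z.1.2.1 z.1.2.2)].

Definition up_reject N (a b : state D -> \bar R) (z : proposal N) : \bar R :=
  ((weight z.1.1.1 z.1.1.2 z.2 * dens z.1.1.1 z.1.1.2 z.1.2.1 z.1.2.2)%:E *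
   (a (State z.1.1.1 (- z.1.1.2) N.+1%:R (- z.2)%R) *
    b (State z.1.1.1 z.1.1.2 N.+1%:R (- z.2)%R)))%E.

Definition up_set N : set (proposal N) :=
  [set z | dom (extend z.1.1.1 z.1.2.1) /\ 0 < z.2].

Lemma measurable_up_set N : measurable (@up_set N).
Proof.
have [mq mp my1 my2 mr] := @measurable_proposal N setT.
have mext : measurable_fun setT (fun z : proposal N => extend z.1.1.1 z.1.2.1).
  exact: measurable_extend.
have m1 := mext measurableT _ (@dom_measurable R D HD N.+1).
have h : measurable_fun setT (fun z : proposal N => 0 < (z.2 : R)).
  exact: measurable_fun_ltr.
have m2 := h measurableT [set true] I.
by have := measurableI _ _ m1 m2; rewrite !setTI.
Qed.

Lemma measurable_jump_proposal N (E : set (proposal N)) : E `<=` @up_set N ->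
  measurable_fun E (fun z => jump z.1.1.1 z.1.1.2 z.1.2.1 z.1.2.2).
Proof.
move=> EU; have [mq mp my1 my2 _] := measurable_proposal E.
by apply: (measurable_jump HD) => // z /EU[].
Qed.

Lemma measurable_up_accept_set N : measurable (@up_accept_set N).
Proof.
have [_ _ _ _ mr] := measurable_proposal (@up_set N).
have h : measurable_fun (@up_set N) (fun z =>
    jump z.1.1.1 z.1.1.2 z.1.2.1 z.1.2.2 <= (z.2 : R)).
  by apply: measurable_fun_ler => //; exact: measurable_jump_proposal.
have := h (@measurable_up_set N) [set true] I.
congr measurable; apply/seteqP; split=> z /=; first by case=> -[].
by case=> ? [].
Qed.

Lemma measurable_up_reject_set N : measurable (@up_reject_set N).
Proof.
have [_ _ _ _ mr] := measurable_proposal (@up_set N).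
have h : measurable_fun (@up_set N) (fun z =>
    (z.2 : R) < jump z.1.1.1 z.1.1.2 z.1.2.1 z.1.2.2).
  by apply: measurable_fun_ltr => //; exact: measurable_jump_proposal.
have := h (@measurable_up_set N) [set true] I.
congr measurable; apply/seteqP; split=> z /=; first by case=> -[].
by case=> ? [].
Qed.

Lemma measurable_up_coef N (E : set (proposal N)) : E `<=` @up_set N ->
  measurable_fun E (fun z => (weight z.1.1.1 z.1.1.2 z.2 *
    dens z.1.1.1 z.1.1.2 z.1.2.1 z.1.2.2)%:E).
Proof.
move=> EU; have [mq mp my1 my2 mr] := measurable_proposal E.
apply/measurable_EFinP; apply: measurable_funM.
  by apply: measurable_weight => // z /EU[/(dom_extend HD)].
by apply: (measurable_dens HD) => // z /EU[].
Qed.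

Lemma measurable_up_accept N a b : observable a -> observable b ->
  measurable_fun setT (@up_accept N a b \_ @up_accept_set N).
Proof.
move=> oa ob; apply/(measurable_restrictT _ (@measurable_up_accept_set N)).
have EU : @up_accept_set N `<=` @up_set N by move=> z [? []].
have [mq mp my1 my2 mr] := measurable_proposal (@up_accept_set N).
apply: emeasurable_funM; first exact: measurable_up_coef.
apply: emeasurable_funM; apply: observable_comp => //.
- exact: measurable_rV_opp.
- exact: measurableT_comp.
- by move=> z /EU[/(dom_extend HD)].
- exact: measurable_extend.
- exact: measurable_extend.
- by apply: measurable_funB => //; exact: measurable_jump_proposal.
- by move=> z /EU[].
Qed.

Lemma measurable_up_reject N a b : observable a -> observable b ->
  measurable_fun setT (@up_reject N a b \_ @up_reject_set N).
Proof.
move=> oa ob; apply/(measurable_restrictT _ (@measurable_up_reject_set N)).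
have EU : @up_reject_set N `<=` @up_set N by move=> z [? []].
have [mq mp my1 my2 mr] := measurable_proposal (@up_reject_set N).
have dq : forall z, @up_reject_set N z -> dom z.1.1.1.
  by move=> z /EU[/(dom_extend HD)].
apply: emeasurable_funM; first exact: measurable_up_coef.
apply: emeasurable_funM; apply: observable_comp => //.
- exact: measurable_rV_opp.
- exact: measurableT_comp.
- exact: measurableT_comp.
Qed.

Lemma up_accept_ge0 N a b : observable a -> observable b ->
  forall z, (0 <= (@up_accept N a b \_ @up_accept_set N) z)%E.
Proof.
move=> [_ a0] [_ b0] z; rewrite /patch; case: ifPn => // /set_mem[dz _].
apply: mule_ge0; first by rewrite lee_fin mulr_ge0 ?expR_ge0 ?(dens_ge0 HD).
by apply: mule_ge0; [apply: a0; exact: (dom_extend HD dz)|exact: b0].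
Qed.

Lemma up_reject_ge0 N a b : observable a -> observable b ->
  forall z, (0 <= (@up_reject N a b \_ @up_reject_set N) z)%E.
Proof.
move=> [_ a0] [_ b0] z; rewrite /patch; case: ifPn => // /set_mem[dz _].
apply: mule_ge0; first by rewrite lee_fin mulr_ge0 ?expR_ge0 ?(dens_ge0 HD).
by apply: mule_ge0; [apply: a0|apply: b0]; exact: (dom_extend HD dz).
Qed.

Definition phase_pos N : set (phase N) := [set y | dom y.1.1 /\ 0 < y.2].

(** The expectation over proposals inside [event] becomes an integral over additional coordinates,
    by Tonelli; there the accepted and the rejected proposals are separated by measurable sets. *)
Lemma pairing_term_up N a b : observable a -> observable b ->
  (\int[phase_measure N]_y (@pairing_term N a b \_ @phase_pos N) y =
   \int[proposal_measure N]_z (@up_accept N a b \_ @up_accept_set N) z +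
   \int[proposal_measure N]_z (@up_reject N a b \_ @up_reject_set N) z)%E.
Proof.
move=> oa ob.
have mA := @measurable_up_accept N _ _ oa ob.
have mR' := @measurable_up_reject N _ _ oa ob.
have A0 := @up_accept_ge0 N _ _ oa ob.
have R0 := @up_reject_ge0 N _ _ oa ob.
rewrite -ge0_integralD//.
pose K z := ((@up_accept N a b \_ @up_accept_set N) z +
  (@up_reject N a b \_ @up_reject_set N) z)%E.
have mK : measurable_fun setT K by exact: emeasurable_funD.
have K0 z : (0 <= K z)%E by exact: adde_ge0.
pose K' (w : phase N * (new N * new N)) := K ((w.1.1, w.2), w.1.2).
have sw := mpres_swap23 (prodm (leb N) (leb N)) (@lebesgue_measure R)
  (prodm (lebnew N) (lebnew N)).
have mK' : measurable_fun setT K' by exact: (measurableT_comp mK sw.1).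
rewrite -/K.
transitivity (\int[prodm (phase_measure N) (prodm (lebnew N) (lebnew N))]_w K' w)%E;
  last by rewrite (mpres_integral sw mK K0).
transitivity (\int[phase_measure N]_y
    \int[prodm (lebnew N) (lebnew N)]_y' K' (y, y'))%E; last first.
  apply/esym; exact: (@fubini_tonelli1 _ _ _ _ R (phase_measure N)
    (prodm (lebnew N) (lebnew N)) K' mK' (fun w => K0 _)).
apply: eq_integral => -[[q p] r] _; rewrite /patch /=; case: ifPn; last first.
  move=> /negP nd; apply/esym/integral0_eq => y _.
  rewrite /K' /K /patch /= !memNset ?adde0//.
    by move=> [/(dom_extend HD) dq [/= r0 _]]; apply: nd; exact/mem_set.
  by move=> [/(dom_extend HD) dq [/= r0 _]]; apply: nd; exact/mem_set.
rewrite inE /= => -[dq r0].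
rewrite /pairing_term /= /exit_idx (ltW r0) event_upE ?(ltW r0)// muleA.
have mext : measurable_fun setT (fun y : new N * new N => extend q y.1).
  by apply: measurable_extend.
have mnew : measurable (new_dom q).
  by have := mext measurableT _ (@dom_measurable R D HD N.+1); rewrite setTI.
have mj F : F `<=` new_dom q ->
    measurable_fun F (fun y : new N * new N => jump q p y.1 y.2).
  by move=> FS; apply: (measurable_jump HD) => //; apply: measurable_funTS.
rewrite -ge0_integralZl//; last 3 first.
- apply: emeasurable_funM.
    apply/measurable_EFinP; apply: (measurable_dens HD) => //;
    exact: measurable_funTS.
  apply: (measurable_fun_if mnew).
  + by apply: measurable_fun_ler => //; exact: mj.
  + set F := _ `&` _; have FS : F `<=` new_dom q by move=> ? [].
    apply: observable_comp => //.
    * by apply: measurable_extend => //; exact: measurable_funTS.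
    * by apply: measurable_extend => //; exact: measurable_funTS.
    * by apply: measurable_funB => //; exact: mj.
  + exact: observable_comp.
- move=> y dy; apply: mule_ge0; first by rewrite lee_fin (dens_ge0 HD).
  by case: ifP => _; apply: ob.2 => //=.
- by apply: mule_ge0; [rewrite lee_fin expR_ge0|exact: oa.2].
rewrite [LHS]integral_mkcond; apply: eq_integral => y _.
rewrite /K' /K /patch /=.
have [dy|ndy] := pselect (dom (extend q y.1)); last first.
  rewrite memNset//; rewrite !memNset ?adde0//; by move=> [].
rewrite mem_set//; have [jr|jr] := leP (jump q p y.1 y.2) r.
  rewrite [X in (X + _)%E](_ : _ = up_accept a b ((q, p), y, r)); last first.
    by rewrite mem_set.
  rewrite memNset ?adde0; last by move=> [_ [_]] /=; rewrite ltNge jr.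
  by rewrite /up_accept /= EFinM muleACA.
rewrite [X in (X + _)%E](_ : _ = 0%E); last first.
  by rewrite memNset//; move=> [_ [_]] /=; rewrite leNgt jr.
rewrite mem_set ?add0e//.
by rewrite /up_reject /= EFinM muleACA.
Qed.

(** A rejected move only reverses p_n, so the two states seen by [a] and [b] differ by the sign of
    the momenta. Reversing the old and the proposed momenta exchanges them; the hypothesis on the
    proposal densities keeps both the density and the set of rejected proposals unchanged. *)
Lemma up_reject_sym N a b : observable a -> observable b ->
  (\int[proposal_measure N]_z (@up_reject N a b \_ @up_reject_set N) z =
   \int[proposal_measure N]_z (@up_reject N b a \_ @up_reject_set N) z)%E.
Proof.
move=> oa ob.
have mp := mpres_prod (mpres_prod
  (mpres_prod (mpres_id (leb N)) (lebesgue_rV_opp (dim D N)))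
  (mpres_prod (mpres_id (lebnew N)) (lebesgue_rV_opp (dim D N.+1 - dim D N))))
  (mpres_id (@lebesgue_measure R)).
rewrite (mpres_integral mp (measurable_up_reject oa ob) (up_reject_ge0 oa ob)).
apply: eq_integral => -[[[q p] [y1 y2]] r] _; rewrite /patch /=.
have inS : (((q, - p), (y1, - y2), r) \in @up_reject_set N) =
    (((q, p), (y1, y2), r) \in @up_reject_set N).
  apply/idP/idP; rewrite !inE /= => -[dy [r0 rj]]; split=> //; split=> //.
    by rewrite -jumpN.
  by rewrite jumpN.
rewrite inS; case: ifPn => //; rewrite inE /= => -[dy _].
by rewrite /up_reject /= weightNp densN// opprK [(b _ * a _)%E]muleC.
Qed.

End detailed_pairing.

(** * Downward moves and their duality with upward moves *)

Lemma mpres_interchange d1 d2 d3 d4 (T1 : measurableType d1)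
    (T2 : measurableType d2) (T3 : measurableType d3) (T4 : measurableType d4)
    (R : realType)
    (m1 : {sigma_finite_measure set T1 -> \bar R})
    (m2 : {sigma_finite_measure set T2 -> \bar R})
    (m3 : {sigma_finite_measure set T3 -> \bar R})
    (m4 : {sigma_finite_measure set T4 -> \bar R}) :
  measure_preserving (prodm (prodm m1 m2) (prodm m3 m4))
    (prodm (prodm m1 m3) (prodm m2 m4))
    (fun z => ((z.1.1, z.2.1), (z.1.2, z.2.2))).
Proof.
have mas : measurable_fun setT
   (fun z : ((T1 * T3) * T2) * T4 => (z.1.1, (z.1.2, z.2))).
  apply: measurable_fun_pair; first exact: measurableT_comp.
  by apply: measurable_fun_pair => //; exact: measurableT_comp.
have as1 := mpres_can (mpres_assoc (prodm m1 m3) m2 m4) mas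
  (fun z => match z with (_, (_, _)) => erefl end).
have sw := mpres_prod (mpres_swap23 m1 m2 m3) (mpres_id m4).
exact: (mpres_comp (mpres_comp (mpres_assoc (prodm m1 m2) m3 m4) sw) as1).
Qed.

Section detailed_pairing_down.
Context {R : realType} (D : dhmc R).
Hypothesis HD : dhmc_setting D.
Hypothesis Hsym : proposals_reversible D.

Local Notation vec N := 'rV[R]_(dim D N).
Local Notation new N := 'rV[R]_(dim D N.+1 - dim D N).
Local Notation mR := (measurableTypeR R).
Local Notation phase N := ((vec N * vec N) * mR)%type.
Local Notation leb N := (@lebesgue_rV R (dim D N)).
Local Notation lebnew N := (@lebesgue_rV R (dim D N.+1 - dim D N)).
Local Notation phase_measure N :=
  (prodm (prodm (leb N) (leb N)) (@lebesgue_measure R)).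
Local Notation proposal_measure N :=
  (prodm (prodm (prodm (leb N) (leb N)) (prodm (lebnew N) (lebnew N)))
    (@lebesgue_measure R)).

Definition accepts_down N : vec N -> vec N -> R -> bool :=
  match N return vec N -> vec N -> R -> bool with
  | 0 => fun _ _ _ => false
  | N'.+1 => fun q p r =>
    (0 < dens (old_part q) (old_part p) (new_part q) (new_part p)) &&
    (r <= jump (old_part q) (old_part p) (new_part q) (new_part p))
  end.

Definition phase_neg N : set (phase N) := [set y | dom y.1.1 /\ y.2 < 0].

Definition down_accept_set N : set (phase N.+1) :=
  [set y | @phase_neg N.+1 y /\ accepts_down y.1.1 y.1.2 y.2].

Definition down_accept N (a b : state D -> \bar R) (y : phase N.+1) : \bar R :=
  ((weight y.1.1 y.1.2 y.2)%:E *
   (a (State y.1.1 (- y.1.2) N.+1%:R (- y.2)%R) *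
    b (State (old_part y.1.1) (old_part y.1.2) N.+1%:R
      (y.2 - jump (old_part y.1.1) (old_part y.1.2)
                  (new_part y.1.1) (new_part y.1.2))%R)))%E.

Definition down_reject_set N : set (phase N) :=
  [set y | @phase_neg N y /\ ~~ accepts_down y.1.1 y.1.2 y.2].

Definition down_reject N (a b : state D -> \bar R) (y : phase N) : \bar R :=
  ((weight y.1.1 y.1.2 y.2)%:E *
   (a (State y.1.1 (- y.1.2) N%:R (- y.2)%R) *
    b (State y.1.1 y.1.2 N%:R (- y.2)%R)))%E.

Lemma measurable_phase_neg N : measurable (@phase_neg N).
Proof.
have [mq mp mr] := @measurable_phase _ D N setT.
have m1 := mq measurableT _ (@dom_measurable R D HD N).
have h : measurable_fun setT (fun y : phase N => (y.2 : R) < 0).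
  exact: measurable_fun_ltr.
have := measurableI _ _ m1 (h measurableT [set true] I).
by rewrite !setTI.
Qed.

Lemma measurable_accepts_down N :
  measurable_fun (@phase_neg N) (fun y => accepts_down y.1.1 y.1.2 y.2).
Proof.
case: N => [|N] /=; first exact: measurable_cst.
have [mq mp mr] := measurable_phase (@phase_neg N.+1).
apply: measurable_and.
  apply: measurable_fun_ltr => //; apply: (measurable_dens HD);
    try exact: measurable_old_part; try exact: measurable_new_part.
  by move=> y []; rewrite extend_parts.
apply: measurable_fun_ler => //; apply: (measurable_jump HD);
  try exact: measurable_old_part; try exact: measurable_new_part.
by move=> y []; rewrite extend_parts.
Qed.

Lemma measurable_down_accept_set N : measurable (@down_accept_set N).
Proof.
exact: (@measurable_accepts_down N.+1 (@measurable_phase_neg N.+1) [set true] I).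
Qed.

Lemma measurable_down_reject_set N : measurable (@down_reject_set N).
Proof.
have := @measurable_accepts_down N (@measurable_phase_neg N) [set false] I.
congr measurable; apply/seteqP; split=> y [ny e]; split=> //.
  by rewrite /= in e; rewrite e.
exact/negbTE.
Qed.

Lemma measurable_down_accept N a b : observable a -> observable b ->
  measurable_fun setT (@down_accept N a b \_ @down_accept_set N).
Proof.
move=> oa ob; apply/(measurable_restrictT _ (@measurable_down_accept_set N)).
have [mq mp mr] := measurable_phase (@down_accept_set N).
have dq y : @down_accept_set N y -> dom y.1.1 by move=> [[]].
apply: emeasurable_funM.
  by apply/measurable_EFinP; exact: (measurable_weight HD).
apply: emeasurable_funM; apply: (observable_comp HD) => //.
- exact: measurable_rV_opp.
- exact: measurableT_comp.
- exact: measurable_old_part.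
- exact: measurable_old_part.
- apply: measurable_funB => //; apply: (measurable_jump HD);
  try exact: measurable_old_part; try exact: measurable_new_part.
  by move=> y /dq; rewrite extend_parts.
- by move=> y /dq; exact: dom_old_part.
Qed.

Lemma measurable_down_reject N a b : observable a -> observable b ->
  measurable_fun setT (@down_reject N a b \_ @down_reject_set N).
Proof.
move=> oa ob; apply/(measurable_restrictT _ (@measurable_down_reject_set N)).
have [mq mp mr] := measurable_phase (@down_reject_set N).
have dq y : @down_reject_set N y -> dom y.1.1 by move=> [[]].
apply: emeasurable_funM.
  by apply/measurable_EFinP; exact: (measurable_weight HD).
apply: emeasurable_funM; apply: (observable_comp HD) => //.
- exact: measurable_rV_opp.
- exact: measurableT_comp.
- exact: measurableT_comp.
Qed.

Lemma down_accept_ge0 N a b : observable a -> observable b ->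
  forall y, (0 <= (@down_accept N a b \_ @down_accept_set N) y)%E.
Proof.
move=> [_ a0] [_ b0] y; rewrite /patch; case: ifPn => // /set_mem[[dy _] _].
apply: mule_ge0; first by rewrite lee_fin expR_ge0.
by apply: mule_ge0; [exact: a0|apply: b0; exact: (dom_old_part HD)].
Qed.

Lemma down_reject_ge0 N a b : observable a -> observable b ->
  forall y, (0 <= (@down_reject N a b \_ @down_reject_set N) y)%E.
Proof.
move=> [_ a0] [_ b0] y; rewrite /patch; case: ifPn => // /set_mem[[dy _] _].
apply: mule_ge0; first by rewrite lee_fin expR_ge0.
by apply: mule_ge0; [exact: a0|exact: b0].
Qed.

Lemma down_reject_sym N a b : observable a -> observable b ->
  (\int[phase_measure N]_z (@down_reject N a b \_ @down_reject_set N) z =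
   \int[phase_measure N]_z (@down_reject N b a \_ @down_reject_set N) z)%E.
Proof.
move=> oa ob.
have mp := mpres_prod
  (mpres_prod (mpres_id (leb N)) (lebesgue_rV_opp (dim D N)))
  (mpres_id (@lebesgue_measure R)).
rewrite (mpres_integral mp (measurable_down_reject oa ob) (down_reject_ge0 oa ob)).
apply: eq_integral => -[[q p] r] _; rewrite /patch /=.
have acc : dom q -> accepts_down q (- p) r = accepts_down q p r.
  case: N mp q p => [//|N] _ q p dq /=.
  have dq' : dom (extend (old_part q) (new_part q)) by rewrite extend_parts.
  by rewrite old_partN new_partN (densN HD Hsym)// (jumpN HD Hsym).
have inS : (((q, - p), r) \in @down_reject_set N) =
    (((q, p), r) \in @down_reject_set N).
  by apply/idP/idP; rewrite !inE => -[[/= dq r0] nacc]; split=> //;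
      move: nacc; rewrite /= acc.
rewrite inS; case: ifPn => //; rewrite inE /= => -[dy _].
by rewrite /down_reject /= weightNp opprK [(b _ * a _)%E]muleC.
Qed.

Lemma pairing_term_downS N a b : observable a -> observable b ->
  (\int[phase_measure N.+1]_y (@pairing_term _ _ N.+1 a b \_ @phase_neg N.+1) y =
   \int[phase_measure N.+1]_z (@down_accept N a b \_ @down_accept_set N) z +
   \int[phase_measure N.+1]_z (@down_reject N.+1 a b \_ @down_reject_set N.+1) z)%E.
Proof.
move=> oa ob.
rewrite -ge0_integralD//; first last.
- exact: measurable_down_reject.
- by move=> y _; exact: down_reject_ge0.
- exact: measurable_down_accept.
- by move=> y _; exact: down_accept_ge0.
apply: eq_integral => -[[q p] r] _; rewrite /patch.
have [[/= dq r0]|ny] := pselect (@phase_neg N.+1 ((q, p), r)); last first.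
  by rewrite !memNset ?adde0//; [move=> []|move=> []].
rewrite mem_set// /pairing_term /exit_idx /= (lt_geF r0) (event_downE HD)//.
have [acc|nacc] := boolP (accepts_down q p r).
  rewrite mem_set// memNset ?adde0; last by move=> [_ /negP]; exact.
  by move: acc => /= ->.
rewrite memNset; last by move=> [_ acc]; move/negP: nacc; exact.
by rewrite mem_set// add0e; move: nacc => /= /negbTE ->.
Qed.

Lemma pairing_term_down0 a b :
  (\int[phase_measure 0]_y (@pairing_term _ _ 0 a b \_ @phase_neg 0) y =
   \int[phase_measure 0]_z (@down_reject 0 a b \_ @down_reject_set 0) z)%E.
Proof.
apply: eq_integral => -[[q p] r] _; rewrite /patch.
have [[/= dq r0]|ny] := pselect (@phase_neg 0 ((q, p), r)); last first.
  by rewrite !memNset//; move=> [].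
rewrite !mem_set// /pairing_term /exit_idx /= (lt_geF r0).
by rewrite event_down0.
Qed.

(** With J the jump, an accepted upward move leads from (q, p, r + J) to (extend q y1, extend p y2,
    r). From the reversal of the latter, the downward move leads to (q, - p, - (r + J)), the
    reversal of the initial state. Both integrals are written in the coordinates (q, p, y1, y2, r):
    [theta] gives the reversed final state and [shift] the initial momentum. The integrands then
    agree by [weight_jump]. *)
Lemma accept_duality N a b : observable a -> observable b ->
  (\int[phase_measure N.+1]_y (@down_accept N b a \_ @down_accept_set N) y =
   \int[proposal_measure N]_z (@up_accept _ _ N a b \_ @up_accept_set _ _ N) z)%E.
Proof.
move=> oa ob.
have ext := @extend_mpres R D N.
have theta := mpres_comp (mpres_prod
    (mpres_interchange (leb N) (leb N) (lebnew N) (lebnew N))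
    lebesgue_measure_opp)
  (mpres_prod (mpres_prod ext (mpres_comp ext (lebesgue_rV_opp (dim D N.+1))))
    (mpres_id (@lebesgue_measure R))).
pose S := [set x : (vec N * vec N) * (new N * new N) | dom (extend x.1.1 x.2.1)].
have [mq mp my1 my2 _] := measurable_proposal (D := D) (N := N) setT.
have mS : measurable S.
  have mext : measurable_fun setT
      (fun x : (vec N * vec N) * (new N * new N) => extend x.1.1 x.2.1).
    by apply: measurable_extend; do 2 apply: measurableT_comp => //.
  by have := mext measurableT _ (@dom_measurable R D HD N.+1); rewrite setTI.
pose J (x : (vec N * vec N) * (new N * new N)) := jump x.1.1 x.1.2 x.2.1 x.2.2.
have mJ : measurable_fun setT (J \_ S).
  apply/(measurable_restrictT _ mS); apply: (measurable_jump HD) => //;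
  by apply: measurable_funTS; do 2 apply: measurableT_comp => //.
have shift := @mpres_fiber R _ _ _ _ _ _
  (prodm (prodm (leb N) (leb N)) (prodm (lebnew N) (lebnew N)))
  (@lebesgue_measure R) (@lebesgue_measure R)
  (fun x r => r + (J \_ S) x) _ (fun x => lebesgue_measure_shift ((J \_ S) x)).
have {}shift := shift (measurable_funD measurable_snd
  (measurableT_comp mJ measurable_fst)).
have mA := measurable_up_accept HD (N := N) oa ob.
have mD := measurable_down_accept (N := N) ob oa.
have A0 := up_accept_ge0 HD (N := N) oa ob.
have D0 := down_accept_ge0 (N := N) ob oa.
rewrite (mpres_integral theta mD D0) (mpres_integral shift mA A0).
apply: ge0_ae_eq_integral => //.
- exact: (measurableT_comp mD theta.1).
- exact: (measurableT_comp mA shift.1).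
(* The two acceptance sets differ at most at r = 0 and r + J = 0. In the first case only the upward
   set can contain the point, since the downward one asks for a strictly negative momentum; in the
   second the roles are exchanged. *)
have n0 := graph_null (prodm (prodm (leb N) (leb N)) (prodm (lebnew N) (lebnew N)))
  (measurable_cst (0 : R)).
have nJ := graph_null (prodm (prodm (leb N) (leb N)) (prodm (lebnew N) (lebnew N)))
  (measurableT_comp (@oppr_measurable R setT) mJ).
apply: (negligibleS _ (negligibleU n0 nJ)) => -[[[q p] [y1 y2]] r] /= neq.
apply: contrapT => /not_orP[/eqP r0 /eqP rJ]; apply: neq => _ /=.
have [dy|ndy] := pselect (dom (extend q y1)); last first.
  rewrite {1}/patch memNset; last by move=> [[]].
  by rewrite /patch [X in if X then _ else _]memNset// => -[].
have inS : (q, p, (y1, y2)) \in S by exact: mem_set.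
have JE : (J \_ S) (q, p, (y1, y2)) = jump q p y1 y2 by rewrite /patch inS.
rewrite JE in rJ *.
have d0 := dens_ge0 HD (y := (y1, y2)) p dy.
have densE : dens (old_part (extend q y1)) (old_part (- extend p y2))
    (new_part (extend q y1)) (new_part (- extend p y2)) = dens q p y1 y2.
  by rewrite old_partN new_partN !extendK1 !extendK2 (densN HD Hsym).
have jumpE : jump (old_part (extend q y1)) (old_part (- extend p y2))
    (new_part (extend q y1)) (new_part (- extend p y2)) = jump q p y1 y2.
  by rewrite old_partN new_partN !extendK1 !extendK2 (jumpN HD Hsym).
rewrite /patch.
have [rpos|rneg] := ltP 0 r; last first.
  rewrite [X in if X then _ else _]memNset; last first.
    move=> [[_ /=]]; rewrite oppr_lt0 => r0'.
    by move: rneg; rewrite leNgt r0'.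
  rewrite [X in if X then _ else _]memNset// => -[_ /= [_]].
  by rewrite lerDr => r0'; move: r0; rewrite eq_le rneg r0'.
have [rJpos|rJneg] := ltP 0 (r + jump q p y1 y2); last first.
  rewrite [X in if X then _ else _]memNset; last first.
    move=> [_ /= /andP[_]]; rewrite jumpE lerNl => h.
    have : r + jump q p y1 y2 = 0.
      by apply/eqP; rewrite eq_le rJneg /= -lerBlDr sub0r.
    by move/eqP; rewrite addr_eq0 (negbTE rJ).
  rewrite [X in if X then _ else _]memNset// => -[_ /= [h _]].
  by move: rJneg; rewrite leNgt h.
rewrite [X in _ = if X then _ else _]mem_set; last first.
  by split=> //=; split=> //; rewrite lerDr ltW.
rewrite /up_accept /= addrK.
(* A proposal of density zero is outside the downward acceptance set, and has the factor 0 on the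
   upward side. *)
have [dpos|dneg] := ltP 0 (dens q p y1 y2); last first.
  have -> : dens q p y1 y2 = 0 by apply/eqP; rewrite eq_le dneg.
  rewrite mulr0 mul0e memNset//.
  by move=> [_ /= /andP[]]; rewrite densE ltNge dneg.
rewrite [X in if X then _ else _]mem_set; last first.
  split; first by split=> //=; rewrite oppr_lt0.
  by rewrite /= densE jumpE dpos lerNl -subr_ge0 opprK ltW.
rewrite /down_accept /= weight_jump ?(ltW rpos) ?(ltW rJpos)//.
rewrite weightNp weightNr !opprK jumpE old_partN !extendK1 opprD.
by rewrite [(b _ * a _)%E]muleC.
Qed.

End detailed_pairing_down.

(** * Symmetry of the pairing *)

Section pairing_theory.
Context {R : realType} (D : dhmc R).
Hypothesis HD : dhmc_setting D.
Hypothesis Hsym : proposals_reversible D.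

Local Notation vec N := 'rV[R]_(dim D N).
Local Notation mR := (measurableTypeR R).
Local Notation phase N := ((vec N * vec N) * mR)%type.
Local Notation leb N := (@lebesgue_rV R (dim D N)).
Local Notation phase_measure N :=
  (prodm (prodm (leb N) (leb N)) (@lebesgue_measure R)).

Let mass_gt0 : 0 < mass D. Proof. by case: HD => -[]. Qed.
Let nmass_gt0 : 0 < nmass D. Proof. by case: HD => -[]. Qed.

Lemma measurable_phase_dom N : measurable (@phase_dom R D N).
Proof.
have [mq mp mr] := @measurable_phase _ D N setT.
by have := mq measurableT _ (@dom_measurable R D HD N); rewrite setTI.
Qed.

Lemma measurable_exit_idx d (X : measurableType d) (E : set X) N (r : X -> R) :
  measurable_fun E r -> measurable_fun E (fun x => exit_idx N (r x)).
Proof.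
move=> mr mE; move: (mE); apply: (measurable_fun_if mE) => //.
exact: measurable_fun_ler.
Qed.

Lemma measurable_pairing_term N a b (E : set (phase N)) :
  observable a -> observable b -> E `<=` @phase_dom R D N ->
  measurable_fun E (@pairing_term _ _ N a b).
Proof.
move=> oa ob EE; have [mq mp mr] := measurable_phase E.
have dq y : E y -> dom y.1.1 by move=> /EE.
have me : measurable_fun E (fun y => exit_idx N (y.2 : R)).
  exact: measurable_exit_idx.
apply: emeasurable_funM.
  by apply/measurable_EFinP; exact: (measurable_weight HD).
apply: emeasurable_funM.
  apply: (observable_comp HD) => //; first exact: measurable_rV_opp.
  exact: measurableT_comp.
exact: (observable_comp HD (observable_event HD ob)).
Qed.

Lemma pairing_term_ge0 N a b (y : phase N) : observable a -> observable b ->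
  dom y.1.1 -> (0 <= pairing_term a b y)%E.
Proof.
move=> [_ a0] ob dy; apply: mule_ge0; first by rewrite lee_fin expR_ge0.
by apply: mule_ge0; [exact: a0|apply: (observable_event HD ob).2].
Qed.

Lemma patch_ge0 (T : Type) (E : set T) (f : T -> \bar R) :
  (forall x, E x -> 0 <= f x)%E -> forall x, (0 <= (f \_ E) x)%E.
Proof. by move=> f0 x; rewrite /patch; case: ifPn => // /set_mem/f0. Qed.

Lemma pairing_split N a b : observable a -> observable b ->
  (\int[phase_measure N]_y (@pairing_term _ _ N a b \_ @phase_dom R D N) y =
   \int[phase_measure N]_y (@pairing_term _ _ N a b \_ @phase_pos R D N) y +
   \int[phase_measure N]_y (@pairing_term _ _ N a b \_ @phase_neg R D N) y)%E.
Proof.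
move=> oa ob.
have mpos : measurable (@phase_pos R D N).
  have [mq mp mr] := measurable_phase (@phase_dom R D N).
  have h : measurable_fun (@phase_dom R D N) (fun y => 0 < (y.2 : R)).
    exact: measurable_fun_ltr.
  exact: (h (@measurable_phase_dom N) [set true] I).
have posD : @phase_pos R D N `<=` @phase_dom R D N by move=> y [].
have negD : @phase_neg R D N `<=` @phase_dom R D N by move=> y [].
have mm E : measurable E -> E `<=` @phase_dom R D N ->
    measurable_fun setT (@pairing_term _ _ N a b \_ E).
  move=> mE ED; apply/(measurable_restrictT _ mE).
  exact: measurable_pairing_term.
have m0 E : E `<=` @phase_dom R D N ->
    forall y, (0 <= (@pairing_term _ _ N a b \_ E) y)%E.
  by move=> ED; apply: patch_ge0 => y /ED; exact: pairing_term_ge0.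
have mp := mm _ mpos posD; have mn := mm _ (@measurable_phase_neg R D HD N) negD.
have mt := mm _ (@measurable_phase_dom N) (fun _ h => h).
have p0 := m0 _ posD; have n0 := m0 _ negD; have t0 := m0 _ (fun _ h => h).
rewrite -ge0_integralD//; apply: ge0_ae_eq_integral => //.
- exact: emeasurable_funD.
- by move=> y _; exact: adde_ge0.
have nul := graph_null (prodm (leb N) (leb N)) (measurable_cst (0 : R)).
apply: negligibleS nul => -[[q p] r] /= neq; apply: contrapT => /eqP r0.
apply: neq => _; rewrite /patch.
have [dq|ndq] := pselect (dom q); last first.
  by rewrite !memNset ?adde0// => -[].
rewrite mem_set//; have [rp|rn|r00] := ltgtP r 0; last by rewrite r00 eqxx in r0.
  rewrite [X in (if X then _ else _) + _]memNset; last first.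
    by move=> [_ /=]; rewrite ltNge (ltW rp).
  by rewrite mem_set// add0e.
rewrite mem_set// memNset ?adde0//.
by move=> [_ /=]; rewrite ltNge (ltW rn).
Qed.

(** The accepted downward part of <a, b> from level N + 1 is the accepted upward part of <b, a> from
    level N. The pairing is therefore the rejected parts, each symmetric, plus the upward parts of
    <a, b> and of <b, a>, whose sum is symmetric although neither is. *)
Lemma pairing_sym (a b : state D -> \bar R) : observable a -> observable b ->
  pairing a b = pairing b a.
Proof.
move=> oa ob.
pose UA a b N := (\int[prodm (prodm (prodm (leb N) (leb N))
    (prodm (@lebesgue_rV R (dim D N.+1 - dim D N))
           (@lebesgue_rV R (dim D N.+1 - dim D N)))) (@lebesgue_measure R)]_z
    (@up_accept _ D N a b \_ @up_accept_set _ D N) z)%E.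
pose UR a b N := (\int[prodm (prodm (prodm (leb N) (leb N))
    (prodm (@lebesgue_rV R (dim D N.+1 - dim D N))
           (@lebesgue_rV R (dim D N.+1 - dim D N)))) (@lebesgue_measure R)]_z
    (@up_reject _ D N a b \_ @up_reject_set _ D N) z)%E.
pose DA a b N := (\int[phase_measure N.+1]_y
  (@down_accept _ D N a b \_ @down_accept_set _ D N) y)%E.
pose DR a b N := (\int[phase_measure N]_y
  (@down_reject _ D N a b \_ @down_reject_set _ D N) y)%E.
have UA0 a' b' N : observable a' -> observable b' -> (0 <= UA a' b' N)%E.
  by move=> ? ?; apply: integral_ge0 => z _; exact: up_accept_ge0.
have UR0 a' b' N : observable a' -> observable b' -> (0 <= UR a' b' N)%E.
  by move=> ? ?; apply: integral_ge0 => z _; exact: up_reject_ge0.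
have DA0 a' b' N : observable a' -> observable b' -> (0 <= DA a' b' N)%E.
  by move=> ? ?; apply: integral_ge0 => z _; exact: down_accept_ge0.
have DR0 a' b' N : observable a' -> observable b' -> (0 <= DR a' b' N)%E.
  by move=> ? ?; apply: integral_ge0 => z _; exact: down_reject_ge0.
have E (a' b' : state D -> \bar R) : observable a' -> observable b' -> pairing a' b' =
    (\sum_(N <oo) (UA a' b' N + UR a' b' N) +
     (\sum_(N <oo) DR a' b' N + \sum_(N <oo) UA b' a' N))%E.
  move=> oa' ob'.
  (* The shift of index between the two levels: no downward move is accepted at level 0, so the
     series starts with 0. *)
  pose M N := (if N is N'.+1 then DA a' b' N' else 0)%E.
  have M0 N : (0 <= M N)%E by case: N => //= N; exact: DA0.
  have -> : (\sum_(N <oo) UA b' a' N = \sum_(N <oo) M N)%E.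
    rewrite [RHS]nneseries_recl// add0e.
    rewrite -(nneseries_addn 1)//.
    by apply: eq_eseriesr => N _; rewrite addn1 /M /DA (accept_duality HD Hsym).
  have DM : (\sum_(N <oo) DR a' b' N + \sum_(N <oo) M N =
      \sum_(N <oo) (DR a' b' N + M N))%E.
    by rewrite (@nneseriesD R (DR a' b') M)// => *; exact: DR0.
  rewrite DM -(@nneseriesD R (fun N => UA a' b' N + UR a' b' N)%E
    (fun N => DR a' b' N + M N)%E); last 2 first.
  - by move=> *; apply: adde_ge0; [exact: UA0|exact: UR0].
  - by move=> *; apply: adde_ge0; [exact: DR0|exact: M0].
  - apply: eq_eseriesr => N _; rewrite pairing_split// pairing_term_up//.
    congr (_ + _)%E; case: N => [|N].
      by rewrite pairing_term_down0 /M adde0.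
    by rewrite pairing_term_downS// addeC.
rewrite (E _ _ oa ob) (E _ _ ob oa).
have SD a' b' : observable a' -> observable b' ->
    (\sum_(N <oo) (UA a' b' N + UR a' b' N) =
     \sum_(N <oo) UA a' b' N + \sum_(N <oo) UR a' b' N)%E.
  by move=> oa' ob'; rewrite (@nneseriesD R (UA a' b') (UR a' b'))// => *;
    (exact: UA0 || exact: UR0).
rewrite (SD _ _ oa ob) (SD _ _ ob oa).
have -> : (\sum_(N <oo) UR b a N = \sum_(N <oo) UR a b N)%E.
  by apply: eq_eseriesr => N _; rewrite /UR (up_reject_sym HD Hsym).
have -> : (\sum_(N <oo) DR b a N = \sum_(N <oo) DR a b N)%E.
  by apply: eq_eseriesr => N _; rewrite /DR (down_reject_sym HD Hsym).
move: (\sum_(_ <oo) UA a b _)%E (\sum_(_ <oo) UR a b _)%E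
  (\sum_(_ <oo) DR a b _)%E (\sum_(_ <oo) UA b a _)%E => x y z w.
by rewrite [(z + w)%E]addeC [(z + x)%E]addeC addeACA [RHS]addeACA [(w + x)%E]addeC.
Qed.

End pairing_theory.

(** * Time reversal of the trajectories *)

Section reversal.
Context {R : realType} (D : dhmc R).
Hypothesis HD : dhmc_setting D.
Hypothesis Hsym : proposals_reversible D.

Local Notation vec N := 'rV[R]_(dim D N).
Local Notation mR := (measurableTypeR R).
Local Notation phase N := ((vec N * vec N) * mR)%type.
Local Notation leb N := (@lebesgue_rV R (dim D N)).
Local Notation phase_measure N :=
  (prodm (prodm (leb N) (leb N)) (@lebesgue_measure R)).

Let mass_gt0 : 0 < mass D. Proof. by case: HD => -[]. Qed.
Let nmass_gt0 : 0 < nmass D. Proof. by case: HD => -[]. Qed.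

(** In [pairing] the first function is evaluated only at the end of an interval from which the
    momentum points inwards, and [r = 0] is negligible. *)
Lemma pairing_eql (a a' b : state D -> \bar R) :
  observable a -> observable a' -> observable b ->
  (forall N (q p : vec N) r, dom q -> r != 0 ->
    a (State q p (exit_idx N (- r)) r) = a' (State q p (exit_idx N (- r)) r)) ->
  pairing a b = pairing a' b.
Proof.
move=> oa oa' ob aa'; apply: eq_eseriesr => N _.
rewrite !(pairing_split HD)//; congr (_ + _)%E; apply: eq_integral => -[[q p] r] _;
  rewrite /patch; case: ifPn => //; rewrite inE => -[/= dq r0];
  rewrite /pairing_term /=; do 2 congr (_ * _)%E;
  have := aa' N q (- p) (- r) dq; rewrite opprK oppr_eq0; apply.
  by rewrite gt_eqF.
by rewrite lt_eqF.
Qed.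

(** The momenta are reversed before the flow: [pairing_term] provides the flipped state at one end
    of the interval, and for [t = nmass D] this map gives the phase in which that state reaches the
    other end. *)
Definition reversed_flow N (t : R) (y : phase N) : phase N :=
  (total_flow (@dom _ D N) (@flow _ D N) t (flip y.1), - y.2).

Lemma reversed_flowE N t (y : phase N) : dom y.1.1 ->
  reversed_flow t y = (flow t (y.1.1, - y.1.2), - y.2).
Proof. by move=> dy; rewrite /reversed_flow /total_flow /= mem_set. Qed.

Lemma reversed_flow_dom N t (y : phase N) :
  dom (reversed_flow t y).1.1 <-> dom y.1.1.
Proof.
split=> [|dy]; last by rewrite reversed_flowE//; exact: (flow_in_dom HD).
have [//|nd] := pselect (dom y.1.1).
by rewrite /reversed_flow /total_flow /= memNset.
Qed.

Lemma reversed_flowK N t (y : phase N) : 0 <= t -> dom y.1.1 ->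
  reversed_flow t (reversed_flow t y) = y.
Proof.
move=> t0 dy; rewrite reversed_flowE; last exact/reversed_flow_dom.
rewrite reversed_flowE//= opprK.
rewrite (flow_reverse (@dom_open R D HD N) (@pot_smooth R D HD N) mass_gt0
  (@flow0 R D HD N) (@flow_trajectory R D HD N) _ t0)//.
by case: y dy => -[q p] r dy; rewrite /flip /= opprK.
Qed.

Lemma reversed_flow_mpres N t : 0 <= t ->
  measure_preserving (phase_measure N) (phase_measure N) (@reversed_flow N t).
Proof.
move=> t0.
have tf := total_flow_mpres (@dom_open R D HD N) (@pot_smooth R D HD N) mass_gt0
  (@flow0 R D HD N) (@flow_trajectory R D HD N) t0.
exact: (mpres_prod (mpres_comp (flip_mpres (n := dim D N)) tf)
  (lebesgue_measure_opp (R := R))).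
Qed.

Lemma reversed_flow_weight N t (y : phase N) : 0 <= t -> dom y.1.1 ->
  weight (reversed_flow t y).1.1 (reversed_flow t y).1.2 (reversed_flow t y).2 =
  weight y.1.1 y.1.2 y.2.
Proof.
move=> t0 dy; rewrite reversed_flowE//= weightNr; congr expR; congr (_ * (_ + _)).
have := flow_energy (@dom_open R D HD N) (@pot_smooth R D HD N) mass_gt0
  (@flow0 R D HD N) (@flow_trajectory R D HD N) t (z := (y.1.1, - y.1.2)) dy.
by rewrite -[LHS]/(_ + kinetic D _) -[RHS]/(_ + kinetic D _) /energy => ->;
  rewrite /= kineticN.
Qed.

Lemma integral_phase_mpres N (f : phase N -> phase N) (F : phase N -> \bar R) :
  measure_preserving (phase_measure N) (phase_measure N) f ->
  (forall y, dom (f y).1.1 <-> dom y.1.1) ->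
  measurable_fun (@phase_dom R D N) F -> (forall y, dom y.1.1 -> 0 <= F y)%E ->
  (\int[phase_measure N]_(y in @phase_dom R D N) F y =
   \int[phase_measure N]_(y in @phase_dom R D N) F (f y))%E.
Proof.
move=> fP df mF F0; rewrite integral_mkcond [RHS]integral_mkcond.
rewrite (mpres_integral fP).
- apply: eq_integral => y _; rewrite /patch.
  have [dy|ndy] := pselect (dom y.1.1).
    by rewrite !mem_set//; exact/df.
  by rewrite !memNset// => /df.
- exact/(measurable_restrictT _ (@measurable_phase_dom R D HD N)).
- exact: patch_ge0.
Qed.

Lemma measurable_reversed_flow d (X : measurableType d) (E : set X) N
    (t : X -> R) (y : X -> phase N) : (forall x, E x -> dom (y x).1.1) ->
  measurable_fun E t -> measurable_fun E y ->
  measurable_fun E (fun x => reversed_flow (t x) (y x)).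
Proof.
move=> dy mt my.
have my1 : measurable_fun E (fun x => flip (y x).1).
  by apply: measurable_flip; exact: (measurableT_comp measurable_fst my).
have mf := measurable_flow (@dom_open R D HD N) (@pot_smooth R D HD N) mass_gt0
  (@flow0 R D HD N) (@flow_trajectory R D HD N) (z := fun x => flip (y x).1)
  dy mt my1.
apply: measurable_pair_on.
  apply: (@eq_measurable_fun _ _ _ _ _ (fun x => flow (t x) (flip (y x).1))) => //.
  move=> x; rewrite inE => Ex.
  by rewrite /total_flow mem_set//; exact: dy.
exact: (measurableT_comp (@oppr_measurable R setT) (measurableT_comp measurable_snd my)).
Qed.

Definition exit_state N (y : phase N) : state D :=
  State y.1.1 y.1.2 (exit_idx N y.2) y.2.

Lemma exit_idxN N (r : R) : r != 0 ->
  exit_idx N (- r) + sign r = exit_idx N r.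
Proof.
rewrite /exit_idx /sign => r0; have [rp|rn] := leP 0 r.
  by rewrite ifF ?natr1// oppr_ge0 leNgt lt_neqAle eq_sym r0 rp.
by rewrite oppr_ge0 (ltW rn) -natr1 addrK.
Qed.

Lemma advance_entrance N (y : phase N) : dom y.1.1 -> y.2 != 0 ->
  advance (nmass D) (State y.1.1 (- y.1.2) (exit_idx N y.2) (- y.2)) =
  exit_state (reversed_flow (nmass D) y).
Proof.
move=> dy y0; rewrite /exit_state reversed_flowE// /advance /=; congr State.
rewrite mulrCA mulfV ?mulr1 ?gt_eqF//.
by have := @exit_idxN N (- y.2); rewrite opprK oppr_eq0; exact.
Qed.

Lemma hitting_time_entrance N (q p : vec N) r : r != 0 ->
  hitting_time (State q p (exit_idx N (- r)) r) = nmass D.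
Proof.
rewrite /hitting_time /exit_idx /= => r0; have [rp|rn] := leP 0 r.
  rewrite ifF; first by rewrite -natr1 addrAC subrr add0r mulr1.
  by rewrite oppr_ge0 leNgt lt_neqAle eq_sym r0 rp.
by rewrite oppr_ge0 (ltW rn) -natr1 addrAC subrr add0r mulr1.
Qed.

Definition enters_as (a a' : state D -> \bar R) :=
  forall N (q p : vec N) r, dom q -> r != 0 ->
    a' (State q p (exit_idx N (- r)) r) =
    event a (advance (nmass D) (State q p (exit_idx N (- r)) r)).

Lemma integral_nonzero_mom N (F G : phase N -> \bar R) :
  measurable_fun (@phase_dom R D N) F -> measurable_fun (@phase_dom R D N) G ->
  (forall y, dom y.1.1 -> 0 <= F y)%E -> (forall y, dom y.1.1 -> 0 <= G y)%E ->
  (forall y, dom y.1.1 -> y.2 != 0 -> F y = G y) ->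
  (\int[phase_measure N]_(y in @phase_dom R D N) F y =
   \int[phase_measure N]_(y in @phase_dom R D N) G y)%E.
Proof.
move=> mF mG F0 G0 FG; apply: ge0_ae_eq_integral => //.
  exact: measurable_phase_dom.
have nul := graph_null (prodm (leb N) (leb N)) (measurable_cst (0 : R)).
apply: negligibleS nul => y /= neq; apply: contrapT => /eqP r0.
by apply: neq => dy; exact: FG.
Qed.

Lemma observable_exit N a d (X : measurableType d)
    (F : set X) (y : X -> phase N) : observable a ->
  (forall x, F x -> dom (y x).1.1) -> measurable_fun F y ->
  measurable_fun F (fun x => a (exit_state (y x))).
Proof.
move=> oa dy my.
have my1 := measurableT_comp measurable_fst my.
have my2 : measurable_fun F (fun x => (y x).2 : R).
  exact: (measurableT_comp measurable_snd my).
apply: (observable_comp HD oa) => //.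
- exact: (measurableT_comp measurable_fst my1).
- exact: (measurableT_comp measurable_snd my1).
- exact: measurable_exit_idx.
Qed.

(* One step of the reversed dynamics is traded for a step of the forward one. *)
Lemma pairing_step (a a' b b' : state D -> \bar R) :
  observable a -> observable a' -> observable b -> observable b' ->
  enters_as a a' -> enters_as b b' -> pairing a b' = pairing a' b.
Proof.
(* By symmetry both primed functions come first, where they are evaluated at an entrance and unfold
   to an event one passage later. The two integrals are then exchanged by the involution
   [reversed_flow (nmass D)], which preserves the measure and the weight. *)
move=> oa oa' ob ob' aa' bb'; rewrite (pairing_sym HD Hsym)//.
apply: eq_eseriesr => N _; rewrite -!integral_mkcond.
have t0 : 0 <= nmass D by exact: ltW.
pose w (y : phase N) := weight y.1.1 y.1.2 y.2.
pose A (y : phase N) := event a (exit_state y).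
pose B (y : phase N) := event b (exit_state y).
have mexit e (z : phase N -> phase N) : observable e ->
    (forall y, phase_dom y -> dom (z y).1.1) ->
    measurable_fun (@phase_dom R D N) z ->
    measurable_fun (@phase_dom R D N) (fun y => event e (exit_state (z y))).
  by move=> oe dz mz; exact: (observable_exit (observable_event HD oe) dz mz).
have mrev : measurable_fun (@phase_dom R D N) (reversed_flow (nmass D)).
  exact: (measurable_reversed_flow (t := fun=> nmass D) (y := id)).
have drev y : @phase_dom R D N y -> dom (reversed_flow (nmass D) y).1.1.
  by move=> dy; apply/reversed_flow_dom.
have mw : measurable_fun (@phase_dom R D N) (fun y => (w y)%:E).
  have [mq mp mr] := measurable_phase (@phase_dom R D N).
  by apply/measurable_EFinP; exact: (measurable_weight HD).
have mA := mexit a id oa (fun y dy => dy) (@measurable_id _ _ _).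
have mB := mexit b id ob (fun y dy => dy) (@measurable_id _ _ _).
have mA' := mexit a _ oa drev mrev.
have mB' := mexit b _ ob drev mrev.
have A0 y : dom y.1.1 -> (0 <= A y)%E.
  by move=> dy; apply: (observable_event HD oa).2.
have B0 y : dom y.1.1 -> (0 <= B y)%E.
  by move=> dy; apply: (observable_event HD ob).2.
have w0 y : (0 <= (w y)%:E)%E by rewrite lee_fin expR_ge0.
have step e e' f : observable e' -> observable f -> enters_as e e' ->
    observable e ->
    (\int[phase_measure N]_(y in @phase_dom R D N) pairing_term e' f y =
     \int[phase_measure N]_(y in @phase_dom R D N) ((w y)%:E *
       (event e (exit_state (reversed_flow (nmass D) y)) *
        event f (exit_state y))))%E.
  move=> oe' of_ ee' oe; apply: integral_nonzero_mom.
  - exact: measurable_pairing_term.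
  - apply: emeasurable_funM => //; apply: emeasurable_funM.
      exact: mexit.
    exact: (mexit f id).
  - by move=> y; exact: pairing_term_ge0.
  - move=> y dy; apply: mule_ge0 => //; apply: mule_ge0.
      by apply: (observable_event HD oe).2; exact/reversed_flow_dom.
    by apply: (observable_event HD of_).2.
  move=> y dy y0; rewrite /pairing_term; do 2 congr (_ * _)%E.
  have := ee' N y.1.1 (- y.1.2) (- y.2) dy; rewrite opprK oppr_eq0 => ->//.
  by rewrite advance_entrance.
rewrite (step b b' a)// (step a a' b)//.
rewrite (integral_phase_mpres (reversed_flow_mpres N t0)
  (reversed_flow_dom (nmass D))); last 2 first.
- by apply: emeasurable_funM => //; exact: emeasurable_funM.
- move=> y dy; apply: mule_ge0 => //; apply: mule_ge0.
    by apply: B0; exact/reversed_flow_dom.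
  exact: A0.
apply: eq_integral => y; rewrite inE => dy.
by rewrite /w reversed_flow_weight// reversed_flowK// [(event b _ * _)%E]muleC.
Qed.

Lemma pairing0 (a b : state D -> \bar R) : observable a -> observable b ->
  (forall N (q p : vec N) r, dom q -> r != 0 ->
    b (State q p (exit_idx N (- r)) r) = 0%E) -> pairing a b = 0%E.
Proof.
move=> oa ob b0.
have o0 : observable (fun _ : state D => 0%E : \bar R).
  by split=> // N; exact: measurable_cst.
rewrite (pairing_sym HD Hsym)// (@pairing_eql b (fun=> 0%E) a)//.
apply: eseries0 => N _ _; apply: integral0_eq => y _.
by rewrite /patch; case: ifPn => // _; rewrite /pairing_term mul0e mule0.
Qed.

Definition good_target (C : set (state D)) := forall N,
  measurable [set z : (vec N * vec N) * (mR * mR) |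
    C (State z.1.1 z.1.2 z.2.1 z.2.2)].

Lemma observable_kernel_events k T (C : set (state D)) : good_target C ->
  observable (fun x => kernel_events k T x C).
Proof.
move=> mC; split; last by move=> x dx; exact: (kernel_events_ge0 HD).
move=> N; have mG := levelwise_kernel_events HD k mC.
have [mt mq mp mn mr] := @measurable_coords R D N
  [set z : mR * ((vec N * vec N) * (mR * mR)) | dom z.2.1.1].
exact: (levelwise_comp HD (t := fun=> T) mG).
Qed.

Lemma kernel_events_enters k T (C : set (state D)) : nmass D <= T ->
  enters_as (fun x => kernel_events k (T - nmass D) x C)
            (fun x => kernel_events k.+1 T x C).
Proof.
by move=> mT N q p r dq r0; rewrite /= hitting_time_entrance// mT.
Qed.

(** Each use of [pairing_step] moves one event, together with the time nmass, from the second
    function to the first. *)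
Lemma pairing_kernel_events k (A B : set (state D)) j s T :
  good_target A -> good_target B -> 0 <= s -> k%:R * nmass D <= T ->
  pairing (fun x => kernel_events j s x A) (fun x => kernel_events k T x B) =
  pairing (fun x => kernel_events (j + k) (s + k%:R * nmass D) x A)
          (fun x => kernel_events 0 (T - k%:R * nmass D) x B).
Proof.
move=> mA mB; elim: k j s T => [|k IH] j s T s0 kT.
  by rewrite addn0 mul0r addr0 subr0.
have kE : k.+1%:R * nmass D = k%:R * nmass D + nmass D by rewrite -natr1; ring.
have mT : nmass D <= T.
  by apply: le_trans kT; rewrite kE lerDr mulr_ge0// ltW.
rewrite (@pairing_step _ (fun x => kernel_events j.+1 (s + nmass D) x A)
  (fun x => kernel_events k (T - nmass D) x B)); last 6 first.
- exact: observable_kernel_events.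
- exact: observable_kernel_events.
- exact: observable_kernel_events.
- exact: observable_kernel_events.
- have := @kernel_events_enters j (s + nmass D) A.
  by rewrite addrK lerDr; exact.
- exact: kernel_events_enters.
rewrite IH; last 2 first.
- by rewrite addr_ge0// ltW.
- by rewrite lerBrDr -kE.
have -> : s + nmass D + k%:R * nmass D = s + k.+1%:R * nmass D.
  by rewrite kE -addrA [X in s + X]addrC.
have -> : T - nmass D - k%:R * nmass D = T - k.+1%:R * nmass D.
  by rewrite kE opprD addrA addrAC.
by rewrite addSnnS.
Qed.

(** When T is too short for k events, moving them one at a time leads to a second function that
    still requires an event after an entrance with less than nmass of time left, and which is
    therefore zero. *)
Lemma pairing_kernel_events0 k (A B : set (state D)) j s T :
  good_target A -> good_target B -> 0 <= s -> 0 <= T -> T < k%:R * nmass D ->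
  pairing (fun x => kernel_events j s x A) (fun x => kernel_events k T x B) = 0%E.
Proof.
move=> mA mB; elim: k j s T => [|k IH] j s T s0 T0 kT.
  by move: kT; rewrite mul0r ltNge T0.
have kE : k.+1%:R * nmass D = k%:R * nmass D + nmass D by rewrite -natr1; ring.
have [mT|mT] := leP (nmass D) T; last first.
  apply: pairing0; [exact: observable_kernel_events|exact: observable_kernel_events|].
  by move=> N q p r dq r0; rewrite /= hitting_time_entrance// leNgt mT.
rewrite (@pairing_step _ (fun x => kernel_events j.+1 (s + nmass D) x A)
  (fun x => kernel_events k (T - nmass D) x B)); last 6 first.
- exact: observable_kernel_events.
- exact: observable_kernel_events.
- exact: observable_kernel_events.
- exact: observable_kernel_events.
- have := @kernel_events_enters j (s + nmass D) A.
  by rewrite addrK lerDr; exact.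
- exact: kernel_events_enters.
by apply: IH; [rewrite addr_ge0// ltW|rewrite subr_ge0|rewrite ltrBlDr -kE].
Qed.

End reversal.

(** * The mass carried from a set of initial positions *)

Section flux.
Context {R : realType} (D : dhmc R).
Hypothesis HD : dhmc_setting D.

Local Notation vec N := 'rV[R]_(dim D N).
Local Notation mR := (measurableTypeR R).
Local Notation phase N := ((vec N * vec N) * mR)%type.
Local Notation ext N := (vec N * mR)%type.
Local Notation leb N := (@lebesgue_rV R (dim D N)).
Local Notation phase_measure N :=
  (prodm (prodm (leb N) (leb N)) (@lebesgue_measure R)).
Local Notation extm N := (prodm (leb N) (@lebesgue_measure R)).

Let beta_gt0 : 0 < beta D. Proof. by case: HD => -[]. Qed.
Let mass_gt0 : 0 < mass D. Proof. by case: HD => -[]. Qed.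
Let nmass_gt0 : 0 < nmass D. Proof. by case: HD => -[]. Qed.

(** What remains of the densities besides [weight]. The Gaussian constant of the momenta is absorbed
    by the logarithm in [energy], so this constant is the same at all levels, as a balance between
    different levels requires. *)
Definition norm_const : R :=
  (fine (partition_function D))^-1 * (beta D / (2 * nmass D)).

Lemma target_ge0 N (q : vec N) : 0 <= target q.
Proof.
apply: mulr_ge0; last exact: expR_ge0.
rewrite invr_ge0 fine_ge0//; apply: nneseries_ge0 => k _ _.
by apply: integral_ge0 => x _; rewrite lee_fin expR_ge0.
Qed.

Lemma momentum_density_ge0 N (psi : ext N) : 0 <= momentum_density psi.
Proof.
apply: mulr_ge0; first by rewrite mulr_ge0 ?powR_ge0 ?expR_ge0.
by rewrite mulr_ge0 ?expR_ge0// divr_ge0 ?ltW// mulr_gt0.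
Qed.

Lemma norm_const_ge0 : 0 <= norm_const.
Proof.
apply: mulr_ge0; last by rewrite divr_ge0 ?ltW// mulr_gt0.
rewrite invr_ge0 fine_ge0//; apply: nneseries_ge0 => k _ _.
by apply: integral_ge0 => x _; rewrite lee_fin expR_ge0.
Qed.

Lemma target_momentum N (q p : vec N) (n r : R) :
  @ext_target R D N (q, n) * @momentum_density R D N (p, r) =
  norm_const * weight q p r.
Proof.
rewrite /ext_target /target /momentum_density /norm_const /weight /energy /=.
have a0 : 0 < 2 * mass D * pi / beta D by rewrite divr_gt0// !mulr_gt0// pi_gt0.
set a := _ / beta D in a0 *; move: a a0 => a a0.
rewrite /powR gt_eqF// !mulrDr !expRD.
set e1 := expR (- beta D * pot q).
have -> : - ((dim D N)%:R / 2) * ln a =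
  - beta D * ((dim D N)%:R / (2 * beta D) * ln a).
  by field; rewrite gt_eqF.
by ring.
Qed.

(* The index of a state which has index momentum [r] and reaches an end of
   [N, N + 1] at time [u * nmass D]. *)
Definition idx_before N (u r : R) : R := exit_idx N r - sign r * u.

Lemma idx_before_mpres N r :
  measure_preserving (@lebesgue_measure R) (@lebesgue_measure R)
    (fun u : mR => idx_before N u r : mR).
Proof.
have [r0|r0] := leP 0 r.
  have := mpres_comp (lebesgue_measure_opp (R := R))
    (lebesgue_measure_shift (exit_idx N r)).
  congr measure_preserving; apply/funext => u /=.
  by rewrite /idx_before /sign r0 mul1r addrC.
have := lebesgue_measure_shift (exit_idx N r).
congr measure_preserving; apply/funext => u /=.
by rewrite /idx_before /sign leNgt r0 /= mulN1r opprK addrC.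
Qed.

Lemma measurable_idx_before d (X : measurableType d) (E : set X) N
    (u r : X -> R) : measurable_fun E u -> measurable_fun E r ->
  measurable_fun E (fun x => idx_before N (u x) (r x)).
Proof.
move=> mu mr; apply: measurable_funB; first exact: measurable_exit_idx.
by apply: measurable_funM => //; exact: measurable_sign.
Qed.

Definition before N (u : R) (y : phase N) : ext N * ext N :=
  ((y.1.1, idx_before N u y.2), (y.1.2, y.2)).

(** For fixed momenta, n is an affine function of u with slope 1 or -1, so the change of coordinates
    is a shear up to rearrangement. Counting time in units of nmass is what makes the slope a
    sign. *)
Lemma before_mpres N :
  measure_preserving (prodm (@lebesgue_measure R) (phase_measure N))
    (prodm (extm N) (extm N)) (fun z : mR * phase N => before z.1 z.2).
Proof.
have f1 := mpres_swap (@lebesgue_measure R) (phase_measure N).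
have f2 : measure_preserving (prodm (phase_measure N) (@lebesgue_measure R))
    (prodm (phase_measure N) (@lebesgue_measure R))
    (fun z : phase N * mR => (z.1, idx_before N z.2 z.1.2 : mR)).
  apply: (@mpres_fiber _ _ _ _ _ _ _ _ _ _
    (fun (y : phase N) (u : mR) => idx_before N u y.2 : mR)).
    apply: measurable_idx_before; first exact: measurable_snd.
    exact: (measurableT_comp measurable_snd measurable_fst).
  by move=> y; exact: idx_before_mpres.
have f3 := mpres_can (mpres_assoc (prodm (leb N) (leb N)) (@lebesgue_measure R)
  (@lebesgue_measure R)) (g := fun z => (z.1.1, (z.1.2, z.2))).
have {}f3 := f3 _ (fun z => let: (a, (b, c)) := z in erefl).
have f4 := mpres_prod (mpres_id (prodm (leb N) (leb N)))
  (mpres_swap (@lebesgue_measure R) (@lebesgue_measure R)).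
have f5 := mpres_interchange (leb N) (leb N) (@lebesgue_measure R)
  (@lebesgue_measure R).
apply: (mpres_comp f1 (mpres_comp f2 (mpres_comp (f3 _) (mpres_comp f4 f5)))).
apply: measurable_fun_pair; first exact: (measurableT_comp measurable_fst).
apply: measurable_fun_pair; last exact: measurable_snd.
exact: (measurableT_comp measurable_snd measurable_fst).
Qed.

Definition flux_density N (A : set (ext N)) (G : state D -> \bar R)
    (z : ext N * ext N) : \bar R :=
  ((norm_const * weight z.1.1 z.2.1 z.2.2)%:E *
   ((\1_A z.1)%:E * G (State z.1.1 z.2.1 z.1.2 z.2.2)))%E.

Definition flux_dom N : set (ext N * ext N) := [set z | dom z.1.1].

Definition flux N (A : set (ext N)) (G : state D -> \bar R) : \bar R :=
  (\int[prodm (extm N) (extm N)]_z (@flux_density N A G \_ @flux_dom N) z)%E.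

Lemma measurable_flux_density N (A : set (ext N)) G : measurable A ->
  observable G -> measurable_fun setT (@flux_density N A G \_ @flux_dom N).
Proof.
move=> mA oG.
have m1 F : measurable_fun F (fun z : ext N * ext N => z.1).
  exact: measurable_funTS measurable_fst.
have m2 F : measurable_fun F (fun z : ext N * ext N => z.2).
  exact: measurable_funTS measurable_snd.
have mq F : measurable_fun F (fun z : ext N * ext N => z.1.1).
  exact: (measurableT_comp measurable_fst (m1 F)).
have mp F : measurable_fun F (fun z : ext N * ext N => z.2.1).
  exact: (measurableT_comp measurable_fst (m2 F)).
have mn F : measurable_fun F (fun z : ext N * ext N => z.1.2 : R).
  exact: (measurableT_comp measurable_snd (m1 F)).
have mr F : measurable_fun F (fun z : ext N * ext N => z.2.2 : R).
  exact: (measurableT_comp measurable_snd (m2 F)).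
have mF : measurable (@flux_dom N).
  by have := mq setT measurableT _ (@dom_measurable R D HD N); rewrite setTI.
apply/(measurable_restrictT _ mF); apply: emeasurable_funM.
  apply/measurable_EFinP; apply: measurable_funM => //.
  exact: (measurable_weight HD).
apply: emeasurable_funM; last exact: (observable_comp HD oG).
by apply/measurable_EFinP; apply: measurableT_comp => //; exact: measurable_indic.
Qed.

Lemma flux_density_ge0 N (A : set (ext N)) G (z : ext N * ext N) :
  observable G -> dom z.1.1 -> (0 <= flux_density A G z)%E.
Proof.
move=> [_ G0] dz; apply: mule_ge0.
  by rewrite lee_fin mulr_ge0 ?norm_const_ge0 ?expR_ge0.
by apply: mule_ge0; [rewrite lee_fin|exact: G0].
Qed.

(** The slice of [flux] over initial states whose first end of interval is reached at time
    [u * nmass D]. Here u runs over the whole line; for sets [A] inside [ext_dom] the indicator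
    makes the slice vanish outside [0, 1]. *)
Definition flux_at N (A : set (ext N)) (G : state D -> \bar R) (u : R) : \bar R :=
  (\int[phase_measure N]_(y in @phase_dom R D N) flux_density A G (before u y))%E.

Lemma patch_before N (A : set (ext N)) G (u : R) (y : phase N) :
  (@flux_density N A G \_ @flux_dom N) (before u y) =
  ((fun y => flux_density A G (before u y)) \_ @phase_dom R D N) y.
Proof.
rewrite /patch; have [dy|ndy] := pselect (dom y.1.1); first by rewrite !mem_set.
by rewrite !memNset.
Qed.

Lemma flux_slices N (A : set (ext N)) G : measurable A -> observable G ->
  measurable_fun setT (flux_at A G) /\
  (flux A G = \int[@lebesgue_measure R]_u flux_at A G u)%E.
Proof.
move=> mA oG; have mF := measurable_flux_density mA oG.
have F0 z : (0 <= (@flux_density N A G \_ @flux_dom N) z)%E.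
  by apply: patch_ge0 => {}z; exact: flux_density_ge0.
pose H (z : mR * phase N) := (@flux_density N A G \_ @flux_dom N) (before z.1 z.2).
have mH : measurable_fun setT H.
  by apply: measurableT_comp => //; exact: (@before_mpres N).1.
have H0 z : (0 <= H z)%E by exact: F0.
have HE : flux_at A G = fubini_F (phase_measure N) H.
  apply/funext => u; rewrite /flux_at integral_mkcond; apply: eq_integral => y _.
  by rewrite -patch_before.
split; first by rewrite HE; exact: measurable_fun_fubini_tonelli_F.
rewrite /flux (mpres_integral (@before_mpres N))// HE.
exact: (@fubini_tonelli1 _ _ _ _ _ (@lebesgue_measure R) (phase_measure N) H mH).
Qed.

Lemma measurable_momentum_density N :
  measurable_fun setT (@momentum_density R D N).
Proof.
have mp : measurable_fun setT (fun psi : ext N => psi.1) by exact: measurable_fst.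
have mr : measurable_fun setT (fun psi : ext N => psi.2 : R).
  exact: measurable_snd.
apply: measurable_funM; apply: measurable_funM => //.
  apply: measurableT_comp => //; apply: measurable_funM => //.
  exact: measurable_kinetic.
apply: measurableT_comp => //; apply: measurable_funM => //.
by apply: measurable_funM => //; exact: measurableT_comp.
Qed.

Lemma integral_flux N (A : set (ext N)) G : measurable A ->
  A `<=` @ext_dom R D N -> observable G ->
  (\int[extm N]_(phi in A) ((ext_target phi)%:E *
     \int[extm N]_psi ((momentum_density psi)%:E *
       G (State phi.1 psi.1 phi.2 psi.2))) = flux A G)%E.
Proof.
move=> mA AN oG; have mF := measurable_flux_density mA oG.
have F0 z : (0 <= (@flux_density N A G \_ @flux_dom N) z)%E.
  by apply: patch_ge0 => {}z; exact: flux_density_ge0.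
rewrite /flux.
rewrite (@fubini_tonelli1 _ _ _ _ _ (extm N) (extm N) _ mF F0).
rewrite integral_mkcond; apply: eq_integral => phi _.
rewrite /fubini_F [LHS]/patch; case: ifPn => [/set_mem Aphi|nA]; last first.
  apply/esym/integral0_eq => psi _; rewrite /patch; case: ifPn => // _.
  by rewrite /flux_density indicE (negbTE nA) mul0e mule0.
have dphi : dom phi.1 by have [] := AN _ Aphi.
have mp : measurable_fun setT (fun psi : ext N => psi.1) by exact: measurable_fst.
have mr : measurable_fun setT (fun psi : ext N => psi.2 : R).
  exact: measurable_snd.
rewrite -ge0_integralZl//.
- apply: eq_integral => psi _; rewrite /patch mem_set// /flux_density/=.
  rewrite indicE mem_set// mul1e -(target_momentum _ _ phi.2) EFinM muleA.
  by case: (phi) (psi) => [q n] [p r].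
- apply: emeasurable_funM; last exact: (observable_comp HD oG).
  by apply/measurable_EFinP; exact: measurable_momentum_density.
- move=> psi _; apply: mule_ge0; first by rewrite lee_fin momentum_density_ge0.
  exact: oG.2.
- by rewrite lee_fin target_ge0.
Qed.

Lemma flux_nneseries N (A : set (ext N)) (G : nat -> state D -> \bar R) :
  measurable A -> (forall k, observable (G k)) ->
  (flux A (fun x => \sum_(k <oo) G k x) = \sum_(k <oo) flux A (G k))%E.
Proof.
move=> mA oG; rewrite -integral_nneseries//.
- apply: eq_integral => z _; rewrite /patch; case: ifPn => [/set_mem dz|_].
    rewrite /flux_density -!nneseriesZl//.
    - by move=> k _; apply: mule_ge0; [rewrite lee_fin|apply: (oG k).2].
    - by move=> k _; apply: (oG k).2.
  by rewrite eseries0.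
- by move=> k; exact: measurable_flux_density.
- by move=> k z _; apply: patch_ge0 => {}z; exact: flux_density_ge0.
Qed.

End flux.

(** * Detailed balance *)

Section balance.
Context {R : realType} (D : dhmc R).
Hypothesis HD : dhmc_setting D.
Hypothesis Hsym : proposals_reversible D.

Local Notation vec N := 'rV[R]_(dim D N).
Local Notation mR := (measurableTypeR R).
Local Notation phase N := ((vec N * vec N) * mR)%type.
Local Notation ext N := (vec N * mR)%type.
Local Notation leb N := (@lebesgue_rV R (dim D N)).
Local Notation phase_measure N :=
  (prodm (prodm (leb N) (leb N)) (@lebesgue_measure R)).
Local Notation events k T A :=
  (fun x => kernel_events k T x (states_over A)).

Let mass_gt0 : 0 < mass D. Proof. by case: HD => -[]. Qed.
Let nmass_gt0 : 0 < nmass D. Proof. by case: HD => -[]. Qed.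

Lemma states_overE N (B : set (ext N)) (q p : vec N) (n r : R) :
  states_over B (State q p n r) = B (q, n).
Proof.
apply/propext; split=> [[q' [p' [n' [r' [E]]]]]|Bq]; last by exists q, p, n, r.
have /= := f_equal (fun x : state D =>
  existT (fun N => vec N) (level x) (pos x)) E.
(* The type of the position depends on the level, so injectivity passes through dependent pairs over
   [nat], whose equality is decidable. *)
move=> /(Eqdep_dec.inj_pair2_eq_dec _ (@eq_comparable nat) _ _ _ _) ->.
by have /= -> := f_equal (@idx R D) E.
Qed.

Lemma indic_states_over N (B : set (ext N)) (q p : vec N) (n r : R) :
  \1_(states_over B) (State q p n r) = \1_B (q, n) :> R.
Proof.
rewrite !indicE; congr (nat_of_bool _)%:R.
by apply/idP/idP => /set_mem h; apply/mem_set; move: h; rewrite states_overE.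
Qed.

Lemma states_over_level N M (B : set (ext M)) (q p : vec N) (n r : R) :
  N != M -> ~ states_over B (State q p n r).
Proof.
move=> /eqP NM [q' [p' [n' [r' [E _]]]]]; apply: NM.
exact: (f_equal (@level R D) E).
Qed.

Lemma good_states_over M (B : set (ext M)) : measurable B ->
  good_target (states_over B).
Proof.
move=> mB N; have [NM|NM] := eqVneq N M; last first.
  rewrite (_ : [set _ | _] = set0)//; apply/seteqP; split=> // z.
  exact: states_over_level.
subst M.
have mf : measurable_fun setT
    (fun z : (vec N * vec N) * (mR * mR) => (z.1.1, z.2.1)).
  by apply: measurable_fun_pair; apply: measurableT_comp.
have := mf measurableT _ mB; rewrite setTI.
by congr measurable; apply/seteqP; split=> z; rewrite /= states_overE.
Qed.

Lemma observable_events k T M (B : set (ext M)) : measurable B ->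
  observable (events k T B).
Proof.
by move=> mB; apply: (observable_kernel_events HD); exact: good_states_over.
Qed.

Lemma idx_beforeE N (u r : R) :
  idx_before N u r = if 0 <= r then N.+1%:R - u else N%:R + u.
Proof.
rewrite /idx_before /exit_idx /sign.
by case: ifP => _; rewrite ?mul1r// mulN1r opprK.
Qed.

(** A state at distance u from its exit is, once reversed, at distance 1 - u from the other end. *)
Lemma idx_beforeN N (u r : R) : r != 0 ->
  idx_before N u (- r) = idx_before N (1 - u) r.
Proof.
move=> r0; rewrite !idx_beforeE oppr_ge0 -natr1; have [rp|rn] := leP 0 r.
  by rewrite leNgt lt_neqAle eq_sym r0 rp /=; ring.
by rewrite (ltW rn); ring.
Qed.

Lemma hitting_time_before N (q p : vec N) (u r : R) :
  hitting_time (State q p (idx_before N u r) r) = u * nmass D.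
Proof.
rewrite /hitting_time /= idx_beforeE [RHS]mulrC; congr (_ * _).
by case: (0 <= r); ring.
Qed.

Lemma before_ext_dom N (A : set (ext N)) (q : vec N) (u r : R) :
  A `<=` @ext_dom R D N -> A (q, idx_before N u r) -> 0 <= u <= 1.
Proof.
move=> AN /AN[_]; rewrite idx_beforeE -natr1 /=.
by case: ifP => _ /andP[h1 h2]; apply/andP; split; lra.
Qed.

Lemma measurable_flux_before N (A : set (ext N)) G (u : R) : measurable A ->
  observable G ->
  measurable_fun (@phase_dom R D N) (fun y => flux_density A G (before u y)).
Proof.
move=> mA oG.
apply/(measurable_restrictT _ (@measurable_phase_dom R D HD N)).
apply: (@eq_measurable_fun _ _ _ _ _
  (fun y : phase N => (flux_density A G \_ @flux_dom R D N) (before u y))).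
  by move=> y _; exact: patch_before.
apply: (measurableT_comp (measurable_flux_density HD mA oG)).
have m1 : measurable_fun setT (fun y : phase N => (u : mR, y)).
  exact: measurable_pair_on.
exact: (measurableT_comp (@before_mpres R D N).1 m1).
Qed.

Lemma measurable_phase_comp N (F : phase N -> \bar R) g :
  measurable_fun (@phase_dom R D N) F -> measurable_fun setT g ->
  (forall y, dom y.1.1 -> dom (g y).1.1) ->
  measurable_fun (@phase_dom R D N) (fun y => F (g y)).
Proof.
move=> mF mg dg; apply: (measurable_comp (@measurable_phase_dom R D HD N) _ mF).
  by move=> _ [y dy <-]; exact: dg.
exact: measurable_funTS.
Qed.

Lemma pairing_level N (a b : state D -> \bar R) : observable a -> observable b ->
  (forall M (q p : vec M) n r, M != N -> a (State q p n r) = 0%E) ->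
  (pairing a b = \int[phase_measure N]_(y in @phase_dom R D N) pairing_term a b y)%E.
Proof.
move=> oa ob a0; rewrite /pairing (nneseriesD1 (n := N))//; last first.
  move=> k _; apply: integral_ge0 => y _; apply: patch_ge0 => {}y dy.
  exact: (pairing_term_ge0 HD).
rewrite [X in (_ + X)%E]eseries0 ?adde0 -?integral_mkcond// => M _ /= MN.
apply: integral0_eq => y _; rewrite /patch; case: ifPn => // _.
by rewrite /pairing_term a0// mul0e mule0.
Qed.

(** The initial state is replaced by the state at the first event as integration variable.
    Membership of the initial state in [A] then reads: the flipped state at the event reaches [A]
    after [u * nmass D] without meeting another event. This is the first argument of the pairing;
    the second is what happens from the event on. *)
Lemma flux_at_before_first_event N (A : set (ext N)) (C : set (state D)) k T u :
  measurable A -> A `<=` @ext_dom R D N -> good_target C -> u != 1 ->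
  flux_at A (fun x => kernel_events k.+1 T x C) u =
  if (0 <= u) && (u * nmass D <= T) then
    ((norm_const D)%:E * pairing (events 0 (u * nmass D) A)
      (fun x => kernel_events k (T - u * nmass D) x C))%E
  else 0%E.
Proof.
move=> mA AN gC u1.
have oG : observable (fun x => kernel_events k.+1 T x C).
  exact: (observable_kernel_events HD).
have [u0|u0] /= := leP 0 u; last first.
  apply: integral0_eq => y dy; rewrite /flux_density /= indicE memNset ?mul0e ?mule0//.
  by move=> /(before_ext_dom AN) /andP[]; rewrite leNgt u0.
case: ifPn => [uT|uT]; last first.
  apply: integral0_eq => y dy; rewrite /flux_density /= hitting_time_before.
  by rewrite (negbTE uT) !mule0.
set a := events 0 _ A; set b := fun x => kernel_events k _ x C.
have oa : observable a by exact: observable_events.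
have ob : observable b by exact: (observable_kernel_events HD).
have t0 : 0 <= u * nmass D by rewrite mulr_ge0// ltW.
(* [reversed_flow 0] only flips the momenta back, so the composite carries the state at the first
   event to the state [u * nmass D] earlier, with p_n unchanged. *)
have gP := mpres_comp (reversed_flow_mpres HD N t0) (reversed_flow_mpres HD N (lexx 0)).
have dg y : dom ((@reversed_flow _ D N 0 \o reversed_flow (u * nmass D)) y).1.1 <->
    dom y.1.1.
  exact: (iff_trans (reversed_flow_dom HD _ _) (reversed_flow_dom HD _ _)).
have mF := measurable_flux_before u mA oG.
rewrite /flux_at (integral_phase_mpres HD gP dg mF); last first.
  by move=> y dy; exact: flux_density_ge0.
rewrite (pairing_level oa ob (N := N)); last first.
  move=> M q p n r MN; rewrite /a /=; case: ifP => // _.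
  by rewrite indicE memNset//; exact: states_over_level.
have mP := measurable_pairing_term HD oa ob (@subset_refl _ (@phase_dom R D N)).
have P0 y : dom y.1.1 -> (0 <= @pairing_term _ _ N a b y)%E.
  by move=> dy; exact: (pairing_term_ge0 HD).
rewrite -ge0_integralZl//; last 2 first.
- exact: measurable_phase_dom.
- by rewrite lee_fin; exact: norm_const_ge0.
apply: (integral_nonzero_mom HD).
- exact: (measurable_phase_comp mF gP.1 (fun y => (dg y).2)).
- exact: measurable_funeM.
- by move=> y dy; apply: (flux_density_ge0 HD) => //; apply: (dg y).2.
- by move=> y dy; apply: mule_ge0; [rewrite lee_fin norm_const_ge0|exact: P0].
move=> [[q p] r] /= dq r0.
rewrite [reversed_flow (u * _) _]reversed_flowE//=.
have dQ : dom (flow (u * nmass D) (q, - p)).1 by exact: (flow_in_dom HD).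
rewrite reversed_flowE//= opprK flow0//.
have F := flow_reverse (@dom_open R D HD N) (@pot_smooth R D HD N) mass_gt0
  (@flow0 R D HD N) (@flow_trajectory R D HD N) (z := (q, - p)) dq t0.
have W := reversed_flow_weight HD t0 (y := ((q, p), r)) dq.
rewrite reversed_flowE//= weightNr in W.
rewrite /flux_density /pairing_term /= hitting_time_before uT weightNp W EFinM -muleA.
do 2 congr (_ * _)%E.
have -> : advance (u * nmass D) (State (flow (u * nmass D) (q, - p)).1
    (- (flow (u * nmass D) (q, - p)).2) (idx_before N u r) r) =
    State q p (exit_idx N r) r.
  rewrite /advance /= -[((flow _ _).1, _)]/(flip _) F /flip /= opprK; congr State.
  by rewrite /idx_before mulrA mulrAC mulfK ?gt_eqF//; ring.
congr (_ * _)%E.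
rewrite /a /=.
have := @hitting_time_entrance _ _ N q (- p) (- r); rewrite opprK oppr_eq0 => ->//.
have -> : advance (u * nmass D) (State q (- p) (exit_idx N r) (- r)) =
    State (flow (u * nmass D) (q, - p)).1 (flow (u * nmass D) (q, - p)).2
      (idx_before N u r) (- r).
  rewrite /advance /=; congr State.
  rewrite mulrA mulrAC mulfK ?gt_eqF// /idx_before /sign oppr_ge0.
  by move: r0; case: ltrgt0P => // _ _; ring.
rewrite indic_states_over.
(* [kernel_events 0] asks for [u * nmass D < nmass D]. If this fails then u is at least 1, whereas
   [A] allows at most 1, so u = 1, which is excluded. *)
rewrite indicE; case: ltP => // mu; rewrite memNset//.
move=> /(before_ext_dom AN)/andP[_ u1'].
by move: mu; rewrite -{1}[nmass D]mul1r ler_pM2r// leNgt lt_neqAle u1 u1'.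
Qed.

(** The last of k + 1 events takes place at (u + k) nmass and leaves the time v nmass, which is the
    time to the first event of the reversed path. The k later events are moved across the pairing,
    which then has kernels without events on both sides and is symmetric. For times out of range
    both sides vanish. *)
Lemma flux_at_event_sym N M (A : set (ext N)) (B : set (ext M)) k T u :
  measurable A -> A `<=` @ext_dom R D N ->
  measurable B -> B `<=` @ext_dom R D M ->
  u != 1 -> T / nmass D - k%:R - u != 1 ->
  flux_at A (events k.+1 T B) u =
  flux_at B (events k.+1 T A) (T / nmass D - k%:R - u).
Proof.
move=> mA AN mB BM; set v := _ - u => u1 v1.
have gA := good_states_over mA; have gB := good_states_over mB.
rewrite (flux_at_before_first_event k T mA AN gB u1).
rewrite (flux_at_before_first_event k T mB BM gA v1).
have vm : v * nmass D = T - u * nmass D - k%:R * nmass D.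
  by rewrite /v; field; rewrite gt_eqF.
have k0 : 0 <= k%:R * nmass D by rewrite mulr_ge0// ltW.
have pos x : (0 <= x) = (0 <= x * nmass D) by rewrite pmulr_lge0.
(* If u is negative, the other side has less than [k * nmass] of time after its first event, too
   little for k more events. *)
have [u0|u0] := leP 0 u; rewrite ?andTb ?andFb; last first.
  case: ifP => // /andP[v0 vT]; rewrite (pairing_kernel_events0 HD Hsym)//.
  - by rewrite mule0.
  - by rewrite -pos.
  - by rewrite subr_ge0.
  - by rewrite vm; have : u * nmass D < 0; [rewrite nmulr_rlt0|lra].
have [uT|uT] := leP (u * nmass D) T; last first.
  rewrite ifF//; apply/negbTE; rewrite negb_and pos vm -ltNge.
  by apply/orP; left; lra.
have [kT|kT] := leP (k%:R * nmass D) (T - u * nmass D); last first.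
  have u0' : 0 <= u * nmass D by rewrite -pos.
  have uT' : 0 <= T - u * nmass D by rewrite subr_ge0.
  rewrite (pairing_kernel_events0 HD Hsym 0 gA gB u0' uT' kT) mule0 ifF//.
  by apply/negbTE; rewrite negb_and pos vm -ltNge; apply/orP; left; lra.
rewrite pos vm subr_ge0 kT andTb ifT; last first.
  by have := u0; rewrite pos; lra.
have u0' : 0 <= u * nmass D by rewrite -pos.
apply: (f_equal (fun x => (norm_const D)%:E * x)%E).
apply: (etrans (pairing_kernel_events HD Hsym 0 gA gB u0' kT)).
rewrite (pairing_sym HD Hsym); last 2 first.
- exact: observable_events.
- exact: observable_events.
rewrite add0n; congr (pairing _ _); apply/funext => x; congr kernel_events.
by ring.
Qed.

(** No event takes place at which to form a pairing, so the substitution is the flow over the whole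
    time T followed by reversal. The path starts at distance u from its exit and ends at distance u
    - T / nmass; reversed, it starts at distance 1 - (u - T / nmass). *)
Lemma flux_at_no_event_sym N M (A : set (ext N)) (B : set (ext M)) T u :
  0 <= T -> measurable A -> A `<=` @ext_dom R D N ->
  measurable B -> B `<=` @ext_dom R D M ->
  u != 1 -> u != T / nmass D ->
  flux_at A (events 0 T B) u =
  flux_at B (events 0 T A) (T / nmass D + 1 - u).
Proof.
move=> T0 mA AN mB BM; set v := _ - u; set s := T / nmass D => u1 us.
have oB : observable (events 0 T B) by exact: observable_events.
have oA : observable (events 0 T A) by exact: observable_events.
have other N' M' (A' : set (ext N')) (B' : set (ext M')) x : N' != M' ->
    flux_at A' (events 0 T B') x = 0%E.
  move=> NM; apply: integral0_eq => y _; rewrite /flux_density /=; case: ifP => _.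
    rewrite /advance /= (_ : \1_(states_over B') _ = 0) ?mule0//.
    by rewrite indicE memNset//; exact: (states_over_level NM).
  by rewrite !mule0.
have [NM|NM] := eqVneq N M; last first.
  by rewrite !other// eq_sym.
subst M.
have densE (A' B' : set (ext N)) x (y : phase N) : B' `<=` @ext_dom R D N ->
    x != s ->
    flux_density A' (events 0 T B') (before x y) =
    ((norm_const D * weight y.1.1 y.1.2 y.2)%:E *
     ((\1_A' (y.1.1, idx_before N x y.2))%:E *
      (\1_B' ((flow T y.1).1, idx_before N (x - s) y.2))%:E))%E.
  move=> BN xs; rewrite /flux_density /= hitting_time_before.
  do 2 congr (_ * _)%E; rewrite /advance /= indic_states_over.
  have -> : idx_before N x y.2 + T * (sign y.2 / nmass D) = idx_before N (x - s) y.2.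
    by rewrite /idx_before /s; field; rewrite gt_eqF.
  (* If the end of the interval is reached by time T, then x <= s, while membership in [B] would
     need x >= s; the case x = s is excluded. *)
  rewrite -surjective_pairing; case: ltP => // xT; rewrite indicE memNset//.
  move=> /(before_ext_dom BN)/andP[sx _].
  move: xs; rewrite eq_le /s ler_pdivlMr// xT ler_pdivrMr//=.
  by move: sx; rewrite /s subr_ge0 ler_pdivrMr// => ->.
have fP : measure_preserving (phase_measure N) (phase_measure N)
    (fun y : phase N => (flip (total_flow (@dom _ D N) (@flow _ D N) T y.1), - y.2)).
  have tf := total_flow_mpres (@dom_open R D HD N) (@pot_smooth R D HD N) mass_gt0
    (@flow0 R D HD N) (@flow_trajectory R D HD N) T0.
  exact: (mpres_prod (mpres_comp tf (flip_mpres (n := dim D N)))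
    (lebesgue_measure_opp (R := R))).
set f := fun y => _ in fP.
have fE y : dom y.1.1 -> f y = (flip (flow T y.1), - y.2).
  by move=> dy; rewrite /f /total_flow mem_set.
have df y : dom (f y).1.1 <-> dom y.1.1.
  split=> [|dy]; last by rewrite fE//; exact: (flow_in_dom HD).
  have [//|nd] := pselect (dom y.1.1).
  by rewrite /f /total_flow memNset.
have mF := measurable_flux_before u mA oB.
rewrite /flux_at (integral_phase_mpres HD fP df mF); last first.
  by move=> y dy; exact: flux_density_ge0.
apply: (integral_nonzero_mom HD).
- exact: (measurable_phase_comp mF fP.1 (fun y => (df y).2)).
- exact: measurable_flux_before.
- by move=> y dy; apply: (flux_density_ge0 HD) => //; apply: (df y).2.
- by move=> y dy; exact: (flux_density_ge0 HD).
move=> [[q p] r] /= dq r0.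
rewrite fE// densE// densE//; last first.
  by apply: contra u1 => /eqP vs; apply/eqP; move: vs; rewrite /v -/s; lra.
rewrite /= weightNr weightNp.
have E := flow_energy (@dom_open R D HD N) (@pot_smooth R D HD N) mass_gt0
  (@flow0 R D HD N) (@flow_trajectory R D HD N) T (z := (q, p)) dq.
have -> : weight (flow T (q, p)).1 (flow T (q, p)).2 r = weight q p r.
  congr expR; congr (_ * (_ + _)).
  exact: (f_equal (fun x => x + _) E).
have F := flow_reverse (@dom_open R D HD N) (@pot_smooth R D HD N) mass_gt0
  (@flow0 R D HD N) (@flow_trajectory R D HD N) (z := (q, p)) dq T0.
rewrite F /= [in RHS](muleC (\1_B _)%:E) !idx_beforeN//.
have -> : 1 - u = v - s by rewrite /v -/s; ring.
by have -> : 1 - (u - s) = v by rewrite /v -/s; ring.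
Qed.

Lemma flux_events_sym N M (A : set (ext N)) (B : set (ext M)) k T :
  0 <= T -> measurable A -> A `<=` @ext_dom R D N ->
  measurable B -> B `<=` @ext_dom R D M ->
  flux A (events k T B) = flux B (events k T A).
Proof.
move=> T0 mA AN mB BM.
have [mfA ->] := flux_slices HD mA (observable_events k T mB).
have [mfB ->] := flux_slices HD mB (observable_events k T mA).
(* One reflection, u to c - u, covers both cases: c is T / nmass + 1 without event, and T / nmass -
   k with k + 1 events. The excluded points are u = 1 and its mirror image c - 1. *)
pose c := T / nmass D + 1 - k%:R.
have cP := mpres_comp (lebesgue_measure_opp (R := R)) (lebesgue_measure_shift c).
have f0 N' M' (A' : set (ext N')) (B' : set (ext M')) u : measurable B' ->
    (0 <= flux_at A' (events k T B') u)%E.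
  move=> mB'; apply: integral_ge0 => y dy; apply: (flux_density_ge0 HD) => //.
  exact: observable_events.
rewrite [RHS](mpres_integral cP mfB) => [|u]; last exact: f0.
apply: ge0_ae_eq_integral => //.
- exact: (measurableT_comp mfB cP.1).
- by move=> u _; exact: f0.
- by move=> u _; exact: f0.
have null1 (x : R) : (@lebesgue_measure R).-negligible [set x].
  by exists [set x]; split => //; exact: lebesgue_measure_set1.
apply: negligibleS (negligibleU (null1 1) (null1 (c - 1))) => u neq /=.
have [->|u1] := eqVneq u 1; first by left.
have [->|uc] := eqVneq u (c - 1); first by right.
exfalso; apply: neq => _ /=; rewrite [- u + c]addrC.
clear f0 mfA mfB cP; case: k @c uc => [|k] c uc.
  rewrite /c subr0; apply: flux_at_no_event_sym => //.
  by apply: contra uc => /eqP ->; rewrite /c subr0 addrK.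
have cE : c = T / nmass D - k%:R by rewrite /c -natr1; ring.
rewrite cE; apply: flux_at_event_sym => //.
by apply: contra uc => /eqP; rewrite -cE => h; apply/eqP; move: h; lra.
Qed.

End balance.

(** * Kernels on positions, for fixed and random times *)

Section kernels.
Context {R : realType} (D : dhmc R).
Hypothesis HD : dhmc_setting D.
Hypothesis Hsym : proposals_reversible D.

Local Notation vec N := 'rV[R]_(dim D N).
Local Notation mR := (measurableTypeR R).
Local Notation ext N := (vec N * mR)%type.
Local Notation leb N := (@lebesgue_rV R (dim D N)).
Local Notation extm N := (prodm (leb N) (@lebesgue_measure R)).

Lemma phase_kernel_ge0 T (x : state D) C : dom (pos x) ->
  (0 <= phase_kernel T x C)%E.
Proof.
by move=> dx; apply: nneseries_ge0 => k _ _; exact: (kernel_events_ge0 HD).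
Qed.

Lemma levelwise_phase_kernel (C : set (state D)) : good_target C ->
  levelwise_measurable (fun T x => phase_kernel T x C).
Proof.
move=> gC N; apply: ge0_emeasurable_sum => [k z dz _|k _].
  exact: (kernel_events_ge0 HD).
exact: (levelwise_kernel_events HD k gC).
Qed.

Lemma observable_phase_kernel T (C : set (state D)) : good_target C ->
  observable (fun x => phase_kernel T x C).
Proof.
move=> gC; split; last by move=> x; exact: phase_kernel_ge0.
move=> N; have mG := levelwise_phase_kernel gC.
have [mt mq mp mn mr] := @measurable_coords R D N
  [set z : mR * ((vec N * vec N) * (mR * mR)) | dom z.2.1.1].
exact: (levelwise_comp HD (t := fun=> T) mG).
Qed.

(** T = 0 is included because the interval of random times may begin at 0. *)
Lemma dhmc_kernel_balance T : 0 <= T -> detailed_balance (@dhmc_kernel R D T).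
Proof.
move=> T0 N M A B mA AN mB BM.
have gA := good_states_over mA; have gB := good_states_over mB.
apply: (etrans (integral_flux HD mA AN (observable_phase_kernel T gB))).
apply: (etrans _ (esym (integral_flux HD mB BM (observable_phase_kernel T gA)))).
rewrite /phase_kernel (flux_nneseries HD mA); last first.
  by move=> k; exact: observable_events.
rewrite (flux_nneseries HD mB); last by move=> k; exact: observable_events.
by apply: eq_eseriesr => k _; exact: flux_events_sym.
Qed.

Lemma dhmc_kernel_ge0 T N (phi : ext N) M (B : set (ext M)) : dom phi.1 ->
  (0 <= dhmc_kernel T phi B)%E.
Proof.
move=> dphi; apply: integral_ge0 => psi _; apply: mule_ge0.
  by rewrite lee_fin (momentum_density_ge0 HD).
exact: phase_kernel_ge0.
Qed.

Lemma measurable_target N : measurable_fun (@dom _ D N) (@target R D N).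
Proof.
apply: measurable_funM => //; apply: measurableT_comp => //.
apply: measurable_funM => //.
apply: measurable_fun_continuous_rV; first exact: (dom_open HD).
by move=> x dx; have [] := pot_smooth HD [::] dx.
Qed.

(** Measurability jointly in the time and the initial position, as the exchange of the average over
    T with the integral over positions requires. *)
Lemma measurable_dhmc_kernel N M (B : set (ext M)) : measurable B ->
  measurable_fun [set z : mR * ext N | dom z.2.1]
    (fun z => dhmc_kernel z.1 z.2 B).
Proof.
move=> mB; have gB := good_states_over mB.
have mq : measurable_fun setT (fun z : mR * ext N => z.2.1).
  exact: (measurableT_comp measurable_fst measurable_snd).
set E := [set z : mR * ext N | _].
have mE : measurable E.
  by have := mq measurableT _ (@dom_measurable R D HD N); rewrite setTI.
pose H (z : (mR * ext N) * ext N) := ((momentum_density z.2)%:E *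
  phase_kernel z.1.1 (State z.1.2.1 z.2.1 z.1.2.2 z.2.2) (states_over B))%E.
pose F := [set z : (mR * ext N) * ext N | dom z.1.2.1].
have m1 G : measurable_fun G (fun z : (mR * ext N) * ext N => z.1).
  exact: measurable_funTS measurable_fst.
have m2 G : measurable_fun G (fun z : (mR * ext N) * ext N => z.2).
  exact: measurable_funTS measurable_snd.
have m12 G : measurable_fun G (fun z : (mR * ext N) * ext N => z.1.2).
  exact: (measurableT_comp measurable_snd (m1 G)).
have mF : measurable F.
  have := measurableT_comp measurable_fst (m12 setT).
  by move/(_ measurableT _ (@dom_measurable R D HD N)); rewrite setTI.
have mH : measurable_fun setT (H \_ F).
  apply/(measurable_restrictT _ mF); apply: emeasurable_funM.
    apply/measurable_EFinP.
    exact: (measurableT_comp (@measurable_momentum_density R D N) (m2 F)).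
  apply: (levelwise_comp HD (levelwise_phase_kernel gB)) => //.
  - exact: (measurableT_comp measurable_fst (m1 F)).
  - exact: (measurableT_comp measurable_fst (m12 F)).
  - exact: (measurableT_comp measurable_fst (m2 F)).
  - exact: (measurableT_comp measurable_snd (m12 F)).
  - exact: (measurableT_comp measurable_snd (m2 F)).
have H0 z : (0 <= (H \_ F) z)%E.
  apply: patch_ge0 => {}z dz; apply: mule_ge0; last exact: phase_kernel_ge0.
  by rewrite lee_fin (momentum_density_ge0 HD).
have mK : measurable_fun setT (fubini_F (extm N) (H \_ F)).
  exact: measurable_fun_fubini_tonelli_F.
apply: (@eq_measurable_fun _ _ _ _ _ (fubini_F (extm N) (H \_ F))).
  move=> z; rewrite inE => dz; apply: eq_integral => psi _.
  by rewrite /patch mem_set.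
exact: measurable_funTS.
Qed.

(** Tonelli brings the average over T outside, where detailed balance is applied at each fixed T. *)
Lemma random_time_integral Tmin Tmax N M (A : set (ext N)) (B : set (ext M)) :
  Tmin < Tmax -> measurable A -> A `<=` @ext_dom R D N -> measurable B ->
  (\int[extm N]_(phi in A) ((ext_target phi)%:E * random_time_kernel Tmin Tmax phi B) =
   ((Tmax - Tmin)^-1)%:E * \int[@lebesgue_measure R]_(T in `[Tmin, Tmax])
     \int[extm N]_(phi in A) ((ext_target phi)%:E * dhmc_kernel T phi B))%E.
Proof.
move=> TT mA AN mB; set I := `[Tmin, Tmax]%classic.
have mI : measurable I by exact: measurable_itv.
have dA phi : A phi -> dom phi.1 by move=> /AN[].
pose f (z : mR * ext N) := ((ext_target z.2)%:E * dhmc_kernel z.1 z.2 B)%E.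
have mK := @measurable_dhmc_kernel N M B mB.
have mE : measurable [set z : mR * ext N | dom z.2.1].
  have mq : measurable_fun setT (fun z : mR * ext N => z.2.1).
    exact: (measurableT_comp measurable_fst measurable_snd).
  by have := mq measurableT _ (@dom_measurable R D HD N); rewrite setTI.
have mf : measurable_fun setT (f \_ (I `*` A)).
  apply/(measurable_restrictT _ (measurableX mI mA)); apply: emeasurable_funM.
    apply/measurable_EFinP; apply: (measurable_comp (@dom_measurable R D HD N) _
      (@measurable_target N)) => [_ [z [_ /= Az] <-]|]; first exact: dA.
    apply: measurable_funTS.
    exact: (measurableT_comp measurable_fst measurable_snd).
  by apply: measurable_funS mK => // z [_ /= /dA].
have f0 z : (0 <= (f \_ (I `*` A)) z)%E.
  apply: patch_ge0 => {}z [_ /= /dA dz]; apply: mule_ge0.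
    by rewrite lee_fin target_ge0.
  exact: dhmc_kernel_ge0.
have C0 : (0 <= ((Tmax - Tmin)^-1)%:E)%E.
  by rewrite lee_fin invr_ge0 subr_ge0 ltW.
rewrite integral_mkcond.
under eq_integral => phi _.
  rewrite (_ : _ phi = (((Tmax - Tmin)^-1)%:E *
    fubini_G (@lebesgue_measure R) (f \_ (I `*` A)) phi)%E); last first.
    rewrite /patch; case: ifPn => [/set_mem Aphi|nA].
      rewrite /random_time_kernel muleCA; congr (_ * _)%E.
      rewrite -ge0_integralZl//.
      - rewrite integral_mkcond; apply: eq_integral => T _; rewrite /patch.
        have [IT|IT] := pselect (I T); first by rewrite !mem_set.
        by rewrite !memNset// => -[].
      - have mT : measurable_fun I (fun T : mR => (T, phi)).
          exact: measurable_pair_on.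
        by apply: (measurable_comp mE _ mK mT) => _ [T _ <-]; exact: dA.
      - by move=> T _; apply: dhmc_kernel_ge0; exact: dA.
      - by rewrite lee_fin target_ge0.
    rewrite [fubini_G _ _ _]integral0_eq ?mule0// => T _.
    by rewrite /patch memNset// => -[_ /= Aphi]; rewrite mem_set in nA.
  over.
rewrite ge0_integralZl//; last 2 first.
- by apply: measurable_fun_fubini_tonelli_G.
- by move=> phi _; apply: integral_ge0.
congr (_ * _)%E.
(* [fubini_G] integrates over T at fixed position, [fubini_F] over the position at fixed T; the
   passage is through the double integral. *)
rewrite -(@fubini_tonelli2 _ _ _ _ _ (@lebesgue_measure R) (extm N) _ mf f0).
rewrite (@fubini_tonelli1 _ _ _ _ _ (@lebesgue_measure R) (extm N) _ mf f0).
rewrite [RHS]integral_mkcond; apply: eq_integral => T _.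
rewrite /fubini_F [RHS]/patch; case: ifPn => [/set_mem IT|nI].
  rewrite [RHS]integral_mkcond; apply: eq_integral => phi _; rewrite /patch.
  have [Aphi|nA] := pselect (A phi); first by rewrite !mem_set.
  by rewrite !memNset// => -[].
apply: integral0_eq => phi _.
by rewrite /patch memNset// => -[/= IT _]; rewrite mem_set in nI.
Qed.

End kernels.

Theorem theorem3p1 (R : realType) (D : dhmc R)
    (HD : dhmc_setting D) (Hsym : proposals_reversible D) :
  (forall T : R, 0 < T -> detailed_balance (@dhmc_kernel R D T)) /\
  (forall Tmin Tmax : R, 0 <= Tmin -> Tmin < Tmax ->
     detailed_balance (@random_time_kernel R D Tmin Tmax)).
Proof.
split=> [T T0|Tmin Tmax T0 TT]; first exact: (dhmc_kernel_balance HD Hsym (ltW T0)).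
move=> N M A B mA AN mB BM.
apply: (etrans (random_time_integral HD TT mA AN mB)).
apply: (etrans _ (esym (random_time_integral HD TT mB BM mA))).
congr (_ * _)%E; apply: eq_integral => T; rewrite inE /= in_itv/= => /andP[mT _].
exact: (dhmc_kernel_balance HD Hsym (le_trans T0 mT)).
Qed.
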